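(* Let $R<\infty$ and $p\in[1,\infty)$. Let $q>p/3$ also satisfy $q\ge 1$. Then there exist $\tau,\varepsilon>0$ and $C<\infty$ such that for any initial datum $u_0$ satisfying $\|u_0\|_{\mathcal H^p}\le R$, the solution $u=Su_0$ of the modified nonlinear problem (NLS$^*$) and the solution $v$ of the linear problem $iv_t+v_{xx}=0$, $v(0,x)=u_0(x)$, satisfy $$\|u(t,\cdot)-v(t,\cdot)\|_{\mathcal H^q}\le Ct^{\varepsilon}\qquad\text{for all } t\in[0,\tau].$$
   Context: $\mathbb T=\mathbb R/2\pi\mathbb Z$, and $\widehat f(n)=(2\pi)^{-1}\int_{\mathbb T}e^{-inx}f(x)\,dx$ for $n\in\mathbb Z$ (extended to distributions). For $p\in[1,\infty)$, $\mathcal H^{p}=\mathcal H^p(\mathbb T)$ is the space of distributions $f$ on $\mathbb T$ with $\|f\|_{\mathcal H^{p}}=\big(\sum_{n\in\mathbb Z}|\widehat f(n)|^p\big)^{1/p}<\infty$. The parameter $\omega\in\{1,-1\}$ is fixed, and $\mu(|f|^2)=(2\pi)^{-1}\int_{\mathbb T}|f(x)|^2\,dx$. The modified Cauchy problem (NLS$^*$), for $x\in\mathbb T$, $t\ge0$, is $$iu_t+u_{xx}+\omega\big(|u|^2-2\mu(|u|^2)\big)u=0,\qquad u(0,x)=u_0(x),$$ where $\mu(|u|^2)$ means $\mu(|u(t,\cdot)|^2)$. For $u_0\in C^\infty(\mathbb T)$, $Su_0$ is the smooth solution of (NLS$^*$). For each $R<\infty$ there is $\tau_0>0$ such that $S$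 extends by continuity from smooth data to a uniformly continuous mapping from the ball of radius $R$ centered at $0$ in $\mathcal H^p(\mathbb T)$ to $C^0([0,\tau_0],\mathcal H^p(\mathbb T))$; for nonsmooth $u_0\in\mathcal H^p$, $Su_0$ denotes the value of this extension, i.e. the limit of the solutions obtained by approximating $u_0$ in $\mathcal H^p$ by elements of $C^\infty(\mathbb T)$. The solution $v$ of the linear problem is given by $\widehat v(t,n)=e^{-in^2t}\widehat{u_0}(n)$. *)

(* Defs.v *)
From mathcomp Require Import all_boot all_order all_algebra.
From mathcomp Require Import all_classical all_reals all_analysis.
From mathcomp Require Import complex.
Set Implicit Arguments.
Unset Strict Implicit.
Unset Printing Implicit Defensive.
Import Order.TTheory GRing.Theory Num.Theory.
Import numFieldNormedType.Exports.
Local Open Scope classical_set_scope.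
Local Open Scope ring_scope.
Local Open Scope complex_scope.

(* The complex modulus as an element of R (the library's `|z| lies in R[i]). *)
Definition cabs (R : realType) (z : R[i]) : R := ComplexField.Normc.normc z.

Definition cexpi (R : realType) (a : R) : R[i] := cos a +i* sin a.

Definition re_of (R : realType) (f : R -> R[i]) (x : R) : R := complex.Re (f x).
Definition im_of (R : realType) (f : R -> R[i]) (x : R) : R := complex.Im (f x).

Definition cderiv (R : realType) (k : nat) (f : R -> R[i]) (x : R) : R[i] :=
  derive1n k (re_of f) x +i* derive1n k (im_of f) x.

Definition csmooth (R : realType) (f : R -> R[i]) : Prop :=
  forall (k : nat) (x : R),
    derivable (derive1n k (re_of f)) x 1 /\ derivable (derive1n k (im_of f)) x 1.

(* C^oo(T): functions on T = R/2piZ are 2pi-periodic functions on R. *)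
Definition smooth_torus (R : realType) (f : R -> R[i]) : Prop :=
  csmooth f /\ forall x, f (x + 2 * pi) = f x.

Definition torus_int (R : realType) (f : R -> R) : R :=
  Rintegral (@lebesgue_measure R) `[0, 2 * pi] f.

Definition torus_cint (R : realType) (f : R -> R[i]) : R[i] :=
  torus_int (re_of f) +i* torus_int (im_of f).

(* A distribution on T is a continuous linear functional on C^oo(T).  The
   functional is a total function, but only its values on C^oo(T) matter.
   Continuity: |T phi| <= A * max_(k <= N) sup |phi^(k)| for some N and A. *)
Definition functional (R : realType) : Type := (R -> R[i]) -> R[i].

Definition distribution (R : realType) (T : functional R) : Prop :=
  (forall (a : R[i]) (f g : R -> R[i]), smooth_torus f -> smooth_torus g ->
     T (fun x => a * f x + g x) = a * T f + T g) /\
  (exists (N : nat) (A : R), forall (f : R -> R[i]) (M : R), smooth_torus f ->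
     (forall (k : nat) (x : R), (k <= N)%N -> cabs (cderiv k f x) <= M) ->
     cabs (T f) <= A * M).

Definition distr_of_fun (R : realType) (g : R -> R[i]) : functional R :=
  fun f => torus_cint (fun x => f x * g x).

Definition distr_sub (R : realType) (S T : functional R) : functional R :=
  fun f => S f - T f.

Definition fourier (R : realType) (T : functional R) (n : int) : R[i] :=
  ((2 * pi)^-1)%:C * T (fun x => cexpi (- (n%:~R * x))).

(* The H^p norm, with value +oo when the series diverges. *)
Definition Hnorm (R : realType) (p : R) (T : functional R) : \bar R :=
  ((\esum_(n in [set: int]) ((cabs (fourier T n)) `^ p)%:E) `^ (p^-1))%E.

Definition in_H (R : realType) (p : R) (T : functional R) : Prop :=
  distribution T /\ (Hnorm p T < +oo)%E.

Definition dt (R : realType) (g : R -> R -> R) : R -> R -> R :=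
  fun t x => derive1 (fun s => g s x) t.
Definition dx (R : realType) (g : R -> R -> R) : R -> R -> R :=
  fun t x => derive1 (g t) x.

(* An iterated partial derivative, in the order prescribed by a word. *)
Definition partials (R : realType) (w : seq bool) (g : R -> R -> R) :
    R -> R -> R :=
  foldr (fun b h => if b then dt h else dx h) g w.

Definition smooth2 (R : realType) (g : R -> R -> R) : Prop :=
  forall w : seq bool,
    continuous (fun z : R * R => partials w g z.1 z.2) /\
    forall t x : R, derivable (fun s => partials w g s x) t 1 /\
                    derivable (partials w g t) x 1.

Definition re2 (R : realType) (u : R -> R -> R[i]) (t x : R) : R :=
  complex.Re (u t x).
Definition im2 (R : realType) (u : R -> R -> R[i]) (t x : R) : R :=
  complex.Im (u t x).

Definition cdt (R : realType) (u : R -> R -> R[i]) (t x : R) : R[i] :=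
  dt (re2 u) t x +i* dt (im2 u) t x.
Definition cdxx (R : realType) (u : R -> R -> R[i]) (t x : R) : R[i] :=
  dx (dx (re2 u)) t x +i* dx (dx (im2 u)) t x.

Definition mean_sq (R : realType) (f : R -> R[i]) : R :=
  (2 * pi)^-1 * torus_int (fun x => cabs (f x) ^+ 2).

(* Smooth solutions of i u_t + u_xx + omega (|u|^2 - 2 mu(|u|^2)) u = 0 on
   [0,+oo[ x T with datum u0.  Smoothness up to the boundary t = 0 means that u
   is the restriction of a C^oo function on R x T; its values at t < 0 are
   otherwise unconstrained. *)
Definition smooth_NLS_solution (R : realType) (omega : R) (u0 : R -> R[i])
    (u : R -> R -> R[i]) : Prop :=
  [/\ smooth2 (re2 u), smooth2 (im2 u),
      forall t x, u t (x + 2 * pi) = u t x,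
      forall x, u 0 x = u0 x &
      forall t x, 0 <= t ->
        (0 +i* 1) * cdt u t x + cdxx u t x
        + (omega * (cabs (u t x) ^+ 2 - 2 * mean_sq (u t)))%:C * u t x = 0].

Definition in_C0H (R : realType) (p T : R) (u : R -> functional R) : Prop :=
  (forall t, 0 <= t <= T -> in_H p (u t)) /\
  (forall t e : R, 0 <= t <= T -> 0 < e -> exists2 d : R, 0 < d &
     forall s, 0 <= s <= T -> `|s - t| < d ->
       (Hnorm p (distr_sub (u s) (u t)) <= e%:E)%E).

(* u = S u0 on [0,T]: u is the limit in C^0([0,T], H^p) of the smooth solutions
   with data g k in C^oo(T) converging to u0 in H^p.  Where S extends
   continuously to H^p, the limit does not depend on the sequence. *)
Definition NLS_solution (R : realType) (omega p T : R) (u0 : functional R)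
    (u : R -> functional R) : Prop :=
  in_C0H p T u /\
  exists (g : nat -> R -> R[i]) (U : nat -> R -> R -> R[i]),
    [/\ forall k, smooth_torus (g k),
        forall k, smooth_NLS_solution omega (g k) (U k),
        (fun k => Hnorm p (distr_sub (distr_of_fun (g k)) u0)) @ \oo --> 0%E &
        forall e : R, 0 < e -> \forall k \near \oo, forall t, 0 <= t <= T ->
          (Hnorm p (distr_sub (distr_of_fun (U k t)) (u t)) <= e%:E)%E].

(* v solves i v_t + v_xx = 0, v(0) = u0. *)
Definition linear_solution (R : realType) (u0 : functional R)
    (v : R -> functional R) : Prop :=
  forall t, 0 <= t -> distribution (v t) /\
    forall n : int,
      fourier (v t) n = cexpi (- (n%:~R ^+ 2 * t)) * fourier u0 n.

(* Main.v *)
Require Import Defs.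
From mathcomp Require Import all_boot all_order all_algebra.
From mathcomp Require Import all_classical all_reals all_analysis.
From mathcomp Require Import measurable_realfun complex.
From mathcomp Require Import ring lra zify.
Set Implicit Arguments.
Unset Strict Implicit.
Unset Printing Implicit Defensive.
Import Order.TTheory GRing.Theory Num.Theory.
Import numFieldNormedType.Exports.

(** Put [a n t = cexpi (n ^ 2 * t) * coef (u t) n].  For the linear solution [a]
    is constant in time, so the claim is that the [l ^ q] distance from [a t] to
    [a 0] is at most a constant times a power of [t].  The equation becomes
    [a' n = i omega \sum_(j, l) sgn * cexpi (2 (n - j) (n - l) t) * a j * conj (a k) * a l]
    with [k = j + l - n].  The interactions with [j = n] or [l = n] are not
    oscillating; the mean-value term of the equation cancels those in which only
    one of the two equalities holds, and [sgn] is the coefficient that is left.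

    The Picard iterates of this system are superpositions of waves
    [cexpi (2 k t)] whose amplitudes vary slowly.  The cubic term sends three time
    frequencies [t1, t2, t3] to [t1 - t2 + t3 + (n - j) (n - l)], and integrating
    in time over [[0, T]] gains the smaller of [T] and the inverse of the new
    frequency.  Few pairs [(j, l)] share a value of [(n - j) (n - l)], by the
    divisor bound ([card_factorisations_le]); the gain in time therefore controls
    an [l ^ r] norm in the time frequency, for a large [r], and a single Picard step
    preserves a bound in [l ^ p] with respect to [n] if [T] is small
    ([energy_step_le], [total_step_le]).

    That [q] may be smaller than [p] is due to the decay of the interactions.  With a
    part of the gain in time spent on a power of [t], the increment of a Picard
    iterate is bounded by a trilinear sum with kernel
    [<(n - j) (n - l)> ^ (- (1 - 1 / r))].  This kernel almost maps products of
    three sequences in [l ^ p] to [l ^ (p / 3)], as if the sum over [(j, l)] were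
    absent, and it does map them to [l ^ q] for [q > p / 3] once [r] is large
    ([kernel_le]).

    It remains to compare the iterates with the solution.  For smooth data the
    Fourier coefficients decay, so that the solution truncated to the frequencies
    up to [N] solves the truncated system up to an error of order [1 / N]
    ([truncated_evolution]); a Gronwall argument in [l ^ 1] shows that its distance
    to the [m]-th iterate tends to 0 with [2 ^ - m + 1 / N] ([apriori]).  The rate
    depends on the solution, the [l ^ q] bound of the iterates does not, hence it
    holds for the solution ([smooth_solution_bound]).  To bound the iterates in
    [l ^ 1] as well, the [l ^ p] bound is propagated with weights that grow with
    [n], so slowly that they hardly change the norm of the datum ([weight_exists]).
    Finally the bound passes to limits of smooth solutions, because each Fourier
    coefficient converges and the norm is a supremum of finite sums. *)

Local Open Scope ring_scope.

(** * The divisor bound *)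

Lemma size_divisors_prime_pow (p e m : nat) : prime p -> coprime p m -> (0 < m)%N ->
  (size (divisors (p ^ e * m)) <= e.+1 * size (divisors m))%N.
Proof.
move=> pr_p co_pm m_gt0.
pose s := [seq (p ^ i * d)%N | i <- iota 0 e.+1, d <- divisors m].
have <- : size s = (e.+1 * size (divisors m))%N by rewrite size_allpairs size_iota.
apply: uniq_leq_size (divisors_uniq _) _ => x.
have pem_gt0 : (0 < p ^ e * m)%N by rewrite muln_gt0 expn_gt0 prime_gt0.
rewrite -dvdn_divisors // => x_dvd.
have x_gt0 : (0 < x)%N := dvdn_gt0 pem_gt0 x_dvd.
rewrite -(partnC p x_gt0) p_part.
apply/allpairsP; exists (logn p x, x`_p^')%N; split => //.
  rewrite [_.1]/= mem_iota add0n ltnS leq0n andTb.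
  have := dvdn_leq_log p pem_gt0 x_dvd.
  have pe_gt0 : (0 < p ^ e)%N by rewrite expn_gt0 prime_gt0.
  by rewrite (lognM _ pe_gt0 m_gt0) (pfactorK _ pr_p) (logn_coprime co_pm) addn0.
rewrite -dvdn_divisors //.
have co : coprime x`_p^' (p ^ e).
  rewrite coprime_sym coprimeXl // prime_coprime // -p'natE //.
  exact: part_pnat.
by rewrite -(Gauss_dvdr _ co) (dvdn_trans (dvdn_part _ _)).
Qed.

(** Small primes are removed one at a time: a prime power [p ^ e] multiplies the
    number of divisors by [e + 1], and [(e + 1) ^ k <= k ^ k * p ^ e].  When all
    prime factors are at least [2 ^ k], a factor [p ^ e] costs no constant, since
    [(e + 1) ^ k <= (2 ^ e) ^ k <= p ^ e]. *)
Lemma divisors_bound (k : nat) : (0 < k)%N ->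
  exists C : nat, forall n, (0 < n)%N -> (size (divisors n) ^ k <= C * n)%N.
Proof.
move=> k_gt0.
have rough j : exists C : nat, forall n, (0 < n)%N ->
    (forall p, prime p -> (p %| n)%N -> (2 ^ k <= p + j)%N) ->
    (size (divisors n) ^ k <= C * n)%N.
  elim: j => [|j [C IH]].
    exists 1%N; elim/ltn_ind => n IHn n_gt0 big; rewrite mul1n.
    have [n_le1|n_gt1] := leqP n 1.
      by have -> : n = 1%N; [lia | rewrite exp1n].
    have pr_p := pdiv_prime n_gt1; set p := pdiv n in pr_p.
    have p_dvd : (p %| n)%N := pdiv_dvd n.
    pose e := logn p n; pose m := (n`_p^')%N.
    have nE : n = (p ^ e * m)%N by rewrite -[LHS](partnC p n_gt0) p_part.
    have e_gt0 : (0 < e)%N by rewrite logn_gt0 mem_primes pr_p n_gt0.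
    have m_gt0 : (0 < m)%N by exact: part_gt0.
    have co_pm : coprime p m by rewrite prime_coprime // -p'natE //; exact: part_pnat.
    have pe_gt1 : (1 < p ^ e)%N by rewrite -(exp1n e) ltn_exp2r // prime_gt1.
    have lt_mn : (m < n)%N by rewrite nE; nia.
    have IHm : (size (divisors m) ^ k <= m)%N.
      rewrite -[leqRHS]mul1n; apply: IHn => // q pr_q q_dvd; apply: big => //.
      by rewrite nE dvdn_mull.
    rewrite nE.
    apply: (@leq_trans ((e.+1 * size (divisors m)) ^ k)%N).
      by rewrite leq_exp2r //; exact: size_divisors_prime_pow.
    rewrite expnMn; apply: leq_mul => //.
    apply: (@leq_trans ((2 ^ e) ^ k)%N); first by rewrite leq_exp2r // ltn_expl.
    rewrite -expnM mulnC expnM leq_exp2r //.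
    by have := big _ pr_p p_dvd; rewrite addn0.
  exists (k ^ k * C + C)%N => n n_gt0 big.
  have [[p [pr_p p_dvd p_small]]|nobad] :=
      pselect (exists p, [/\ prime p, (p %| n)%N & (p + j < 2 ^ k)%N]); last first.
    apply: (@leq_trans (C * n)%N); last by rewrite mulnDl leq_addl.
    apply: IH => // p pr_p p_dvd; rewrite leqNgt; apply/negP => lt.
    by apply: nobad; exists p.
  have p_eq : (p + j).+1 = (2 ^ k)%N by have := big _ pr_p p_dvd; lia.
  pose e := logn p n; pose m := (n`_p^')%N.
  have nE : n = (p ^ e * m)%N by rewrite -[LHS](partnC p n_gt0) p_part.
  have m_gt0 : (0 < m)%N by exact: part_gt0.
  have co_pm : coprime p m by rewrite prime_coprime // -p'natE //; exact: part_pnat.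
  have IHm : (size (divisors m) ^ k <= C * m)%N.
    apply: IH => // q pr_q q_dvd.
    have q_ge : (2 ^ k <= q + j.+1)%N by apply: big => //; rewrite nE dvdn_mull.
    have q_neq : q != p.
      apply/eqP => qp; move: co_pm; rewrite -qp prime_coprime //.
      by rewrite q_dvd.
    by move/eqP: q_neq; lia.
  apply: (@leq_trans (k ^ k * C * n)%N); last by rewrite mulnDl leq_addr.
  rewrite {2}nE.
  apply: (@leq_trans ((e.+1 * size (divisors m)) ^ k)%N).
    by rewrite {1}nE leq_exp2r //; exact: size_divisors_prime_pow.
  rewrite expnMn.
  apply: (@leq_trans (k ^ k * p ^ e * (C * m))%N); last by rewrite !mulnA leq_mul2r; apply/orP; right; nia.
  apply: leq_mul => //.
  apply: (@leq_trans ((k * 2 ^ (e %/ k)) ^ k)%N).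
    rewrite leq_exp2r //.
    have : (e %/ k < 2 ^ (e %/ k))%N by exact: ltn_expl.
    have := divn_eq e k; have := ltn_pmod e k_gt0; nia.
  rewrite expnMn leq_mul2l; apply/orP; right.
  rewrite -expnM; apply: (@leq_trans (2 ^ e)%N).
    by rewrite leq_exp2l // leq_divM.
  case: (posnP e) => [-> //|e_gt0]; rewrite leq_exp2r //.
  exact: prime_gt1.
have [C HC] := rough (2 ^ k)%N.
by exists C => n n_gt0; apply: HC => // p _ _; rewrite leq_addl.
Qed.

(** * Power inequalities *)

Section PowerInequalities.
Variable R : realType.
Implicit Types (I : Type).

(** Jensen's inequality with weights of arbitrary total mass, by summing Young's
    inequality at the weighted mean of the [y i]. *)
Lemma powR_sum_le I (s : seq I) (P : pred I) (w y : I -> R) (r : R) :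
  1 <= r -> (forall i, 0 <= w i) -> (forall i, 0 <= y i) ->
  (\sum_(i <- s | P i) w i * y i) `^ r <=
  (\sum_(i <- s | P i) w i) `^ (r - 1) * \sum_(i <- s | P i) w i * y i `^ r.
Proof.
move=> r1 w0 y0.
have r0 : 0 < r by lra.
set W := \sum_(i <- s | P i) w i; set S := \sum_(i <- s | P i) w i * y i.
have W0 : 0 <= W by apply: sumr_ge0.
have S0 : 0 <= S by apply: sumr_ge0 => i _; rewrite mulr_ge0.
have Q0 : 0 <= \sum_(i <- s | P i) w i * y i `^ r.
  by apply: sumr_ge0 => i _; rewrite mulr_ge0 ?powR_ge0.
have [->|rn1] := eqVneq r 1.
  rewrite subrr powRr0 mul1r powRr1 //.
  by under eq_bigr do rewrite powRr1 //.
have {rn1} r_gt1 : 1 < r by rewrite lt_neqAle eq_sym rn1.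
have [S00|Sn0] := eqVneq S 0.
  by rewrite S00 powR0 ?gt_eqF // mulr_ge0 ?powR_ge0.
have {Sn0} Spos : 0 < S by rewrite lt_neqAle eq_sym Sn0.
have Wpos : 0 < W.
  rewrite lt_neqAle W0 andbT eq_sym; apply/eqP => W00.
  have : S = 0; last by move=> S00; rewrite S00 ltxx in Spos.
  have wS : forall t : seq I, \sum_(i <- t | P i) w i = 0 -> \sum_(i <- t | P i) w i * y i = 0.
    elim=> [|i t IH]; first by rewrite !big_nil.
    rewrite !big_cons; case: (P i) => // /eqP.
    rewrite paddr_eq0 ?sumr_ge0 // => /andP[/eqP -> /eqP t0].
    by rewrite mul0r add0r IH.
  exact: wS.
pose Y := S / W.
have Y0 : 0 < Y by rewrite divr_gt0.
have pt i : y i * Y `^ (r - 1) <= y i `^ r / r + Y `^ r * (1 - r^-1).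
  have r10 : 0 < r - 1 by lra.
  have := @conjugate_powR R (y i) (Y `^ (r - 1)) r (r / (r - 1)) (y0 i)
     (powR_ge0 _ _) r0 (divr_gt0 r0 r10).
  have e2 : (r - 1) * (r / (r - 1)) = r by field; lra.
  rewrite invf_div -powRrM e2.
  have e : (r - 1) / r = 1 - r^-1 by field; lra.
  by rewrite e; apply; ring.
have : S * Y `^ (r - 1) <= (\sum_(i <- s | P i) w i * y i `^ r) / r + W * (Y `^ r * (1 - r^-1)).
  rewrite /S /W !mulr_suml -big_split /=; apply: ler_sum => i _.
  have := ler_wpM2l (w0 i) (pt i); rewrite mulrDr !mulrA; lra.
have -> : S = W * Y by rewrite /Y mulrC divfK ?gt_eqF.
have YY : Y * Y `^ (r - 1) = Y `^ r by rewrite mulr_powRB1 // ltW.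
rewrite -mulrA YY => key.
rewrite (powRM _ (ltW Wpos) (ltW Y0)).
have WW : W `^ r = W `^ (r - 1) * W by rewrite mulrC mulr_powRB1.
rewrite WW -[leLHS]mulrA; apply: ler_wpM2l; rewrite ?powR_ge0 //.
have ri : 0 < r^-1 by rewrite invr_gt0.
rewrite -(ler_pM2r ri).
move: key; rewrite mulrA; lra.
Qed.

(** Holder's inequality as it is applied below: the [w i] have a bounded sum, and
    the terms pay the price [w i ^ (1 - r)]. *)
Lemma powR_sum_weighted_le I (s : seq I) (P : pred I) (w x : I -> R) (r : R) :
  1 <= r -> (forall i, 0 < w i) -> (forall i, 0 <= x i) ->
  (\sum_(i <- s | P i) x i) `^ r <=
  (\sum_(i <- s | P i) w i) `^ (r - 1) *
    \sum_(i <- s | P i) w i `^ (1 - r) * x i `^ r.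
Proof.
move=> r1 w0 x0.
have r0 : 0 < r by lra.
have := @powR_sum_le I s P w (fun i => x i / w i) r r1
  (fun i => ltW (w0 i)) (fun i => divr_ge0 (x0 i) (ltW (w0 i))).
under eq_bigr => i _ do rewrite mulrC divfK ?gt_eqF //.
move=> /le_trans; apply; apply: ler_wpM2l; rewrite ?powR_ge0 //.
apply: ler_sum => i _; rewrite powRM ?invr_ge0 ?(ltW (w0 i)) //.
rewrite -(powR_inv1 (ltW (w0 i))) -powRrM mulN1r mulrCA [X in _ <= X]mulrC; apply: ler_wpM2l; rewrite ?powR_ge0 //.
by rewrite powRB ?(gt_eqF (w0 i)) ?implybT // powRr1 ?(ltW (w0 i)) // powRN.
Qed.

Lemma powR_sum_concave_le I (s : seq I) (P : pred I) (x : I -> R) (a : R) :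
  0 < a <= 1 -> (forall i, 0 <= x i) ->
  (\sum_(i <- s | P i) x i) `^ a <= \sum_(i <- s | P i) x i `^ a.
Proof.
move=> /andP[a0 a1] x0; elim: s => [|i s IH].
  by rewrite !big_nil powR0 ?gt_eqF.
rewrite !big_cons; case: (P i) => //.
apply: le_trans (_ : x i `^ a + (\sum_(j <- s | P j) x j) `^ a <= _); last first.
  by rewrite lerD2l.
set y := \sum_(j <- s | P j) x j.
have y0 : 0 <= y by apply: sumr_ge0.
have [xy0|xy0] := eqVneq (x i + y) 0.
  by rewrite xy0 powR0 ?gt_eqF // addr_ge0 ?powR_ge0.
have xy : 0 < x i + y by rewrite lt_neqAle eq_sym xy0 addr_ge0.
have h z : 0 <= z -> z <= x i + y -> z / (x i + y) * (x i + y) `^ a <= z `^ a.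
  move=> z0 zle; have [->|zn0] := eqVneq z 0; first by rewrite mul0r mul0r powR_ge0.
  have z_gt0 : 0 < z by rewrite lt_neqAle eq_sym zn0.
  have -> : z `^ a = (z / (x i + y)) `^ a * (x i + y) `^ a.
    by rewrite -powRM ?divfK ?gt_eqF ?divr_ge0 // ltW.
  rewrite ler_wpM2r ?powR_ge0 // ger1_powR // divr_gt0 //=.
  by rewrite ler_pdivrMr // mul1r.
have hx := h (x i) (x0 i); have hy := h y y0.
apply: le_trans (_ : x i / (x i + y) * (x i + y) `^ a + y / (x i + y) * (x i + y) `^ a <= _).
  by rewrite -mulrDl -mulrDl divff // mul1r.
by apply: lerD; [apply: hx; lra | apply: hy; have := x0 i; lra].
Qed.

Lemma powR_add_le (a b r : R) : 0 <= a -> 0 <= b -> 0 <= r ->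
  (a + b) `^ r <= 2 `^ r * (a `^ r + b `^ r).
Proof.
move=> a0 b0 r0.
wlog ab : a b a0 b0 / a <= b.
  move=> h; case: (lerP a b) => [|/ltW] ab; first exact: h.
  by rewrite (addrC a) (addrC (a `^ r)); apply: h.
apply: le_trans (_ : (2 * b) `^ r <= _).
  by apply: ge0_ler_powR; rewrite ?nnegrE; lra.
rewrite powRM //; apply: ler_wpM2l; rewrite ?powR_ge0 //.
by rewrite lerDr powR_ge0.
Qed.

Lemma powR_le_add (x y a : R) : 0 <= x -> 0 <= y -> 0 < a ->
  x * y <= x `^ (1 + a) + y `^ ((1 + a) / a).
Proof.
move=> x0 y0 a0.
have a1 : 0 < 1 + a by lra.
have := @conjugate_powR R x y (1 + a) ((1 + a) / a) x0 y0 a1 (divr_gt0 a1 a0).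
rewrite invf_div => H.
apply: le_trans (H _) _; first by field; lra.
apply: lerD; rewrite ler_piMr ?powR_ge0 //.
  by rewrite invf_le1 //; lra.
by rewrite ler_pdivrMr // mul1r; lra.
Qed.

Lemma mul3_le_cube (a b c : R) : 0 <= a -> 0 <= b -> 0 <= c ->
  a * b * c <= a ^+ 3 + b ^+ 3 + c ^+ 3.
Proof.
move=> a0 b0 c0.
have h (x y z : R) : 0 <= x -> 0 <= y -> 0 <= z -> x <= z -> y <= z -> x * y * z <= z ^+ 3.
  move=> x0 y0 z0 xz yz; rewrite exprS expr2 [leRHS]mulrC ler_wpM2r //.
  exact: ler_pM.
have a3 : 0 <= a ^+ 3 by rewrite exprn_ge0.
have b3 : 0 <= b ^+ 3 by rewrite exprn_ge0.
have c3 : 0 <= c ^+ 3 by rewrite exprn_ge0.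
case: (lerP a b) => [ab|/ltW ab]; case: (lerP b c) => [bc|/ltW bc].
- have := h a b c a0 b0 c0 (le_trans ab bc) bc; lra.
- have := h a c b a0 c0 b0 ab bc; rewrite mulrAC; lra.
- case: (lerP a c) => [ac|/ltW ac].
    have := h a b c a0 b0 c0 ac bc; lra.
  have := h b c a b0 c0 a0 ab ac; rewrite -mulrA mulrC; lra.
- have := h b c a b0 c0 a0 ab (le_trans bc ab); rewrite -mulrA mulrC; lra.
Qed.

Lemma sum_ge0_subset (T : eqType) (s t : seq T) (P : pred T) (f : T -> R) :
  uniq s -> uniq t -> {subset s <= t} -> (forall i, 0 <= f i) ->
  \sum_(i <- s | P i) f i <= \sum_(i <- t | P i) f i.
Proof.
move=> us ut st f0.
rewrite [leRHS](bigID (mem s)) /=.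
have -> : \sum_(i <- t | P i && (i \in s)) f i = \sum_(i <- s | P i) f i.
  rewrite -big_filter -[RHS]big_filter; apply: perm_big.
  apply: uniq_perm; rewrite ?filter_uniq // => i.
  rewrite !mem_filter; case: (boolP (i \in s)) => [/st ->|_]; last by rewrite !andbF.
  by rewrite !andbT.
by rewrite lerDl sumr_ge0.
Qed.

End PowerInequalities.

(** * Integer frequencies and factorisations *)

(** A list of integers, and not a finite type, so that sums over different
    truncations have the same index type and can be shifted. *)
Definition ints (N : nat) : seq int :=
  [seq Posz i | i <- iota 0 N.+1] ++ [seq Negz i | i <- iota 0 N].

Lemma mem_ints N n : (n \in ints N) = (`|n| <= N)%N.
Proof.
rewrite mem_cat; case: n => n.
  rewrite mem_map; last by move=> ? ? [].
  rewrite mem_iota /= add0n ltnS.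
  have -> : (Posz n \in [seq Negz i | i <- iota 0 N]) = false.
    by apply/negbTE/negP => /mapP[].
  by rewrite orbF.
have -> : (Negz n \in [seq Posz i | i <- iota 0 N.+1]) = false.
  by apply/negbTE/negP => /mapP[].
by rewrite mem_map ?mem_iota //; move=> ? ? [].
Qed.

Lemma ints_uniq N : uniq (ints N).
Proof.
rewrite cat_uniq !map_inj_uniq ?iota_uniq; try by move=> ? ? [].
rewrite andbT /=; apply/hasPn => x /mapP[i _ ->].
by apply/negP => /mapP[].
Qed.

Lemma ints_sub (s : seq int) : exists N, {subset s <= ints N}.
Proof.
elim: s => [|x s [N IH]]; first by exists 0%N.
exists (maxn `|x| N)%N => y; rewrite inE => /predU1P[->|/IH].
  by rewrite mem_ints leq_maxl.
by rewrite !mem_ints => /leq_trans; apply; exact: leq_maxr.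
Qed.

(** For [m1 = n - j] and [m2 = n - l], the interactions left over by the
    mean-value term of the equation. *)
Definition admissible (m1 m2 : int) : bool := (m1 == 0) == (m2 == 0).

Section Bracket.
Variable R : realType.
Implicit Types (x y : int).

Definition bracket (x : int) : R := 1 + (absz x)%:R.

Lemma bracket_ge1 x : 1 <= bracket x.
Proof. by rewrite /bracket lerDl ler0n. Qed.

Lemma bracket_gt0 x : 0 < bracket x.
Proof. exact: lt_le_trans (bracket_ge1 x). Qed.

Lemma bracket_ge0 x : 0 <= bracket x.
Proof. exact: ltW (bracket_gt0 x). Qed.

Lemma bracketN x : bracket (- x) = bracket x.
Proof. by rewrite /bracket abszN. Qed.

Lemma bracketD_add x y : bracket (x + y) <= bracket x + bracket y.
Proof.
have : ((absz (x + y))%:R <= (absz x)%:R + (absz y)%:R :> R).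
  by rewrite -natrD ler_nat; lia.
rewrite /bracket; lra.
Qed.

Lemma bracketD x y : bracket (x + y) <= bracket x * bracket y.
Proof.
have h : ((absz (x + y))%:R <= (absz x)%:R + (absz y)%:R :> R).
  by rewrite -natrD ler_nat; lia.
rewrite /bracket mulrDl mul1r mulrDr mulr1.
have : 0 <= (absz x)%:R * (absz y)%:R :> R by rewrite mulr_ge0 ?ler0n.
lra.
Qed.

(** If exactly one of the factors is 0, the right-hand side does not see the
    other: this is where the cancellation encoded in [admissible] matters. *)
Lemma bracketM x y : admissible x y -> bracket x * bracket y <= 4 * bracket (x * y).
Proof.
rewrite /admissible /bracket => ok.
have h : ((1 + absz x) * (1 + absz y) <= 4 * (1 + absz (x * y)%R))%N.
  rewrite abszM; move: ok.
  case: (eqVneq x 0) => [->|x0]; case: (eqVneq y 0) => [->|y0] //= _.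
  have : (0 < `|x|)%N by rewrite absz_gt0.
  have : (0 < `|y|)%N by rewrite absz_gt0.
  nia.
by rewrite -(ler_nat R) !natrM !natrD in h.
Qed.

Lemma bracket_powR_gt0 x (a : R) : 0 < bracket x `^ a.
Proof. by rewrite powR_gt0 // bracket_gt0. Qed.

(** Comparison with a telescoping sum, that of the differences of
    [(1 + k) ^ (1 - s) / (s - 1)]. *)
Lemma sum_bracket_le (s : R) : 1 < s ->
  exists C : R, 0 < C /\ forall t : seq int, uniq t -> \sum_(x <- t) bracket x `^ (- s) <= C.
Proof.
move=> s1; pose a := s - 1; have a0 : 0 < a by rewrite /a; lra.
pose f (k : nat) : R := (1 + k%:R) `^ (- a) / a.
have f0 k : 0 <= f k by rewrite divr_ge0 ?powR_ge0 // ltW.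
have step k : ((1 + k.+1%:R) `^ (- s) : R) <= f k - f k.+1.
  rewrite /f -mulrBl ler_pdivlMr //.
  set x : R := 1 + k%:R; have x1 : 1 <= x by rewrite /x lerDl ler0n.
  have -> : 1 + k.+1%:R = x + 1 :> R by rewrite /x -addn1 natrD addrA.
  have x0 : 0 < x by lra.
  have xx0 : 0 < x + 1 by lra.
  have q0 : 0 < (x + 1) / x by rewrite divr_gt0.
  have -> : x `^ (- a) = (x + 1) `^ (- a) * ((x + 1) / x) `^ a.
    rewrite !powRN powRM ?invr_ge0 ?ltW // -(powR_inv1 (ltW x0)) -powRrM mulN1r powRN.
    by rewrite mulKf // powR_eq0 negb_and gt_eqF.
  have -> : (x + 1) `^ (- s) = (x + 1) `^ (- a) * (x + 1)^-1.
    rewrite -(powR_inv1 (ltW xx0)) -powRD ?(gt_eqF xx0) ?implybT //.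
    by congr (_ `^ _); rewrite /a; ring.
  rewrite -mulrA -[X in _ <= _ - X]mulr1 -mulrBr ler_pM2l ?powR_gt0 //.
  rewrite /powR (gt_eqF q0).
  apply: le_trans (_ : 1 + a * ln ((x + 1) / x) - 1 <= _); last first.
    rewrite lerD2r; apply: expR_ge1Dx.
  have -> : 1 + a * ln ((x + 1) / x) - 1 = a * ln ((x + 1) / x) by ring.
  rewrite [leLHS]mulrC ler_pM2l //.
  have : ln (x / (x + 1)) <= x / (x + 1) - 1.
    have h := @le_ln1Dx R (x / (x + 1) - 1).
    rewrite subrKC in h; apply: h.
    have : 0 < x / (x + 1) by rewrite divr_gt0.
    lra.
  have -> : x / (x + 1) = ((x + 1) / x)^-1 by rewrite invf_div.
  rewrite lnV ?posrE // invf_div.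
  have -> : x / (x + 1) - 1 = - (x + 1)^-1 by field; lra.
  by lra.
have tel N : \sum_(i <- iota 0 N) (1 + i.+1%:R : R) `^ (- s) <= f 0%N - f N.
  elim: N => [|N IH]; first by rewrite big_nil subrr.
  rewrite -addn1 iotaD big_cat /= big_seq1 add0n addn1.
  by have := step N; lra.
exists (1 + f 0%N + f 0%N); split; first by have := f0 0%N; lra.
move=> t ut; have [N tN] := ints_sub t.
apply: le_trans (sum_ge0_subset xpredT ut (ints_uniq N) tN _) _.
  by move=> i; exact: powR_ge0.
rewrite big_cat /= !big_map.
apply: lerD.
  rewrite big_cons /bracket /= addr0 powR1.
  have -> : iota 1 N = [seq i.+1 | i <- iota 0 N] by rewrite (iotaDl 1 0).
  rewrite lerD2l !big_map; apply: (@le_trans _ _ (f 0%N - f N)); last by have := f0 N; lra.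
  exact: tel N.
by apply: (@le_trans _ _ (f 0%N - f N)); [exact: tel N | have := f0 N; lra].
Qed.

(** A pair with product [y != 0] is determined by a divisor of [y] and a sign, and
    for [y = 0] admissibility leaves the pair [(0, 0)] only. *)
Lemma card_factorisations_le (e : R) : 0 < e -> exists C : R, 0 < C /\
  forall (y : int) (s : seq (int * int)), uniq s ->
    all (fun m => admissible m.1 m.2 && (m.1 * m.2 == y)) s ->
    (size s)%:R <= C * bracket y `^ e.
Proof.
move=> e0.
pose k := (Num.truncn e^-1).+1.
have ke : k%:R^-1 <= e.
  rewrite -[leRHS]invrK lef_pV2 ?posrE ?invr_gt0 ?ltr0n //.
  by rewrite ltW // truncnS_gt.
have [D HD] := divisors_bound (ltn0Sn (Num.truncn e^-1)).
rewrite -/k in HD.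
pose C : R := 2 * (1 + D%:R).
have C1 : 1 <= C by have := ler0n R D; rewrite /C; lra.
exists C; split; first by lra.
move=> y s us /allP ok.
have [y0|yn0] := eqVneq y 0.
  have : (size s <= size [:: (0 : int, 0 : int)])%N.
    apply: uniq_leq_size us _ => -[m1 m2] /ok /=; rewrite y0 /admissible mulf_eq0 inE.
    by case: (eqVneq m1 0) => [->|]; case: (eqVneq m2 0) => [->|].
  rewrite /= -(ler_nat R) => /le_trans; apply.
  rewrite y0 /bracket /= addr0 powR1; lra.
pose d := divisors `|y|.
have szle : (size s <= 2 * size d)%N.
  have -> : (2 * size d = size ([seq (Posz i : int, (y %/ (Posz i : int))%Z) | i <- d] ++
       [seq (- (Posz i) : int, (y %/ (- Posz i))%Z) | i <- d]))%N.
    by rewrite size_cat !size_map mul2n addnn.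
  apply: uniq_leq_size us _ => -[m1 m2] /ok /= /andP[_ /eqP m12].
  have m1n0 : m1 != 0 by apply/eqP => m10; rewrite -m12 m10 mul0r eqxx in yn0.
  have md : `|m1|%N \in d by rewrite -dvdn_divisors ?absz_gt0 // -m12 abszM dvdn_mulr.
  have m2E : m2 = (y %/ m1)%Z by rewrite -m12 mulKz.
  rewrite mem_cat; apply/orP; case: (lerP 0 m1) => m1s.
    left; apply/mapP; exists `|m1|%N => //.
    by rewrite gez0_abs // m2E.
  right; apply/mapP; exists `|m1|%N => //.
  by rewrite ltz0_abs // opprK m2E.
have sd : ((size d)%:R : R) <= (1 + D%:R) * bracket y `^ e.
  have H : ((size d)%:R : R) `^ k%:R <= (1 + D%:R) * bracket y.
    rewrite powR_mulrn ?ler0n // -natrX.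
    apply: le_trans (_ : (D * `|y|)%:R <= _); first by rewrite ler_nat HD // absz_gt0.
    rewrite natrM /bracket; apply: ler_pM; rewrite ?ler0n //; lra.
  have k0 : 0 < k%:R :> R by rewrite ltr0n.
  have -> : ((size d)%:R : R) = ((size d)%:R `^ k%:R) `^ (k%:R^-1).
    by rewrite -powRrM divff ?gt_eqF // powRr1 ?ler0n.
  have D1 : 1 <= 1 + D%:R :> R by rewrite lerDl ler0n.
  apply: le_trans (_ : ((1 + D%:R) * bracket y) `^ (k%:R^-1) <= _).
    apply: ge0_ler_powR; rewrite ?nnegrE ?powR_ge0 ?invr_ge0 ?ler0n //.
    by rewrite mulr_ge0 ?bracket_ge0 // (le_trans _ D1).
  rewrite (powRM _ (le_trans ler01 D1) (bracket_ge0 y)).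
  apply: ler_pM; rewrite ?powR_ge0 //.
    by apply: ler1_powR => //; rewrite invf_le1 // ler1n.
  exact: ler_powR (bracket_ge1 y) _ _ ke.
rewrite -(ler_nat R) natrM in szle.
apply: le_trans szle _; rewrite /C -mulrA.
by rewrite ler_pM2l.
Qed.

End Bracket.

(* Only membership matters from here on; simplification must not unfold the list. *)
Global Opaque ints.

(** * Trilinear sums over resonance levels *)

Definition pairs (N : nat) : seq (int * int) :=
  [seq (j, l) | j <- ints N, l <- ints N].

Definition triples (M : nat) : seq (int * int * int) :=
  [seq (x, t) | x <- pairs M, t <- ints M].

(** Two space frequencies [(j, l)], which determine the third one [j + l - n], and
    the time frequencies of the three factors. *)
Definition quintuples (N M : nat) : seq (int * int * (int * int * int)) :=
  [seq (x, y) | x <- pairs N, y <- triples M].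

Definition adm (n : int) (x : int * int) : bool := admissible (n - x.1) (n - x.2).

(** Half of [n ^ 2 - j ^ 2 + k ^ 2 - l ^ 2] when [k = j + l - n]; the free evolution
    makes the interaction oscillate at this frequency. *)
Definition phase (n : int) (x : int * int) : int := (n - x.1) * (n - x.2).

Definition freq (n : int) (x : int * int * (int * int * int)) : int :=
  x.2.1.1 - x.2.1.2 + x.2.2 + phase n x.1.

Lemma pairs_uniq N : uniq (pairs N).
Proof. by apply: allpairs_uniq; rewrite ?ints_uniq // => -[? ?] [? ?]. Qed.

Lemma mem_pairs N j l : ((j, l) \in pairs N) = (j \in ints N) && (l \in ints N).
Proof.
apply/allpairsP/andP => [[[a b] /= [? ? [-> ->]]] //|[? ?]].
by exists (j, l).
Qed.

Lemma sum_partition (V : nmodType) (X S : eqType) (P : pred X) (xs : seq X) (ts : seq S)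
    (g : X -> S) (F : X -> S -> V) : uniq ts ->
  \sum_(t <- ts) \sum_(x <- xs | P x && (g x == t)) F x t =
  \sum_(x <- xs | P x && (g x \in ts)) F x (g x).
Proof.
move=> uts; rewrite (exchange_big_dep P) /=; last by move=> t x _ /andP[].
rewrite [RHS]big_mkcondr /=; apply: eq_bigr => x Px; rewrite Px /=.
case: ifPn => [xin|xnin].
  rewrite (big_rem _ xin) /= eqxx big_seq_cond big_pred0 ?addr0 // => t.
  rewrite mem_rem_uniq // inE; case: (eqVneq t (g x)) => //= tx.
  by rewrite andbC.
rewrite big_seq_cond big_pred0 // => t.
by apply/negbTE/negP => /andP[tin /eqP tx]; rewrite tx tin in xnin.
Qed.

Section Trilinear.
Variable R : realType.
Implicit Types (b : int -> int -> R) (N M : nat) (n : int).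
Local Notation jap := (bracket R).

Lemma big_pairs N (F : int * int -> R) (P : pred (int * int)) :
  \sum_(x <- pairs N | P x) F x =
  \sum_(j <- ints N) \sum_(l <- ints N | P (j, l)) F (j, l).
Proof.
rewrite big_mkcond big_allpairs_dep /=.
by apply: eq_bigr => j _; rewrite -big_mkcond.
Qed.

Lemma big_triples M (F : int * int * int -> R) :
  \sum_(y <- triples M) F y =
  \sum_(t1 <- ints M) \sum_(t2 <- ints M) \sum_(t3 <- ints M) F (t1, t2, t3).
Proof. by rewrite big_allpairs_dep /= big_pairs. Qed.

Lemma big_quintuples N M (F : int * int * (int * int * int) -> R) (P : pred (int * int)) :
  \sum_(x <- quintuples N M | P x.1) F x =
  \sum_(x <- pairs N | P x) \sum_(y <- triples M) F (x, y).
Proof.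
rewrite big_mkcond big_allpairs_dep /= [RHS]big_mkcond /=.
apply: eq_bigr => x _; case: (P x) => //.
by rewrite big1.
Qed.

Definition trip b n (x : int * int * (int * int * int)) : R :=
  b x.1.1 x.2.1.1 * b (x.1.1 + x.1.2 - n) x.2.1.2 * b x.1.2 x.2.2.

(** A bound on the amplitude of the cubic term at time frequency [t], when [b]
    bounds the amplitudes of the unknown. *)
Definition conv b N M n (t : int) : R :=
  \sum_(x <- quintuples N M | adm n x.1 && (freq n x == t)) trip b n x.

Lemma trip_ge0 b n x : (forall i t, 0 <= b i t) -> 0 <= trip b n x.
Proof. by move=> b0; rewrite /trip !mulr_ge0. Qed.

Lemma trip_gt0 b n x : (forall i t, 0 < b i t) -> 0 < trip b n x.
Proof. by move=> b0; rewrite /trip !mulr_gt0. Qed.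

Lemma conv_ge0 b N M n t : (forall i t, 0 <= b i t) -> 0 <= conv b N M n t.
Proof. by move=> b0; apply: sumr_ge0 => x _; exact: trip_ge0. Qed.

Lemma sum_trip (x : int * int) M n b :
  \sum_(y <- triples M) trip b n (x, y) =
  (\sum_(t <- ints M) b x.1 t) * (\sum_(t <- ints M) b (x.1 + x.2 - n) t) *
  (\sum_(t <- ints M) b x.2 t).
Proof.
rewrite big_triples /trip /=.
rewrite -mulrA mulr_suml; apply: eq_bigr => t1 _.
rewrite mulr_suml mulr_sumr; apply: eq_bigr => t2 _.
by rewrite mulrA mulr_sumr.
Qed.

Lemma trip_powR b n x (a : R) : (forall i t, 0 <= b i t) ->
  trip b n x `^ a = trip (fun i t => b i t `^ a) n x.
Proof. by move=> b0; rewrite /trip !powRM ?mulr_ge0. Qed.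

Lemma tripM b c n x : trip b n x * trip c n x = trip (fun i t => b i t * c i t) n x.
Proof. by rewrite /trip; ring. Qed.

Lemma ler_trip b c n x : (forall i t, 0 <= b i t <= c i t) -> trip b n x <= trip c n x.
Proof.
move=> bc; have b0 i t : 0 <= b i t by case/andP: (bc i t).
have bc' i t : b i t <= c i t by case/andP: (bc i t).
by rewrite /trip; apply: ler_pM; rewrite ?mulr_ge0 //; apply: ler_pM.
Qed.

(** For fixed [n] these interactions are factorisations of [t]. *)
Lemma size_resonant_le (e : R) : 0 < e -> exists C : R, 0 < C /\
  forall N n (t : int),
    \sum_(x <- pairs N | adm n x && (phase n x == t)) 1 <= C * jap t `^ e.
Proof.
move=> e0; have [C [C0 HC]] := card_factorisations_le e0.
exists C; split => // N n t.
rewrite -big_filter big_const_seq count_predT iter_addr_0.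
set s := seq.filter _ _.
have -> : size s = size [seq (n - x.1, n - x.2) | x <- s] by rewrite size_map.
apply: HC.
  rewrite map_inj_uniq ?filter_uniq ?pairs_uniq // => -[a b] [c d] /= [h1 h2].
  by congr pair; lia.
apply/allP => x /mapP[y + ->] /=.
by rewrite mem_filter => /andP[].
Qed.

Variables (r s : R).
Hypotheses (r1 : 1 < r) (s1 : 1 < s).

(** The divisor bound loses a power [e] of the phase, which is a combination of
    [t] and of the three time frequencies; the weights have room for the loss in the
    latter as [e < s - 1]. *)
Lemma sum_weight_le (e : R) : 0 < e -> e < s - 1 -> exists C : R, 0 < C /\
  forall N M n (t : int),
    \sum_(x <- quintuples N M | adm n x.1 && (freq n x == t))
      trip (fun _ u => jap u `^ (- s)) n x <= C * jap t `^ e.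
Proof.
move=> e0 es; have [C [C0 HC]] := size_resonant_le e0.
have se : 1 < s - e by lra.
have [D [D0 HD]] := sum_bracket_le se.
exists (C * D ^+ 3); split; first by rewrite mulr_gt0 // exprn_gt0.
move=> N M n t.
pose w (y : int * int * int) : R := jap y.1.1 `^ (- s) * jap y.1.2 `^ (- s) * jap y.2 `^ (- s).
have -> : \sum_(x <- quintuples N M | adm n x.1 && (freq n x == t))
      trip (fun _ u => jap u `^ (- s)) n x =
    \sum_(y <- triples M) w y *
       \sum_(x <- pairs N | adm n x && (phase n x == t - y.1.1 + y.1.2 - y.2)) 1.
  rewrite big_mkcondr /= (big_quintuples _ _ _ (adm n)) exchange_big /=.
  apply: eq_bigr => y _; rewrite mulr_sumr [RHS]big_mkcondr.
  apply: eq_bigr => x _; rewrite mulr1 /freq /=.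
  have -> : (y.1.1 - y.1.2 + y.2 + phase n x == t) = (phase n x == t - y.1.1 + y.1.2 - y.2).
    by apply/eqP/eqP => h; lia.
  by [].
pose v (_ u : int) : R := jap u `^ (- (s - e)).
apply: le_trans (_ : \sum_(y <- triples M) C * jap t `^ e * trip v 0 ((0, 0), y) <= _).
  apply: ler_sum => y _.
  apply: le_trans (_ : w y * (C * jap (t - y.1.1 + y.1.2 - y.2) `^ e) <= _).
    by apply: ler_wpM2l (HC _ _ _); rewrite /w !mulr_ge0 ?powR_ge0.
  have jle : jap (t - y.1.1 + y.1.2 - y.2) `^ e <=
      jap t `^ e * jap y.1.1 `^ e * jap y.1.2 `^ e * jap y.2 `^ e.
    rewrite -!powRM ?mulr_ge0 ?bracket_ge0 //.
    apply: ge0_ler_powR; rewrite ?nnegrE ?mulr_ge0 ?bracket_ge0 ?(ltW e0) //.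
    apply: le_trans (bracketD _ _ _) _; rewrite bracketN ler_wpM2r ?bracket_ge0 //.
    apply: le_trans (bracketD _ _ _) _; rewrite ler_wpM2r ?bracket_ge0 //.
    by apply: le_trans (bracketD _ _ _) _; rewrite bracketN.
  rewrite mulrCA -mulrA ler_pM2l //.
  apply: le_trans (ler_wpM2l _ jle) _; first by rewrite /w !mulr_ge0 ?powR_ge0.
  rewrite /w /trip /v /=.
  have jj u : jap u `^ (- (s - e)) = jap u `^ (- s) * jap u `^ e.
    rewrite -powRD ?(gt_eqF (bracket_gt0 _ _)) ?implybT //.
    by congr (_ `^ _); ring.
  by rewrite !jj le_eqVlt; apply/orP; left; apply/eqP; ring.
rewrite -mulr_sumr sum_trip /= /v.
have -> : C * D ^+ 3 * jap t `^ e = C * jap t `^ e * (D * D * D) by ring.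
rewrite ler_wpM2l ?mulr_ge0 ?powR_ge0 ?(ltW C0) //.
have S0 : 0 <= \sum_(t0 <- ints M) jap t0 `^ (- (s - e)) by apply: sumr_ge0 => i _; exact: powR_ge0.
have SD := HD _ (ints_uniq M).
by apply: ler_pM; rewrite ?mulr_ge0 //; apply: ler_pM.
Qed.

(** The weight is the one for which Holder's inequality bounds the sum of [b n]
    by a multiple of [energy b M n ^ (1 / r)]. *)
Definition energy b M n : R := \sum_(t <- ints M) jap t `^ (s * (r - 1)) * b n t `^ r.

Lemma energy_ge0 b M n : 0 <= energy b M n.
Proof. by apply: sumr_ge0 => t _; rewrite mulr_ge0 ?powR_ge0. Qed.

(** Holder's inequality with the weights of [sum_weight_le]; the interactions are
    partitioned by their time frequency, so the sum over [t] removes the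
    restriction to a level of [freq]. *)
Lemma sum_conv_powR_le (e : R) : 0 < e -> e < s - 1 -> exists C : R, 0 < C /\
  forall N M M' n b, (forall i t, 0 <= b i t) ->
    \sum_(t <- ints M') jap t `^ (- (e * (r - 1))) * conv b N M n t `^ r <=
    C * \sum_(x <- pairs N | adm n x)
      energy b M x.1 * energy b M (x.1 + x.2 - n) * energy b M x.2.
Proof.
move=> e0 es; have [C [C0 HC]] := sum_weight_le e0 es.
have r0 : 0 < r by move: r1; lra.
exists (C `^ (r - 1)); split; first exact: powR_gt0.
move=> N M M' n b b0.
pose w (_ u : int) : R := jap u `^ (- s).
pose f (i u : int) : R := jap u `^ (s * (r - 1)) * b i u `^ r.
have f0 i u : 0 <= f i u by rewrite mulr_ge0 ?powR_ge0.
have step t : jap t `^ (- (e * (r - 1))) * conv b N M n t `^ r <=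
   C `^ (r - 1) * \sum_(x <- quintuples N M | adm n x.1 && (freq n x == t)) trip f n x.
  have := powR_sum_weighted_le (quintuples N M)
     (fun x => adm n x.1 && (freq n x == t)) (ltW r1)
     (fun x => trip_gt0 n x (fun _ u => bracket_powR_gt0 u (- s)))
     (fun x => trip_ge0 n x b0).
  rewrite -/(conv b N M n t) => H.
  have -> : \sum_(x <- quintuples N M | adm n x.1 && (freq n x == t)) trip f n x =
    \sum_(x <- quintuples N M | adm n x.1 && (freq n x == t))
       (trip w n x) `^ (1 - r) * trip b n x `^ r.
    apply: eq_bigr => x _; rewrite !trip_powR; [|by []|by move=> *; exact: powR_ge0].
    rewrite tripM; congr (trip _ n x); apply/funext => i; apply/funext => u.
    by rewrite /f /w -powRrM; congr (_ `^ _ * _); ring.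
  apply: le_trans (ler_wpM2l (powR_ge0 _ _) H) _.
  rewrite mulrA ler_wpM2r //.
    by apply: sumr_ge0 => x _; rewrite mulr_ge0 ?powR_ge0.
  apply: le_trans (_ : jap t `^ (- (e * (r - 1))) * (C * jap t `^ e) `^ (r - 1) <= _).
    rewrite ler_wpM2l ?powR_ge0 //; apply: ge0_ler_powR; rewrite ?nnegrE //; first by move: r1; lra.
    - by apply: sumr_ge0 => x _; rewrite trip_ge0 // => *; exact: powR_ge0.
    - by rewrite mulr_ge0 ?powR_ge0 // ltW.
  rewrite powRM ?powR_ge0 ?(ltW C0) // -powRrM mulrCA -powRD ?(gt_eqF (bracket_gt0 _ _)) ?implybT //.
  by rewrite addNr powRr0 mulr1.
apply: le_trans (_ : C `^ (r - 1) * \sum_(t <- ints M')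
  \sum_(x <- quintuples N M | adm n x.1 && (freq n x == t)) trip f n x <= _).
  by rewrite mulr_sumr; apply: ler_sum => t _; exact: step.
rewrite ler_pM2l ?powR_gt0 //.
rewrite (sum_partition (fun x => adm n x.1) _ (fun x => freq n x) (fun x _ => trip f n x) (ints_uniq M')).
apply: le_trans (_ : \sum_(x <- quintuples N M | adm n x.1) trip f n x <= _).
  rewrite [leRHS](bigID (fun x => freq n x \in ints M')) /= lerDl sumr_ge0 // => x _.
  exact: trip_ge0.
rewrite (big_quintuples _ _ _ (adm n)) le_eqVlt; apply/orP; left; apply/eqP.
by apply: eq_bigr => x _; rewrite sum_trip.
Qed.

End Trilinear.

(** * Trilinear sums with a decay in the time frequency *)

Section TimeFrequencies.
Variable R : realType.
Implicit Types (b : int -> int -> R) (N M : nat) (n : int).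
Local Notation jap := (bracket R).

Lemma sum_shift_le N (f : int -> R) (h : int -> int) : (forall k, 0 <= f k) ->
  (forall k, k \notin ints N -> f k = 0) -> injective h ->
  \sum_(n <- ints N) f (h n) <= \sum_(k <- ints N) f k.
Proof.
move=> f0 fN hinj.
rewrite -(big_map h xpredT f) (bigID (fun k => k \in ints N)) /=.
rewrite [X in _ + X]big1 ?addr0; last by move=> k /fN.
rewrite -big_filter; apply: sum_ge0_subset => //.
- by apply: filter_uniq; rewrite map_inj_uniq // ints_uniq.
- exact: ints_uniq.
- by move=> k; rewrite mem_filter => /andP[].
Qed.

(** For fixed [j] and [l] the map [n |-> j + l - n] is injective, so the sum over
    [n] is that of the middle factor. *)
Lemma sum_trilinear_le N (x y z : int -> R) : (forall k, 0 <= x k) ->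
  (forall k, 0 <= y k) -> (forall k, 0 <= z k) -> (forall k, k \notin ints N -> y k = 0) ->
  \sum_(n <- ints N) \sum_(jl <- pairs N) x jl.1 * y (jl.1 + jl.2 - n) * z jl.2 <=
  (\sum_(k <- ints N) x k) * (\sum_(k <- ints N) y k) * (\sum_(k <- ints N) z k).
Proof.
move=> x0 y0 z0 yN; rewrite exchange_big /= (big_pairs N _ xpredT) /=.
set S := \sum_(k <- ints N) y k.
apply: le_trans (_ : \sum_(j <- ints N) \sum_(l <- ints N) x j * S * z l <= _).
  apply: ler_sum => j _; apply: ler_sum => l _.
  rewrite -mulr_suml -mulr_sumr ler_wpM2r // ler_wpM2l //.
  apply: (@sum_shift_le N y (fun n => j + l - n)) => // a b; lia.
clearbody S; rewrite !mulr_suml; apply: ler_sum => j _.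
by rewrite mulr_sumr.
Qed.

Lemma sum_triple_le N (x : int -> R) : (forall k, 0 <= x k) ->
  (forall k, k \notin ints N -> x k = 0) ->
  \sum_(n <- ints N) \sum_(jl <- pairs N) x jl.1 * x (jl.1 + jl.2 - n) * x jl.2 <=
  (\sum_(k <- ints N) x k) ^+ 3.
Proof.
move=> x0 xN; apply: le_trans (sum_trilinear_le x0 x0 x0 xN) _.
by rewrite exprSr expr2.
Qed.

(** As [jap y <= jap t + jap (t + y)], a factor [jap y ^ (-1)] can be taken out, and
    at most [2 * jap t ^ (- s) + jap (t + y) ^ (- s)] is left. *)
Lemma sum_bracket_shift_le (s : R) : 1 < s -> exists C : R, 0 < C /\
  forall M (y : int),
    \sum_(t <- ints M) jap t `^ (- s) * jap (t + y) `^ (-1) <= C * jap y `^ (-1).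
Proof.
move=> s1; have [C [C0 HC]] := sum_bracket_le s1.
exists (3 * C); split; first by rewrite mulr_gt0.
move=> M y.
apply: le_trans (_ : \sum_(t <- ints M) (2 * jap t `^ (- s) + jap (t + y) `^ (- s)) *
    jap y `^ (-1) <= _); last first.
  rewrite -mulr_suml ler_wpM2r ?powR_ge0 // big_split /= -mulr_sumr.
  have h1 := HC _ (ints_uniq M).
  have h2 : \sum_(t <- ints M) jap (t + y) `^ (- s) <= C.
    rewrite -(big_map (fun t => t + y) xpredT (fun t => jap t `^ (- s))); apply: HC.
    by rewrite map_inj_uniq ?ints_uniq // => a b /addIr.
  lra.
apply: ler_sum => t _.
rewrite !powR_inv1 ?bracket_ge0 // ler_pdivlMr ?bracket_gt0 //.
set a := jap t; set c := jap (t + y).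
have a1 : 1 <= a := bracket_ge1 _ _; have c1 : 1 <= c := bracket_ge1 _ _.
have ac : jap y <= a + c.
  have -> : y = - t + (t + y) by ring.
  by apply: le_trans (bracketD_add _ _ _) _; rewrite bracketN.
have c0 : 0 < c by lra.
have a0 : 0 < a by lra.
apply: le_trans (_ : a `^ (- s) / c * (a + c) <= _).
  by rewrite ler_wpM2l // mulr_ge0 ?powR_ge0 // invr_ge0 ltW.
rewrite mulrDr divfK ?gt_eqF //.
rewrite (_ : 2 * _ + _ = a `^ (- s) + c `^ (- s) + a `^ (- s)); last by ring.
rewrite lerD2r.
have -> : a `^ (- s) / c * a = a `^ (1 - s) * c `^ (- 1).
  rewrite powR_inv1 ?(ltW c0) // mulrAC; congr (_ * _).
  by rewrite powRD ?powRr1 ?(gt_eqF a0) ?implybT ?(ltW a0) // mulrC.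
case: (lerP a c) => [ac'|/ltW ca].
- apply: le_trans (_ : a `^ (1 - s) * a `^ (-1) <= _).
    rewrite ler_wpM2l ?powR_ge0 // !powRN !powRr1 ?(ltW a0) ?(ltW c0) //.
    by rewrite lef_pV2 ?posrE.
  rewrite -powRD ?(gt_eqF a0) ?implybT // (_ : 1 - s - 1 = - s); last by ring.
  by rewrite lerDl powR_ge0.
- apply: le_trans (_ : c `^ (1 - s) * c `^ (-1) <= _).
    rewrite ler_wpM2r ?powR_ge0 //.
    rewrite -opprB !powRN lef_pV2 ?posrE ?powR_gt0 //.
    by apply: ge0_ler_powR; rewrite ?nnegrE ?(ltW a0) ?(ltW c0) //; lra.
  rewrite -powRD ?(gt_eqF c0) ?implybT // (_ : 1 - s - 1 = - s); last by ring.
  by rewrite lerDr powR_ge0.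
Qed.

(** The time frequencies are summed one after the other; each sum keeps the decay
    of order 1 in the shift. *)
Lemma sum_weight_freq_le (s : R) : 1 < s -> exists C : R, 0 < C /\
  forall M n (x : int * int),
    \sum_(y <- triples M) trip (fun _ u => jap u `^ (- s)) n (x, y) *
       jap (freq n (x, y)) `^ (-1) <= C * jap (phase n x) `^ (-1).
Proof.
move=> s1; have [C [C0 HC]] := sum_bracket_shift_le s1.
exists (C ^+ 3); split; first by rewrite exprn_gt0.
move=> M n x; rewrite big_triples /trip /freq /=.
under eq_bigr => t1 _ do under eq_bigr => t2 _ do
  under eq_bigr => t3 _ do rewrite -[X in X * _ * _ * _]mulr1.
have w0 (u : int) : 0 <= jap u `^ (- s) := powR_ge0 _ _.
have v0 (u : int) : 0 <= jap u `^ (- 1) := powR_ge0 _ _.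
pose w u := jap u `^ (- s).
have wge0 u : 0 <= w u by exact: powR_ge0.
apply: le_trans (_ : \sum_(t1 <- ints M) \sum_(t2 <- ints M)
   w t1 * w t2 * (C * jap (t1 - t2 + phase n x) `^ (-1)) <= _).
  apply: ler_sum => t1 _; apply: ler_sum => t2 _.
  apply: le_trans (_ : \sum_(t3 <- ints M) w t1 * w t2 *
    (w t3 * jap (t3 + (t1 - t2 + phase n x)) `^ (-1)) <= _).
    apply: ler_sum => t3 _; rewrite /w mulr1 -!mulrA.
    by rewrite (_ : t3 + (t1 - t2 + phase n x) = t1 - t2 + t3 + phase n x) //; ring.
  by rewrite -mulr_sumr; apply: ler_wpM2l (HC _ _); rewrite mulr_ge0.
apply: le_trans (_ : \sum_(t1 <- ints M) w t1 * (C * (C * jap (t1 + phase n x) `^ (-1))) <= _).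
  apply: ler_sum => t1 _.
  apply: le_trans (_ : \sum_(t2 <- ints M) w t1 * C *
    (w t2 * jap (t2 + (- (t1 + phase n x))) `^ (-1)) <= _).
    apply: ler_sum => t2 _.
    rewrite (_ : jap (t2 - (t1 + phase n x)) = jap (t1 - t2 + phase n x)); last first.
      by rewrite -bracketN; congr (bracket _ _); ring.
    by rewrite le_eqVlt; apply/orP; left; apply/eqP; ring.
  rewrite -mulr_sumr; apply: le_trans (ler_wpM2l _ (HC _ _)) _.
    by rewrite mulr_ge0 ?(ltW C0).
  by rewrite bracketN -!mulrA.
under eq_bigr do rewrite mulrCA [in X in _ * X]mulrCA.
rewrite -mulr_sumr -mulr_sumr exprS expr2 -!mulrA.
rewrite ler_pM2l // ler_pM2l //; exact: HC.
Qed.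

Variables (r s : R).
Hypotheses (r1 : 1 < r) (s1 : 1 < s).

(** Holder's inequality with the weights of [sum_weight_freq_le].  Here the decay
    in the time frequency is converted into a decay in the phase, which is what
    allows [q] to be smaller than [p]. *)
Lemma sum_conv_bracket_le (e : R) : 0 < e -> e <= r^-1 -> exists C : R, 0 < C /\
  forall N M M' n b, (forall i t, 0 <= b i t) ->
    \sum_(t <- ints M') conv b N M n t * jap t `^ (-1 + e) <=
    C * \sum_(x <- pairs N | adm n x) jap (phase n x) `^ (- (1 - r^-1)) *
      (energy r s b M x.1 `^ (r^-1) * energy r s b M (x.1 + x.2 - n) `^ (r^-1) *
       energy r s b M x.2 `^ (r^-1)).
Proof.
move=> e0 er; have [C [C0 HC]] := sum_weight_freq_le s1.
have r0 : 0 < r by move: r1; lra.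
have rn0 : r != 0 by rewrite gt_eqF.
exists (C `^ (1 - r^-1)); split; first exact: powR_gt0.
move=> N M M' n b b0.
pose w (_ u : int) : R := jap u `^ (- s).
pose f (i u : int) : R := jap u `^ (s * (r - 1)) * b i u `^ r.
have f0 i u : 0 <= f i u by rewrite mulr_ge0 ?powR_ge0.
apply: le_trans (_ : \sum_(x <- quintuples N M | adm n x.1)
    trip b n x * jap (freq n x) `^ (-1 + e) <= _).
  under eq_bigr do rewrite mulr_suml.
  rewrite (sum_partition (fun x => adm n x.1) _ (fun x => freq n x)
     (fun x t => trip b n x * jap t `^ (-1 + e)) (ints_uniq M')).
  rewrite [leRHS](bigID (fun x => freq n x \in ints M')) /= lerDl sumr_ge0 // => x _.
  by rewrite mulr_ge0 ?powR_ge0 ?trip_ge0.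
rewrite (big_quintuples _ _ _ (adm n)) mulr_sumr; apply: ler_sum => x _.
set Z := \sum_(y <- triples M) _.
have Z0 : 0 <= Z by apply: sumr_ge0 => y _; rewrite mulr_ge0 ?powR_ge0 ?trip_ge0.
have key : Z `^ r <= (C * jap (phase n x) `^ (-1)) `^ (r - 1) *
   (energy r s b M x.1 * energy r s b M (x.1 + x.2 - n) * energy r s b M x.2).
  have wp y : 0 < trip w n (x, y) * jap (freq n (x, y)) `^ (-1).
    by rewrite mulr_gt0 ?bracket_powR_gt0 // trip_gt0 // => i u; exact: bracket_powR_gt0.
  have zp y : 0 <= trip b n (x, y) * jap (freq n (x, y)) `^ (-1 + e).
    by rewrite mulr_ge0 ?powR_ge0 ?trip_ge0.
  have := powR_sum_weighted_le (triples M) xpredT (ltW r1) wp zp.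
  rewrite -/Z => /le_trans; apply; apply: ler_pM; rewrite ?powR_ge0 //.
  - by apply: sumr_ge0 => y _; rewrite mulr_ge0 ?powR_ge0.
  - apply: ge0_ler_powR; rewrite ?nnegrE ?HC //; first by move: r1; lra.
    + by apply: sumr_ge0 => y _; exact: ltW.
    + by rewrite mulr_ge0 ?powR_ge0 ?(ltW C0).
  - apply: (@le_trans _ _ (\sum_(y <- triples M) trip f n (x, y))); last by rewrite sum_trip.
    apply: ler_sum => y _.
    have j0 := bracket_gt0 R (freq n (x, y)).
    have tw0 : 0 <= trip w n (x, y) by apply: trip_ge0 => i u; exact: powR_ge0.
    have tb0 : 0 <= trip b n (x, y) by exact: trip_ge0.
    rewrite (powRM _ tw0 (powR_ge0 _ _)) (powRM _ tb0 (powR_ge0 _ _)).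
    rewrite mulrACA -!powRrM -powRD ?(gt_eqF j0) ?implybT //.
    rewrite !trip_powR; [|by []|by move=> i u; exact: powR_ge0].
    rewrite tripM.
    rewrite -[leRHS]mulr1; apply: ler_pM; rewrite ?powR_ge0 //.
    + by apply: trip_ge0 => i u; rewrite mulr_ge0 ?powR_ge0.
    + apply: ler_trip => i u; rewrite mulr_ge0 ?powR_ge0 //=.
      by rewrite /w -powRrM (_ : - s * (1 - r) = s * (r - 1)) //; ring.
    + rewrite (_ : -1 * (1 - r) + (-1 + e) * r = e * r - 1); last by ring.
      have er1 : e * r <= 1 by rewrite -(mulVf rn0) ler_pM2r.
      rewrite -[leRHS](powRr0 (jap (freq n (x, y)))).
      by apply: ler_powR; [exact: bracket_ge1 | lra].
have -> : Z = (Z `^ r) `^ (r^-1) by rewrite -powRrM divff // powRr1.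
have En := fun i => energy_ge0 r s b M i.
apply: le_trans (_ : ((C * jap (phase n x) `^ (-1)) `^ (r - 1) *
   (energy r s b M x.1 * energy r s b M (x.1 + x.2 - n) * energy r s b M x.2)) `^ (r^-1) <= _).
  apply: ge0_ler_powR; rewrite ?nnegrE ?powR_ge0 ?invr_ge0 ?(ltW r0) //.
  by rewrite !mulr_ge0 ?powR_ge0.
rewrite !powRM ?mulr_ge0 ?powR_ge0 ?(ltW C0) //.
rewrite -!powRrM -mulrA (_ : (r - 1) * r^-1 = 1 - r^-1); last by field.
by rewrite mulN1r.
Qed.

End TimeFrequencies.

(** * The kernel estimate *)

Section Kernel.
Variable R : realType.
Implicit Types (N M : nat) (n : int).
Local Notation jap := (bracket R).

Lemma sum_bracket_sub_le (u : R) : 1 < u -> exists C : R, 0 < C /\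
  forall N n, \sum_(j <- ints N) jap (n - j) `^ (- u) <= C.
Proof.
move=> u1; have [C [C0 HC]] := sum_bracket_le u1; exists C; split => // N n.
rewrite -(big_map (fun j => n - j) xpredT (fun j => jap j `^ (- u))); apply: HC.
by rewrite map_inj_uniq ?ints_uniq // => a b h; lia.
Qed.

Lemma bracket_subC (i j : int) : jap (i - j) = jap (j - i).
Proof. by rewrite -bracketN opprB. Qed.

(** In each term the sums over the two variables on which [W] does not depend come
    first, and the two brackets make them converge. *)
Lemma sum_bracket2_cube_le (u : R) : 1 < u -> exists C : R, 0 < C /\
  forall N (W : int -> R), (forall k, 0 <= W k) -> (forall k, k \notin ints N -> W k = 0) ->
   \sum_(n <- ints N) \sum_(x <- pairs N)
      (jap (n - x.1) * jap (n - x.2)) `^ (- u) * (W x.1 + W (x.1 + x.2 - n) + W x.2)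
   <= C * \sum_(k <- ints N) W k.
Proof.
move=> u1; have [C [C0 HC]] := sum_bracket_sub_le u1.
exists (3 * C ^+ 2); split; first by rewrite mulr_gt0 // exprn_gt0.
move=> N W W0 WN; set S := \sum_(k <- ints N) W k.
pose w i := jap i `^ (- u); have w0 i : 0 <= w i := powR_ge0 _ _.
have wC n : \sum_(j <- ints N) w (n - j) <= C := HC N n.
have wC' n : \sum_(j <- ints N) w (j - n) <= C.
  by under eq_bigr do rewrite /w bracket_subC; exact: wC.
have A1 : \sum_(n <- ints N) \sum_(j <- ints N) \sum_(l <- ints N) w (n - j) * w (n - l) * W j <= C * C * S.
  rewrite exchange_big /= /S mulr_sumr; apply: ler_sum => j _.
  apply: le_trans (_ : \sum_(n <- ints N) W j * C * w (n - j) <= _).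
    apply: ler_sum => n _; under eq_bigr do rewrite mulrAC.
    rewrite -mulr_sumr (_ : W j * C * w (n - j) = w (n - j) * W j * C); last by ring.
    by apply: ler_wpM2l; [rewrite mulr_ge0 | exact: wC].
  rewrite -mulr_sumr (_ : C * C * W j = W j * C * C); last by ring.
  by apply: ler_wpM2l; [rewrite mulr_ge0 // ltW | exact: wC'].
have A3 : \sum_(n <- ints N) \sum_(j <- ints N) \sum_(l <- ints N) w (n - j) * w (n - l) * W l <= C * C * S.
  apply: le_trans A1; rewrite le_eqVlt; apply/orP; left; apply/eqP.
  apply: eq_bigr => n _; rewrite exchange_big /=; apply: eq_bigr => l _.
  by apply: eq_bigr => j _; rewrite [w (n - j) * _]mulrC.
have A2 : \sum_(n <- ints N) \sum_(j <- ints N) \sum_(l <- ints N) w (n - j) * w (n - l) * W (j + l - n) <= C * C * S.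
  rewrite exchange_big /=; under eq_bigr do rewrite exchange_big /=.
  apply: le_trans (_ : \sum_(j <- ints N) \sum_(l <- ints N) \sum_(k <- ints N)
      w (l - k) * w (j - k) * W k <= _).
    apply: ler_sum => j _; apply: ler_sum => l _.
    apply: le_trans (@sum_shift_le R N (fun k => w (l - k) * w (j - k) * W k)
       (fun n => j + l - n) _ _ _).
    - rewrite le_eqVlt; apply/orP; left; apply/eqP; apply: eq_bigr => n _.
      by congr (w _ * w _ * _); ring.
    - by move=> k; rewrite !mulr_ge0.
    - by move=> k /WN ->; rewrite mulr0.
    - by move=> a b; lia.
  under eq_bigr do rewrite exchange_big /=.
  rewrite exchange_big /= /S mulr_sumr; apply: ler_sum => k _.
  apply: le_trans (_ : \sum_(j <- ints N) W k * C * w (j - k) <= _).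
    apply: ler_sum => j _; rewrite (_ : W k * C * w (j - k) = C * (w (j - k) * W k)); last by ring.
    under eq_bigr do rewrite -mulrA.
    by rewrite -mulr_suml; apply: ler_wpM2r; [rewrite mulr_ge0 | exact: wC'].
  rewrite -mulr_sumr (_ : C * C * W k = W k * C * C); last by ring.
  by apply: ler_wpM2l; [rewrite mulr_ge0 // ltW | exact: wC'].
rewrite (eq_bigr (fun n => \sum_(j <- ints N) \sum_(l <- ints N)
  (w (n - j) * w (n - l) * W j + w (n - j) * w (n - l) * W (j + l - n) +
   w (n - j) * w (n - l) * W l))); last first.
  move=> n _; rewrite (big_pairs N _ xpredT) /=; apply: eq_bigr => j _; apply: eq_bigr => l _.
  by rewrite powRM ?bracket_ge0 // !mulrDr.
have -> : \sum_(n <- ints N) \sum_(j <- ints N) \sum_(l <- ints N)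
  (w (n - j) * w (n - l) * W j + w (n - j) * w (n - l) * W (j + l - n) +
   w (n - j) * w (n - l) * W l) =
  \sum_(n <- ints N) \sum_(j <- ints N) \sum_(l <- ints N) w (n - j) * w (n - l) * W j +
  \sum_(n <- ints N) \sum_(j <- ints N) \sum_(l <- ints N) w (n - j) * w (n - l) * W (j + l - n) +
  \sum_(n <- ints N) \sum_(j <- ints N) \sum_(l <- ints N) w (n - j) * w (n - l) * W l.
  rewrite -!big_split /=; apply: eq_bigr => n _; rewrite -!big_split /=.
  by apply: eq_bigr => j _; rewrite -!big_split.
have -> : 3 * C ^+ 2 * S = C * C * S + C * C * S + C * C * S by ring.
by rewrite lerD // lerD.
Qed.

(** Write [Z i ^ 3] for the summable quantity [P i ^ (3 q / (1 + 2 lam))].  Jensen's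
    inequality with the summable weights [(jap m1 * jap m2) ^ (- (1 + k))] takes the
    power [q] inside and leaves [(jap m1 * jap m2) ^ (- v)] times the power
    [1 + 2 lam] of a product [Z Z Z].  Young's inequality splits this into
    [(jap m1 * jap m2) ^ (- v (1 + lam))] times [Z Z Z], where the kernel is still
    summable and [Z Z Z] is at most a sum of cubes, and into [Z Z Z] to the power
    [3 + 2 lam], where the sum over [n], [j] and [l] factorises and each factor is
    finite because the exponent exceeds 3. *)
Lemma kernel_le (q k lam B : R) : 1 <= q -> 0 < k -> 0 < lam ->
  1 < (1 - 2 * q * k) * (1 + lam) -> 0 <= B -> exists C : R, 0 < C /\
  forall N (P : int -> R), (forall i, 0 <= P i) -> (forall i, i \notin ints N -> P i = 0) ->
    \sum_(n <- ints N) P n `^ (3 * q / (1 + 2 * lam)) <= B ->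
    \sum_(n <- ints N) (\sum_(x <- pairs N | adm n x) jap (phase n x) `^ (- (1 - k)) *
       (P x.1 * P (x.1 + x.2 - n) * P x.2)) `^ q <= C.
Proof.
move=> q1 k0 l0 hk B0.
have q0 : 0 < q by lra.
have eL : 2 * lam * ((1 + lam) / lam) = 3 + 2 * lam - 1 by field; rewrite gt_eqF.
have e32 : 0 < 3 + 2 * lam by lra.
pose v := 1 + k - 2 * k * q; pose u := v * (1 + lam).
have u1 : 1 < u by apply: lt_trans hk _; rewrite /u /v ltr_pM2r; lra.
have qk : 2 * q * k < 1.
  rewrite ltNge; apply/negP => h.
  have : (1 - 2 * q * k) * (1 + lam) <= 0 by apply: mulr_le0_ge0; lra.
  lra.
have k1 : k < 1 by nra.
have k11 : 1 < 1 + k by lra.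
have [C1 [C10 HC1]] := sum_bracket_sub_le k11.
have [C2 [C20 HC2]] := sum_bracket2_cube_le u1.
pose W1 := (C1 * C1) `^ (q - 1).
pose a := 2 * lam / 3.
exists (4 `^ q * (W1 * (C2 * B + (B * B `^ a) ^+ 3)) + 1); split.
  by rewrite ltr_pwDr // !mulr_ge0 ?powR_ge0 // addr_ge0 ?exprn_ge0 ?mulr_ge0 ?powR_ge0 // ltW.
move=> N P P0 PN HB.
pose h n (x : int * int) := jap (n - x.1) * jap (n - x.2).
have h0 n x : 0 < h n x by rewrite mulr_gt0 ?bracket_gt0.
pose Z i := P i `^ (q / (1 + 2 * lam)).
have Z0 i : 0 <= Z i := powR_ge0 _ _.
have l1 : 0 < 1 + 2 * lam by lra.
have Z3 i : Z i ^+ 3 = P i `^ (3 * q / (1 + 2 * lam)).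
  by rewrite -powR_mulrn // -powRrM; congr (_ `^ _); field; lra.
pose PPP n (x : int * int) := P x.1 * P (x.1 + x.2 - n) * P x.2.
pose ZZZ n (x : int * int) := Z x.1 * Z (x.1 + x.2 - n) * Z x.2.
have PPP0 n x : 0 <= PPP n x by rewrite !mulr_ge0.
have ZZZ0 n x : 0 <= ZZZ n x by rewrite !mulr_ge0.
have PZ n x : PPP n x `^ q = ZZZ n x `^ (1 + 2 * lam).
  by rewrite /PPP /ZZZ !powRM ?mulr_ge0 // /Z -!powRrM divfK ?gt_eqF.
have bound n : (\sum_(x <- pairs N | adm n x) jap (phase n x) `^ (- (1 - k)) *
       (P x.1 * P (x.1 + x.2 - n) * P x.2)) `^ q <=
  4 `^ q * (W1 * \sum_(x <- pairs N) (h n x `^ (- u) *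
       (Z x.1 ^+ 3 + Z (x.1 + x.2 - n) ^+ 3 + Z x.2 ^+ 3) + ZZZ n x `^ (3 + 2 * lam))).
  pose w x := h n x `^ (- (1 + k)); pose y x := h n x `^ (2 * k) * PPP n x.
  have w0 x : 0 <= w x := powR_ge0 _ _.
  have y0 x : 0 <= y x by rewrite mulr_ge0 ?powR_ge0.
  apply: le_trans (_ : (4 * \sum_(x <- pairs N) w x * y x) `^ q <= _).
    apply: ge0_ler_powR; rewrite ?nnegrE ?(ltW q0) //.
    - by apply: sumr_ge0 => x _; rewrite mulr_ge0 ?powR_ge0 // PPP0.
    - by rewrite mulr_ge0 // sumr_ge0 // => x _; rewrite mulr_ge0.
    rewrite mulr_sumr [leLHS]big_mkcond; apply: ler_sum => x _; case: ifPn => ax; last first.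
      by apply: mulr_ge0 => //; apply: mulr_ge0.
    rewrite /w /y mulrA [in leRHS]mulrA -mulrA [leRHS]mulrA; apply: ler_wpM2r; first exact: PPP0.
    rewrite -mulrA -powRD ?(gt_eqF (h0 _ _)) ?implybT //.
    rewrite (_ : - (1 + k) + 2 * k = - (1 - k)); last by ring.
    have hle := bracketM R ax; rewrite -/(h n x) -/(phase n x) in hle.
    rewrite !powRN -ler_pdivrMl // -invfM lef_pV2 ?posrE ?mulr_gt0 ?powR_gt0 ?bracket_gt0 //.
    apply: le_trans (_ : (4 * jap (phase n x)) `^ (1 - k) <= _).
      by apply: ge0_ler_powR; rewrite ?nnegrE ?mulr_ge0 ?bracket_ge0 ?(ltW (h0 _ _)) //; lra.
    rewrite powRM ?bracket_ge0 // ler_wpM2r ?powR_ge0 //.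
    by apply: ler1_powR; lra.
  rewrite powRM ?sumr_ge0 //; last by move=> x _; rewrite mulr_ge0.
  rewrite ler_pM2l ?powR_gt0 //.
  apply: le_trans (powR_sum_le (pairs N) xpredT q1 w0 y0) _.
  have s0 : 0 <= \sum_(x <- pairs N) w x by apply: sumr_ge0.
  apply: ler_pM; rewrite ?powR_ge0 //.
  - by apply: sumr_ge0 => x _; rewrite mulr_ge0 ?powR_ge0.
  - apply: ge0_ler_powR; rewrite ?nnegrE ?mulr_ge0 ?(ltW C10) //; first by lra.
    have -> : \sum_(x <- pairs N) w x = (\sum_(j <- ints N) jap (n - j) `^ (- (1 + k))) *
        (\sum_(l <- ints N) jap (n - l) `^ (- (1 + k))).
      rewrite (big_pairs N _ xpredT) /= mulr_suml; apply: eq_bigr => j _.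
      rewrite mulr_sumr; apply: eq_bigr => l _.
      by rewrite /w /h powRM ?bracket_ge0.
    by apply: ler_pM; rewrite ?HC1 //; apply: sumr_ge0 => *; exact: powR_ge0.
  apply: ler_sum => x _.
  have -> : w x * y x `^ q = h n x `^ (- v) * ZZZ n x `^ (2 * lam) * ZZZ n x.
    rewrite /y powRM ?powR_ge0 // PZ -powRrM mulrA /w -powRD ?(gt_eqF (h0 _ _)) ?implybT //.
    rewrite (_ : - (1 + k) + 2 * k * q = - v); last by rewrite /v; ring.
    rewrite -[RHS]mulrA [X in _ = _ * X]mulrC; congr (_ * _).
    rewrite -(mulr_powRB1 (ZZZ0 n x) l1) (_ : 1 + 2 * lam - 1 = 2 * lam) //; ring.
  have y1 := powR_le_add (powR_ge0 (h n x) (- v)) (powR_ge0 (ZZZ n x) (2 * lam)) l0.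
  apply: le_trans (ler_wpM2r (ZZZ0 _ _) y1) _.
  rewrite -!powRrM mulrDl; apply: lerD.
    rewrite (_ : - v * (1 + lam) = - u); last by rewrite /u; ring.
    by rewrite ler_wpM2l ?powR_ge0 //; exact: mul3_le_cube.
  by rewrite eL mulrC mulr_powRB1.
apply: le_trans (ler_sum _ (fun n _ => bound n)) _.
rewrite -mulr_sumr; apply: le_trans (_ : 4 `^ q * (W1 * (C2 * B + (B * B `^ a) ^+ 3)) <= _); last by lra.
rewrite ler_pM2l ?powR_gt0 // -mulr_sumr ler_wpM2l ?powR_ge0 //.
under eq_bigr do rewrite big_split /=.
rewrite big_split /=; apply: lerD.
  apply: le_trans (HC2 N (fun i => Z i ^+ 3) _ _) _.
  - by move=> i; rewrite exprn_ge0.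
  - by move=> i /PN iN; rewrite /Z iN powR0 ?expr0n // gt_eqF // divr_gt0.
  by rewrite ler_pM2l //; under eq_bigr do rewrite Z3.
have e3 : 3 + 2 * lam != 0 by rewrite gt_eqF //; lra.
under eq_bigr => n _ do under eq_bigr => x _ do
  rewrite /ZZZ (powRM _ (mulr_ge0 (Z0 _) (Z0 _)) (Z0 _)) (powRM _ (Z0 _) (Z0 _)).
apply: le_trans (@sum_triple_le R N (fun i => Z i `^ (3 + 2 * lam)) _ _) _.
- by move=> i; exact: powR_ge0.
- move=> i /PN iN; rewrite /Z iN powR0 ?powR0 // gt_eqF // divr_gt0 //.
apply: lerXn2r; rewrite ?nnegrE.
- by apply: sumr_ge0 => *; exact: powR_ge0.
- by rewrite mulr_ge0 ?powR_ge0.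
apply: le_trans (_ : \sum_(i <- ints N) Z i ^+ 3 * B `^ a <= _); last first.
  by rewrite -mulr_suml ler_wpM2r ?powR_ge0 //; under eq_bigr do rewrite Z3.
rewrite big_seq [leRHS]big_seq; apply: ler_sum => i iN.
have ZB : Z i ^+ 3 <= B.
  apply: le_trans HB; rewrite Z3 (big_rem _ iN) /= lerDl sumr_ge0 // => *; exact: powR_ge0.
rewrite (_ : 3 + 2 * lam = 3%:R * (1 + a)); last by rewrite /a; field.
rewrite powRrM powR_mulrn //.
have Z30 : 0 <= Z i ^+ 3 by rewrite exprn_ge0.
rewrite -(mulr_powRB1 Z30); last by rewrite /a; lra.
rewrite ler_wpM2l // (_ : 1 + a - 1 = a); last by ring.
by apply: ge0_ler_powR; rewrite ?nnegrE // /a; lra.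
Qed.

End Kernel.

(** * The majorant of a Picard step *)

Section Majorant.
Variable R : realType.
Implicit Types (N M : nat) (n : int) (b : int -> int -> R).
Local Notation jap := (bracket R).

(** The gain of a Duhamel integral at frequency [t]: integration by parts when the
    exponential oscillates on an interval of length [T], the length otherwise. *)
Definition damp (T : R) (t : int) : R :=
  if 1 <= T * (absz t)%:R then (absz t)%:R^-1 else T.

Definition freq_bound N M : nat := (3 * M + (2 * N) ^ 2)%N.

(** The boundary terms of the integrations by parts keep their frequency; all that
    varies slowly, the datum included, is collected at frequency 0. *)
Definition majorant_step (T : R) (g : int -> R) N M b n t : R :=
  if n \in ints N then
    2 * damp T t * conv b N M n t +
    (t == 0)%:R * (g n + \sum_(u <- ints (freq_bound N M)) 2 * damp T u * conv b N M n u)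
  else 0.

Lemma damp_ge0 T t : 0 < T -> 0 <= damp T t.
Proof. by move=> T0; rewrite /damp; case: ifP => _; rewrite ?invr_ge0 // ltW. Qed.

(** An interpolation: a part of the decay in [t] is given up for a positive power
    of [T]. *)
Lemma damp_le T t (x : R) : 0 < T <= 1 -> 0 < x < 1 ->
  damp T t <= 2 * T `^ x * jap t `^ (-1 + x).
Proof.
move=> /andP[T0 T1] /andP[x0 x1]; rewrite /damp /bracket.
set a : R := (absz t)%:R; have a0 : 0 <= a by exact: ler0n.
have ja : 0 < 1 + a by lra.
have jn0 : 1 + a != 0 by rewrite gt_eqF.
have Tn0 : T != 0 by rewrite gt_eqF.
case: ifPn => h.
  have a1 : 1 <= a by apply: le_trans h _; rewrite ler_piMl.
  have a_gt0 : 0 < a by lra.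
  have TJ : 1 <= (T * (1 + a)) `^ x.
    rewrite -[leLHS](powRr0 (T * (1 + a))); apply: ler_powR; last exact: ltW.
    by apply: le_trans h _; rewrite ler_pM2l //; lra.
  rewrite powRD ?jn0 ?implybT //.
  rewrite powRM ?(ltW T0) ?(ltW ja) // in TJ.
  apply: le_trans (_ : 2 * (1 + a) `^ (-1) <= _).
    rewrite powR_inv1 ?(ltW ja) // ler_pdivlMr // mulrDr mulr1 mulVf; last by rewrite gt_eqF.
    by have : a^-1 <= 1 by [rewrite invf_le1]; lra.
  have p0 := powR_ge0 (1 + a) (-1).
  by nra.
rewrite -ltNge in h.
have TJ2 : T * (1 + a) <= 2 by rewrite mulrDr mulr1; lra.
have TJ : (T * (1 + a)) `^ (1 - x) <= 2.
  apply: le_trans (_ : 2 `^ (1 - x) <= _).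
    by apply: ge0_ler_powR; rewrite ?nnegrE ?mulr_ge0 //; lra.
  by apply: ler1_powR; lra.
rewrite powRM ?(ltW T0) ?(ltW ja) // in TJ.
have -> : -1 + x = - (1 - x) by ring.
rewrite powRN ler_pdivlMr ?powR_gt0 //.
have -> : T * (1 + a) `^ (1 - x) = T `^ x * (T `^ (1 - x) * (1 + a) `^ (1 - x)).
  rewrite mulrA -powRD ?Tn0 ?implybT // (_ : x + (1 - x) = 1); last by ring.
  by rewrite powRr1 // ltW.
by rewrite [leRHS]mulrC ler_pM2l ?powR_gt0.
Qed.

Lemma powR_add3_le (x y r : R) : 0 <= x -> 0 <= y -> 0 < r -> forall d : bool,
  (x + d%:R * y) `^ r <= 2 `^ r * (x `^ r + d%:R * y `^ r).
Proof.
move=> x0 y0 r0 d; apply: le_trans (powR_add_le x0 _ (ltW r0)) _.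
  by rewrite mulr_ge0.
rewrite ler_pM2l ?powR_gt0 // lerD2l; case: d; rewrite ?mul1r // !mul0r powR0 //.
by rewrite gt_eqF.
Qed.

Variables (r s p e x : R).
Hypotheses (r1 : 1 < r) (s1 : 1 < s) (p0 : 0 < p) (pr : p <= r)
  (e0 : 0 < e) (es : e < s - 1) (x01 : 0 < x < 1)
  (hx : s * (r - 1) + (-1 + x) * r <= - (e * (r - 1))).

Definition total (w : int -> R) N M b : R :=
  \sum_(n <- ints N) w n `^ p * energy r s b M n `^ (p / r).

(** The gain [damp] pays both for the weight of [energy] and for the loss in
    [sum_conv_powR_le]; the relation [hx] between the exponents expresses this, and
    leaves the power [x * r] of [T].  The amplitude at frequency 0 is a sum over all
    frequencies, hence the second use of Holder's inequality. *)
Lemma energy_step_le : exists C1 C2 : R, [/\ 0 < C1, 0 < C2 &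
  forall N M (T : R) (g : int -> R) b n, 0 < T <= 1 -> (forall n, 0 <= g n) ->
    (forall n t, 0 <= b n t) -> n \in ints N ->
    energy r s (majorant_step T g N M b) (freq_bound N M) n <=
    C1 * g n `^ r + C2 * T `^ (x * r) * \sum_(y <- pairs N | adm n y)
      energy r s b M y.1 * energy r s b M (y.1 + y.2 - n) * energy r s b M y.2].
Proof.
have [C [C0 HC]] := sum_conv_powR_le r1 s1 e0 es.
have [D [D0 HD]] := sum_bracket_le s1.
have r0 : 0 < r by move: r1; lra.
pose K := 4 `^ r * C.
have K0 : 0 < K by rewrite mulr_gt0 ?powR_gt0.
exists (4 `^ r), (2 `^ r * K + 4 `^ r * (D `^ (r - 1) * K)).
split; first exact: powR_gt0.
  by rewrite addr_gt0 // !mulr_gt0 ?powR_gt0.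
move=> N M T g b n T01 g0 b0 nN.
have T0 : 0 < T by case/andP: T01.
set S := \sum_(y <- pairs N | adm n y) _.
pose be t := 2 * damp T t * conv b N M n t.
have be0 t : 0 <= be t by rewrite !mulr_ge0 ?damp_ge0 ?conv_ge0.
set M' := freq_bound N M.
pose B := \sum_(t <- ints M') jap t `^ (s * (r - 1)) * be t `^ r.
have B0 : 0 <= B by apply: sumr_ge0 => t _; rewrite mulr_ge0 ?powR_ge0.
have S0 : 0 <= S by apply: sumr_ge0 => y _; rewrite !mulr_ge0 ?energy_ge0.
have BS : B <= K * T `^ (x * r) * S.
  apply: le_trans (_ : 4 `^ r * T `^ (x * r) * (C * S) <= _); last first.
    by rewrite /K le_eqVlt; apply/orP; left; apply/eqP; ring.
  apply: le_trans (_ : 4 `^ r * T `^ (x * r) * (\sum_(t <- ints M')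
      jap t `^ (- (e * (r - 1))) * conv b N M n t `^ r) <= _); last first.
    by rewrite ler_wpM2l ?mulr_ge0 ?powR_ge0 // HC.
  rewrite mulr_sumr; apply: ler_sum => t _.
  have j0 := bracket_gt0 R t.
  have cv0 : 0 <= conv b N M n t by exact: conv_ge0.
  apply: le_trans (_ : jap t `^ (s * (r - 1)) *
     (4 * T `^ x * jap t `^ (-1 + x) * conv b N M n t) `^ r <= _).
    rewrite ler_wpM2l ?powR_ge0 //; apply: ge0_ler_powR; rewrite ?nnegrE ?(ltW r0) ?be0 //.
      by rewrite !mulr_ge0 ?powR_ge0.
    rewrite /be ler_wpM2r //.
    by have := damp_le t T01 x01; lra.
  rewrite !powRM ?mulr_ge0 ?powR_ge0 //.
  rewrite -[(T `^ x) `^ r]powRrM -[(jap t `^ _) `^ r]powRrM.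
  rewrite [leLHS](_ : _ = 4 `^ r * T `^ (x * r) *
     (jap t `^ (s * (r - 1)) * jap t `^ ((-1 + x) * r) * conv b N M n t `^ r)); last by ring.
  rewrite ler_wpM2l ?mulr_ge0 ?powR_ge0 // ler_wpM2r ?powR_ge0 //.
  rewrite -powRD ?(gt_eqF j0) ?implybT //.
  by apply: ler_powR; [exact: bracket_ge1 | exact: hx].
pose Y := g n + \sum_(u <- ints M') be u.
have Y0 : 0 <= Y by rewrite addr_ge0 // sumr_ge0.
have YB : Y `^ r <= 2 `^ r * (g n `^ r + D `^ (r - 1) * B).
  apply: le_trans (powR_add_le (g0 n) _ (ltW r0)) _; first exact: sumr_ge0.
  rewrite ler_pM2l ?powR_gt0 // lerD2l.
  have := powR_sum_weighted_le (ints M') xpredT (ltW r1)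
     (fun t => bracket_powR_gt0 t (- s)) be0.
  move=> /le_trans; apply.
  have -> : \sum_(t <- ints M') (jap t `^ (- s)) `^ (1 - r) * be t `^ r = B.
    by apply: eq_bigr => t _; rewrite -powRrM; congr (_ `^ _ * _); ring.
  rewrite ler_wpM2r //; apply: ge0_ler_powR; rewrite ?nnegrE ?(ltW D0) ?HD ?ints_uniq //.
    by move: r1; lra.
  by apply: sumr_ge0 => t _; exact: powR_ge0.
have zero_in : 0 \in ints M' by rewrite mem_ints.
have step : energy r s (majorant_step T g N M b) M' n <= 2 `^ r * (B + Y `^ r).
  apply: le_trans (_ : \sum_(t <- ints M') (2 `^ r * (jap t `^ (s * (r - 1)) * be t `^ r) +
     2 `^ r * (if t == 0 then Y `^ r else 0)) <= _).
    apply: ler_sum => t _; rewrite /majorant_step nN -/(be t) -/Y.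
    apply: le_trans (ler_wpM2l (powR_ge0 _ _) (powR_add3_le (be0 t) Y0 r0 _)) _.
    rewrite mulrCA -mulrDr ler_pM2l ?powR_gt0 // mulrDr lerD2l.
    case: (eqVneq t 0) => [->|_]; last by rewrite mul0r mulr0.
    by rewrite /bracket /= addr0 powR1 !mul1r.
  rewrite big_split /= -!mulr_sumr -/B [leRHS]mulrDr; apply: lerD => //.
  rewrite ler_pM2l ?powR_gt0 //.
  rewrite (big_rem _ zero_in) /= big_seq_cond big1 ?addr0 // => t.
  by rewrite mem_rem_uniq ?ints_uniq // inE andbT => /andP[/negbTE ->].
apply: le_trans step _.
have c4 : (4 : R) `^ r = 2 `^ r * 2 `^ r by rewrite -powRM //; congr (_ `^ _); lra.
have t2 : 0 < (2 : R) `^ r by exact: powR_gt0.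
apply: le_trans (_ : 4 `^ r * g n `^ r + (2 `^ r + 4 `^ r * D `^ (r - 1)) * B <= _).
  rewrite c4; have := ler_wpM2l (ltW t2) YB; lra.
rewrite lerD2l.
have d0 : 0 <= 2 `^ r + 4 `^ r * D `^ (r - 1) by rewrite addr_ge0 // ?mulr_ge0 ?powR_ge0.
apply: le_trans (ler_wpM2l d0 BS) _.
by rewrite le_eqVlt; apply/orP; left; apply/eqP; ring.
Qed.

(** As [p / r <= 1] the power [p / r] may be taken inside the trilinear sum, which
    then factorises because the weight [w] is submultiplicative. *)
Lemma total_step_le : exists C1 C2 : R, [/\ 0 < C1, 0 < C2 &
  forall N M (T : R) (w g : int -> R) b, 0 < T <= 1 -> (forall n, 0 <= g n) ->
    (forall n, 0 <= w n) -> (forall j k l, w (j - k + l) <= w j * w k * w l) ->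
    (forall n t, 0 <= b n t) -> (forall n t, n \notin ints N -> b n t = 0) ->
    total w N (freq_bound N M) (majorant_step T g N M b) <=
    C1 * \sum_(n <- ints N) w n `^ p * g n `^ p + C2 * T `^ (x * p) * total w N M b ^+ 3].
Proof.
have [C1 [C2 [C10 C20 HC]]] := energy_step_le.
have r0 : 0 < r by move: r1; lra.
have a0 : 0 < p / r by rewrite divr_gt0.
have a1 : p / r <= 1 by rewrite ler_pdivrMr // mul1r.
pose a := p / r.
exists (C1 `^ a), (C2 `^ a); split; try exact: powR_gt0.
move=> N M T w g b T01 g0 w0 wM b0 bN.
have T0 : 0 < T by case/andP: T01.
pose E i := energy r s b M i.
have E0 i : 0 <= E i by exact: energy_ge0.
pose X i := w i `^ p * E i `^ a.
have X0 i : 0 <= X i by rewrite mulr_ge0 ?powR_ge0.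
have XN i : i \notin ints N -> X i = 0.
  move=> iN; rewrite /X /E /energy big1 ?powR0 ?mulr0 ?gt_eqF // => t _.
  by rewrite bN // powR0 ?mulr0 // gt_eqF.
apply: le_trans (_ : \sum_(n <- ints N) (C1 `^ a * (w n `^ p * g n `^ p) +
   C2 `^ a * T `^ (x * p) * \sum_(y <- pairs N) X y.1 * X (y.1 + y.2 - n) * X y.2) <= _); last first.
  rewrite big_split /= -!mulr_sumr lerD2l ler_wpM2l ?mulr_ge0 ?powR_ge0 //.
  exact: sum_triple_le.
rewrite /total big_seq [leRHS]big_seq; apply: ler_sum => n nN.
set S := \sum_(y <- pairs N | adm n y) E y.1 * E (y.1 + y.2 - n) * E y.2.
have S0 : 0 <= S by apply: sumr_ge0 => y _; rewrite !mulr_ge0.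
apply: le_trans (_ : w n `^ p * (C1 * g n `^ r + C2 * T `^ (x * r) * S) `^ a <= _).
  rewrite ler_wpM2l ?powR_ge0 //; apply: ge0_ler_powR; rewrite ?nnegrE ?energy_ge0 ?(ltW a0) ?HC //.
  by rewrite addr_ge0 // !mulr_ge0 ?powR_ge0 // ltW.
have A0 : 0 <= C1 * g n `^ r by rewrite mulr_ge0 ?powR_ge0 // ltW.
have B0 : 0 <= C2 * T `^ (x * r) * S by rewrite !mulr_ge0 ?powR_ge0 // ltW.
have two : (C1 * g n `^ r + C2 * T `^ (x * r) * S) `^ a <=
    (C1 * g n `^ r) `^ a + (C2 * T `^ (x * r) * S) `^ a.
  have := @powR_sum_concave_le R bool [:: true; false] xpredT
    (fun i => if i then C1 * g n `^ r else C2 * T `^ (x * r) * S) a.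
  by rewrite !big_cons !big_nil !addr0 /a a0 a1; apply => // -[].
apply: le_trans (ler_wpM2l (powR_ge0 _ _) two) _.
have ra : r * a = p by rewrite /a mulrC divfK // gt_eqF.
rewrite mulrDr; apply: lerD.
  rewrite powRM ?powR_ge0 ?(ltW C10) // -powRrM ra.
  by rewrite le_eqVlt; apply/orP; left; apply/eqP; ring.
have xra : x * r * a = x * p by rewrite -mulrA ra.
rewrite (powRM _ (mulr_ge0 (ltW C20) (powR_ge0 _ _)) S0) (powRM _ (ltW C20) (powR_ge0 _ _)) -powRrM xra.
rewrite mulrCA; apply: ler_wpM2l; first by rewrite mulr_ge0 ?powR_ge0.
have SE : S `^ a <= \sum_(y <- pairs N) (E y.1 * E (y.1 + y.2 - n) * E y.2) `^ a.
  apply: le_trans (powR_sum_concave_le _ _ _ _) _.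
  - by rewrite a0 a1.
  - by move=> y; rewrite !mulr_ge0.
  rewrite big_mkcond; apply: ler_sum => y _; case: ifP => // _; exact: powR_ge0.
apply: le_trans (ler_wpM2l (powR_ge0 _ _) SE) _.
rewrite mulr_sumr; apply: ler_sum => y _.
set k := y.1 + y.2 - n.
have -> : X y.1 * X k * X y.2 = (w y.1 * w k * w y.2) `^ p * (E y.1 * E k * E y.2) `^ a.
  rewrite (powRM _ (mulr_ge0 (w0 _) (w0 _)) (w0 _)) (powRM _ (w0 _) (w0 _)).
  rewrite (powRM _ (mulr_ge0 (E0 _) (E0 _)) (E0 _)) (powRM _ (E0 _) (E0 _)).
  rewrite /X; move: (E y.1 `^ a) (E k `^ a) (E y.2 `^ a) (w y.1 `^ p) (w k `^ p) (w y.2 `^ p).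
  by move=> *; ring.
apply: ler_wpM2r; first exact: powR_ge0.
apply: ge0_ler_powR; rewrite ?nnegrE ?mulr_ge0 ?(ltW p0) //.
by have := wM y.1 k y.2; rewrite (_ : y.1 - k + y.2 = n) // /k; ring.
Qed.

End Majorant.

(** * Calculus of complex-valued functions *)

Local Open Scope complex_scope.

Section ComplexModulus.
Variable R : realType.
Implicit Types (z w : R[i]).

Lemma cabs_ge0 z : 0 <= cabs z.
Proof. by case: z => a b; exact: sqrtr_ge0. Qed.

Lemma cabs0 : cabs (0 : R[i]) = 0. Proof. exact: ComplexField.Normc.normc0. Qed.
Lemma cabs1 : cabs (1 : R[i]) = 1. Proof. exact: ComplexField.Normc.normc1. Qed.
Lemma cabsM z w : cabs (z * w) = cabs z * cabs w.
Proof. exact: ComplexField.Normc.normcM. Qed.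
Lemma cabsD z w : cabs (z + w) <= cabs z + cabs w.
Proof. exact: le_normcD. Qed.
Lemma cabsN z : cabs (- z) = cabs z.
Proof. exact: normcN. Qed.
Lemma cabsV z : cabs z^-1 = (cabs z)^-1.
Proof. exact: ComplexField.Normc.normcV. Qed.
Lemma cabsB z w : cabs (z - w) <= cabs z + cabs w.
Proof. by rewrite -(cabsN w) cabsD. Qed.
Lemma cabsC z w : cabs (z - w) = cabs (w - z).
Proof. by rewrite -cabsN opprB. Qed.
Lemma cabs_eq0 z : cabs z = 0 -> z = 0.
Proof. exact: ComplexField.Normc.eq0_normc. Qed.

Lemma cabs_real (x : R) : cabs x%:C = `|x|.
Proof. by rewrite /cabs /= expr0n addr0 sqrtr_sqr. Qed.

Lemma cabs_conj z : cabs (conjc z) = cabs z.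
Proof. by case: z => a b; rewrite /cabs /= sqrrN. Qed.

Lemma cabs_i : cabs ('i : R[i]) = 1.
Proof. by rewrite /cabs /= expr0n add0r expr1n sqrtr1. Qed.

Lemma cabs_cexpi (a : R) : cabs (cexpi a) = 1.
Proof. by rewrite /cabs /= cos2Dsin2 sqrtr1. Qed.

Lemma cabs_sum (I : Type) (s : seq I) (P : pred I) (F : I -> R[i]) :
  cabs (\sum_(i <- s | P i) F i) <= \sum_(i <- s | P i) cabs (F i).
Proof.
elim: s => [|i s IH]; first by rewrite !big_nil cabs0.
rewrite !big_cons; case: (P i) => //.
by apply: le_trans (cabsD _ _) _; rewrite lerD2l.
Qed.

Lemma Re_le_cabs z : complex.Re z <= cabs z.
Proof.
case: z => a b; rewrite /cabs /=; apply: le_trans (ler_norm _) _.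
by rewrite -sqrtr_sqr ler_wsqrtr // lerDl sqr_ge0.
Qed.

Lemma normRe_le_cabs z : `|complex.Re z| <= cabs z.
Proof. by case: z => a b; rewrite /cabs /= -sqrtr_sqr ler_wsqrtr // lerDl sqr_ge0. Qed.

Lemma normIm_le_cabs z : `|complex.Im z| <= cabs z.
Proof. by case: z => a b; rewrite /cabs /= -sqrtr_sqr ler_wsqrtr // lerDr sqr_ge0. Qed.

Lemma cabs_le_Re_Im z : cabs z <= `|complex.Re z| + `|complex.Im z|.
Proof.
case: z => a b; rewrite [complex.Re _]/= [complex.Im _]/=.
have e : a +i* b = a%:C + 'i * b%:C.
  by apply/eqP; rewrite eq_complex /=; apply/andP; split; apply/eqP; ring.
by rewrite e; apply: le_trans (cabsD _ _) _; rewrite cabsM cabs_i mul1r !cabs_real.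
Qed.

Lemma cabs_sqr z : (cabs z ^+ 2)%:C = z * conjc z.
Proof.
case: z => a b; rewrite /cabs /= sqr_sqrtr ?addr_ge0 ?sqr_ge0 //.
by apply/eqP; rewrite eq_complex /=; apply/andP; split; apply/eqP; ring.
Qed.

Lemma cexpiD (a b : R) : cexpi (a + b) = cexpi a * cexpi b.
Proof.
apply/eqP; rewrite eq_complex /= cosD sinD; apply/andP; split; apply/eqP; ring.
Qed.

Lemma cexpi0 : cexpi (0 : R) = 1.
Proof. by apply/eqP; rewrite eq_complex /= cos0 sin0 !eqxx. Qed.

Lemma conj_cexpi (a : R) : conjc (cexpi a) = cexpi (- a).
Proof. by apply/eqP; rewrite eq_complex /= cosN sinN !eqxx. Qed.

Lemma conj_sum (I : Type) (s : seq I) (P : pred I) (F : I -> R[i]) :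
  conjc (\sum_(i <- s | P i) F i) = \sum_(i <- s | P i) conjc (F i).
Proof. exact: rmorph_sum. Qed.

Lemma Re_sum (I : Type) (s : seq I) (P : pred I) (F : I -> R[i]) :
  complex.Re (\sum_(i <- s | P i) F i) = \sum_(i <- s | P i) complex.Re (F i).
Proof. by apply: (big_morph (@complex.Re R)) => // -[a b] [c d]. Qed.

Lemma ReM z w : complex.Re (z * w) = complex.Re z * complex.Re w - complex.Im z * complex.Im w.
Proof. by case: z w => a b [c d]. Qed.
Lemma ImM z w : complex.Im (z * w) = complex.Re z * complex.Im w + complex.Im z * complex.Re w.
Proof. by case: z w => a b [c d]. Qed.
Lemma ReD z w : complex.Re (z + w) = complex.Re z + complex.Re w.
Proof. by case: z w => a b [c d]. Qed.
Lemma ImD z w : complex.Im (z + w) = complex.Im z + complex.Im w.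
Proof. by case: z w => a b [c d]. Qed.
Lemma ReN z : complex.Re (- z) = - complex.Re z. Proof. by case: z. Qed.
Lemma ImN z : complex.Im (- z) = - complex.Im z. Proof. by case: z. Qed.
Lemma ReJ z : complex.Re (conjc z) = complex.Re z. Proof. by case: z. Qed.
Lemma ImJ z : complex.Im (conjc z) = - complex.Im z. Proof. by case: z. Qed.

Lemma complex_ext z w : complex.Re z = complex.Re w -> complex.Im z = complex.Im w -> z = w.
Proof. by case: z w => a b [c d] /= -> ->. Qed.

Lemma unimodular_align z : exists u : R[i], cabs u <= 1 /\ u * z = (cabs z)%:C.
Proof.
have [->|z0] := eqVneq z 0; first by exists 0; rewrite cabs0 mulr0.
have c0 : cabs z != 0 by apply/eqP => /cabs_eq0 h; rewrite h eqxx in z0.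
exists (conjc z * ((cabs z)^-1)%:C); split.
  by rewrite cabsM cabs_conj cabs_real normfV ger0_norm ?cabs_ge0 // divff.
rewrite mulrAC [conjc z * z]mulrC -cabs_sqr -rmorphM /=.
by rewrite expr2 mulfK.
Qed.

End ComplexModulus.

Section Derivatives.
Variable R : realType.
Implicit Types (f g : R -> R[i]) (t : R) (l m : R[i]).

Definition has_cderiv f t l : Prop :=
  is_derive t 1 (re_of f : R -> R) (complex.Re l) /\ is_derive t 1 (im_of f : R -> R) (complex.Im l).

Lemma is_derive_ext (h k : R -> R) t (a b : R) :
  (forall s, h s = k s) -> a = b -> is_derive t 1 h a -> is_derive t 1 k b.
Proof. by move=> /funext -> ->. Qed.

Lemma has_cderiv_ext f g t l m : (forall s, f s = g s) -> l = m ->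
  has_cderiv f t l -> has_cderiv g t m.
Proof. by move=> /funext -> ->. Qed.

Lemma has_cderiv_cst (c : R[i]) t : has_cderiv (fun _ => c) t 0.
Proof. by split; apply: is_derive_cst. Qed.

Lemma has_cderivD f g t l m : has_cderiv f t l -> has_cderiv g t m ->
  has_cderiv (fun s => f s + g s) t (l + m).
Proof.
move=> [f1 f2] [g1 g2]; split.
  by apply: is_derive_ext (is_deriveD f1 g1) => [s|]; rewrite /re_of -?ReD //= ReD.
by apply: is_derive_ext (is_deriveD f2 g2) => [s|]; rewrite /im_of -?ImD //= ImD.
Qed.

Lemma has_cderivN f t l : has_cderiv f t l -> has_cderiv (fun s => - f s) t (- l).
Proof.
move=> [f1 f2]; split.
  by apply: is_derive_ext (is_deriveN f1) => [s|]; rewrite /re_of -?ReN //= ReN.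
by apply: is_derive_ext (is_deriveN f2) => [s|]; rewrite /im_of -?ImN //= ImN.
Qed.

Lemma has_cderivB f g t l m : has_cderiv f t l -> has_cderiv g t m ->
  has_cderiv (fun s => f s - g s) t (l - m).
Proof. by move=> hf hg; apply: has_cderivD => //; exact: has_cderivN. Qed.

Lemma has_cderivM f g t l m : has_cderiv f t l -> has_cderiv g t m ->
  has_cderiv (fun s => f s * g s) t (l * g t + f t * m).
Proof.
move=> [f1 f2] [g1 g2]; split.
  apply: is_derive_ext (is_deriveB (is_deriveM f1 g1) (is_deriveM f2 g2)) => [s|].
    by rewrite /re_of /im_of ReM.
  by rewrite ReD !ReM /re_of /im_of /GRing.scale /=; ring.
apply: is_derive_ext (is_deriveD (is_deriveM f1 g2) (is_deriveM f2 g1)) => [s|].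
  by rewrite /re_of /im_of ImM.
by rewrite ImD !ImM /re_of /im_of /GRing.scale /=; ring.
Qed.

Lemma has_cderivZ f t l (c : R[i]) : has_cderiv f t l -> has_cderiv (fun s => c * f s) t (c * l).
Proof.
move=> hf; apply: has_cderiv_ext (has_cderivM (has_cderiv_cst c t) hf) => //.
by rewrite mul0r add0r.
Qed.

Lemma has_cderivJ f t l : has_cderiv f t l -> has_cderiv (fun s => conjc (f s)) t (conjc l).
Proof.
move=> [f1 f2]; split.
  by apply: is_derive_ext f1 => [s|]; rewrite /re_of ?ReJ.
by apply: is_derive_ext (is_deriveN f2) => [s|]; rewrite /im_of ?ImJ.
Qed.

Lemma has_cderiv_sum (I : Type) (s : seq I) (P : pred I) (F : I -> R -> R[i]) (L : I -> R[i]) t :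
  (forall i, P i -> has_cderiv (F i) t (L i)) ->
  has_cderiv (fun u => \sum_(i <- s | P i) F i u) t (\sum_(i <- s | P i) L i).
Proof.
move=> h; elim: s => [|i s IH].
  by apply: has_cderiv_ext (has_cderiv_cst 0 t) => [u|]; rewrite big_nil.
case Pi : (P i); last first.
  by apply: has_cderiv_ext IH => [u|]; rewrite big_cons Pi.
by apply: has_cderiv_ext (has_cderivD (h i Pi) IH) => [u|]; rewrite big_cons Pi.
Qed.

Lemma has_cderiv_cexpi (a t : R) : has_cderiv (fun s => cexpi (a * s)) t ('i * a%:C * cexpi (a * t)).
Proof.
have dl : is_derive t 1 (fun s : R => a * s) a.
  apply: is_derive_ext (is_deriveZ a (is_derive_id t 1)) => [//|].
  by rewrite /GRing.scale /= mulr1.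
split.
  apply: is_derive_ext (is_derive1_comp (is_derive_cos (a * t)) dl) => [//|].
  by rewrite /= /GRing.scale /=; ring.
apply: is_derive_ext (is_derive1_comp (is_derive_sin (a * t)) dl) => [//|].
by rewrite /= /GRing.scale /=; ring.
Qed.

Lemma is_derive_continuous (h : R -> R) t (a : R) : is_derive t 1 h a -> {for t, continuous h}.
Proof. by move=> [dh _]; apply/differentiable_continuous/derivable1_diffP. Qed.

Lemma ge0_derive_le (G dG : R -> R) (t : R) : 0 <= t ->
  (forall s, 0 <= s <= t -> is_derive s 1 G (dG s)) ->
  (forall s, 0 <= s <= t -> 0 <= dG s) -> G 0 <= G t.
Proof.
move=> t0 dG' dG0.
have [||c cin eq] := @MVT_segment R G dG 0 t t0.
- by move=> x; rewrite in_itv /= => /andP[x0 xt]; apply: dG'; rewrite !ltW.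
- apply: derivable_within_continuous => x; rewrite in_itv /= => xin.
  by case: (dG' x xin).
- rewrite in_itv /= in cin.
  by rewrite -subr_ge0 eq subr0 mulr_ge0 // dG0.
Qed.

(** Rotating each increment onto the positive axis turns the sum of moduli into the
    real part of one function, to which the mean value theorem applies. *)
Lemma sum_cabs_le (I : Type) (l : seq I) (F dF : I -> R -> R[i]) (ph dph : R -> R) (t : R) :
  0 <= t ->
  (forall i s, 0 <= s <= t -> has_cderiv (F i) s (dF i s)) ->
  (forall s, 0 <= s <= t -> is_derive s 1 ph (dph s)) ->
  (forall s, 0 <= s <= t -> \sum_(i <- l) cabs (dF i s) <= dph s) ->
  \sum_(i <- l) cabs (F i t - F i 0) <= ph t - ph 0.
Proof.
move=> t0 hF hph hle.
have [u hu] := choice (fun i => unimodular_align (F i t - F i 0)).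
pose G s := ph s - complex.Re (\sum_(i <- l) u i * F i s).
have -> : \sum_(i <- l) cabs (F i t - F i 0) =
   complex.Re (\sum_(i <- l) u i * F i t) - complex.Re (\sum_(i <- l) u i * F i 0).
  rewrite -ReN -ReD -sumrN -big_split Re_sum /=; apply: eq_bigr => i _.
  by rewrite -mulrN -mulrDr (hu i).2.
suff : G 0 <= G t by rewrite /G; lra.
apply: (@ge0_derive_le G (fun s => dph s - complex.Re (\sum_(i <- l) u i * dF i s))) => // s hs.
  apply: is_deriveB; first exact: hph.
  by have [] := @has_cderiv_sum I l xpredT _ _ s (fun i _ => has_cderivZ (u i) (hF i s hs)).
rewrite subr_ge0; apply: le_trans (hle s hs).
apply: le_trans (Re_le_cabs _) _; apply: le_trans (cabs_sum _ _ _) _.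
apply: ler_sum => i _; rewrite cabsM ler_piMl ?cabs_ge0 //.
exact: (hu i).1.
Qed.

Lemma cabs_increment_le (F dF : R -> R[i]) (A t : R) : 0 <= t ->
  (forall s, 0 <= s <= t -> has_cderiv F s (dF s)) ->
  (forall s, 0 <= s <= t -> cabs (dF s) <= A) ->
  cabs (F t - F 0) <= A * t.
Proof.
move=> t0 hF hA.
have := @sum_cabs_le unit [:: tt] (fun _ => F) (fun _ => dF) (fun s => A * s) (fun _ => A) t t0.
rewrite !big_seq1 mulr0 subr0; apply => //.
- move=> s _; apply: is_derive_ext (is_deriveZ A (is_derive_id s 1)) => [//|].
  by rewrite /GRing.scale /= mulr1.
- by move=> s hs; rewrite big_seq1 hA.
Qed.

End Derivatives.

(** * Duhamel integrals of oscillating terms *)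

Section Primitive.
Variable R : realType.

(** Composition with the projection of the line to [[0, T]] makes [F] continuous
    everywhere. *)
Lemma primitive_exists (F : R -> R) (T : R) : 0 <= T ->
  (forall t, 0 <= t <= T -> {for t, continuous F}) ->
  exists H : R -> R, H 0 = 0 /\ forall t, 0 <= t <= T -> is_derive t 1 H (F t).
Proof.
move=> T0 cF.
pose clip (t : R) : R := Num.max 0 (Num.min t T).
have clip_in t : 0 <= clip t <= T.
  by rewrite /clip le_max lexx /= ge_max T0 ge_min lexx orbT.
have clip_id t : 0 <= t <= T -> clip t = t.
  by move=> /andP[t0 tT]; rewrite /clip min_l // max_r.
have cclip : continuous clip.
  move=> t; apply: (@continuous_max _ _ (fun=> 0) (fun t => Num.min t T)).
    exact: cvg_cst.
  by apply: (@continuous_min _ _ id (fun=> T)); [exact: cvg_id | exact: cvg_cst].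
pose G := F \o clip.
have cG : continuous G by move=> t; apply: continuous_comp; [exact: cclip | apply: cF; exact: clip_in].
pose K x := (\int[@lebesgue_measure R]_(t in `[(-1)%R, x]) G t)%R.
have dK t : 0 <= t <= T -> is_derive t 1 K (G t).
  move=> /andP[t0 tT].
  have [||||d1 d2] := @continuous_FTC1_closed R G (-1) t (T + 1).
  - by lra.
  - apply: continuous_compact_integrable; first exact: segment_compact.
    by apply: continuous_subspaceT.
  - by lra.
  - exact: cG.
  by split; [exact: d1 | rewrite -derive1E d2].
exists (fun x => K x - K 0); split; first by rewrite subrr.
move=> t ht; have := is_deriveB (dK t ht) (is_derive_cst (K 0) t 1).
rewrite subr0 /G /= clip_id //.
Qed.

Lemma cprimitive_exists (F dF : R -> R[i]) (T : R) : 0 <= T ->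
  (forall t, 0 <= t <= T -> has_cderiv F t (dF t)) ->
  exists H : R -> R[i], H 0 = 0 /\ forall t, 0 <= t <= T -> has_cderiv H t (F t).
Proof.
move=> T0 hF.
have [H1 [H10 d1]] := @primitive_exists (re_of F) T T0
  (fun t ht => is_derive_continuous (hF t ht).1).
have [H2 [H20 d2]] := @primitive_exists (im_of F) T T0
  (fun t ht => is_derive_continuous (hF t ht).2).
exists (fun t => H1 t +i* H2 t); split; first by rewrite H10 H20.
by move=> t ht; split; [exact: d1 | exact: d2].
Qed.

End Primitive.

Section Oscillation.
Variable R : realType.

Definition wave (k : int) (t : R) : R[i] := cexpi (2 * k%:~R * t).

Lemma waveD k l t : wave (k + l) t = wave k t * wave l t.
Proof. by rewrite /wave -cexpiD intrD; congr cexpi; ring. Qed.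

Lemma waveN k t : wave (- k) t = conjc (wave k t).
Proof. by rewrite /wave conj_cexpi; congr cexpi; rewrite rmorphN /=; ring. Qed.

Lemma cabs_wave k t : cabs (wave k t) = 1.
Proof. exact: cabs_cexpi. Qed.

Lemma wave0 t : wave 0 t = 1.
Proof. by rewrite /wave mulr0 mul0r cexpi0. Qed.

Definition rate (k : int) : R[i] := 'i * (2 * k%:~R)%:C.

Lemma has_cderiv_wave k t : has_cderiv (wave k) t (rate k * wave k t).
Proof. exact: has_cderiv_cexpi. Qed.

Lemma cabs_rate k : cabs (rate k) = 2 * (absz k)%:R.
Proof.
by rewrite cabsM cabs_i mul1r cabs_real normrM ger0_norm // -intr_norm natr_absz.
Qed.

Lemma rate_neq0 k : k != 0 -> rate k != 0.
Proof.
move=> k0; apply/eqP => h; have := cabs_rate k; rewrite h cabs0 => /esym/eqP.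
by rewrite mulf_eq0 pnatr_eq0 /= pnatr_eq0 absz_eq0 (negbTE k0).
Qed.

(** Integration by parts: [F * wave k / rate k] carries the oscillation, while the
    remainder has derivative [- dF * wave k / rate k] and varies slowly.  The factor
    3 in the bound on [dF] is the one for a product of three factors. *)
Lemma duhamel_exists (F dF : R -> R[i]) (T A : R) (k : int) : 0 < T ->
  (forall t, 0 <= t <= T -> has_cderiv F t (dF t)) ->
  (forall t, 0 <= t <= T -> cabs (F t) <= A) ->
  (forall t, 0 <= t <= T -> cabs (dF t) <= 3 * A / T) ->
  exists H dH : R -> R[i],
   [/\ H 0 = 0, forall t, 0 <= t <= T -> has_cderiv H t (F t * wave k t),
       forall t, 0 <= t <= T -> cabs (H t) <= A * t,
       forall t, 0 <= t <= T -> has_cderiv (fun s => H s - F s * wave k s / rate k) t (dH t) &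
       k != 0 -> forall t, 0 <= t <= T ->
          cabs (H t - F t * wave k t / rate k) <= 2 * A / (absz k)%:R /\
          cabs (dH t) <= 2 * A / (absz k)%:R / T].
Proof.
move=> T0 hF bF bdF.
have [H [H0 dH]] := cprimitive_exists (ltW T0)
  (fun t ht => has_cderivM (hF t ht) (has_cderiv_wave k t)).
have A0 : 0 <= A by apply: le_trans (bF 0 _); rewrite ?cabs_ge0 // lexx ltW.
pose h s := H s - F s * wave k s / rate k.
pose dh s := F s * wave k s - (dF s * wave k s + F s * (rate k * wave k s)) / rate k.
have hd t : 0 <= t <= T -> has_cderiv h t (dh t).
  move=> ht; apply: has_cderivB (dH t ht) _.
  apply: has_cderiv_ext (has_cderivZ (rate k)^-1 (has_cderivM (hF t ht) (has_cderiv_wave k t))) => [s|].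
    by rewrite mulrC.
  by rewrite mulrC.
exists H, dh; split => //.
  move=> t /andP[t0 tT].
  have := @cabs_increment_le R H (fun s => F s * wave k s) A t t0 _ _.
  rewrite H0 subr0; apply => s /andP[s0 st].
    by apply: dH; rewrite s0 (le_trans st).
  by rewrite cabsM cabs_wave mulr1; apply: bF; rewrite s0 (le_trans st).
move=> k0.
have r0 := rate_neq0 k0.
have dhE s : dh s = - (dF s * wave k s / rate k).
  rewrite /dh mulrDl opprD addrCA [X in _ + (_ - X)](_ : _ = F s * wave k s).
    by rewrite subrr addr0.
  by rewrite mulrCA mulrC mulKf.
have a0 : 0 < (absz k)%:R :> R by rewrite ltr0n absz_gt0.
have bdh s : 0 <= s <= T -> cabs (dh s) <= 3 / 2 * A / (absz k)%:R / T.
  move=> hs; rewrite dhE cabsN !cabsM cabs_wave mulr1 cabsV cabs_rate.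
  apply: le_trans (_ : 3 * A / T * (2 * (absz k)%:R)^-1 <= _).
    by rewrite ler_wpM2r ?invr_ge0 ?mulr_ge0 ?bdF.
  by rewrite le_eqVlt; apply/orP; left; apply/eqP; field; rewrite !gt_eqF.
have Ak : 0 <= A / (absz k)%:R by rewrite divr_ge0 // ltW.
move=> t ht; split; last first.
  apply: le_trans (bdh t ht) _; rewrite ler_wpM2r ?invr_ge0 ?(ltW T0) //; lra.
have /andP[t0 tT] := ht.
have h0 : cabs (h 0) <= A / (2 * (absz k)%:R).
  rewrite /h H0 sub0r cabsN !cabsM cabs_wave mulr1 cabsV cabs_rate.
  by rewrite ler_wpM2r ?invr_ge0 ?mulr_ge0 // bF // lexx ltW.
have hinc : cabs (h t - h 0) <= 3 / 2 * A / (absz k)%:R / T * t.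
  apply: (@cabs_increment_le R h dh) => // s /andP[s0 st].
    by apply: hd; rewrite s0 (le_trans st).
  by apply: bdh; rewrite s0 (le_trans st).
have htri : cabs (h t) <= cabs (h t - h 0) + cabs (h 0).
  by rewrite -[in leLHS](subrK (h 0) (h t)) cabsD.
apply: le_trans htri _.
apply: le_trans (_ : 3 / 2 * A / (absz k)%:R + A / (2 * (absz k)%:R) <= _); last first.
  by rewrite le_eqVlt; apply/orP; left; apply/eqP; field; rewrite gt_eqF.
apply: lerD => //; apply: le_trans hinc _.
rewrite -mulrA ler_piMr //; first by rewrite -mulrA mulr_ge0.
by rewrite mulrC ler_pdivrMr // mul1r.
Qed.

End Oscillation.

(** * One Picard step *)

Lemma freq_in_bound N M n x : n \in ints N -> x \in quintuples N M ->
  freq n x \in ints (freq_bound N M).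
Proof.
rewrite mem_ints => nN /allpairsP[[[j l] [[t1 t2] t3]] /= [jl t ->]].
move: jl; rewrite mem_pairs !mem_ints => /andP[jN lN].
have : [/\ t1 \in ints M, t2 \in ints M & t3 \in ints M].
  move: t => /allpairsP[[[u1 u2] u3] /= [+ ? [-> -> ->]]].
  by rewrite mem_pairs => /andP[? ?]; split.
rewrite !mem_ints => -[h1 h2 h3]; rewrite /freq /phase /freq_bound /=.
have p : (absz ((n - j) * (n - l))%R <= (2 * N) ^ 2)%N.
  by rewrite abszM expnS expn1; apply: leq_mul; lia.
set y := (n - j) * (n - l) in p *.
by lia.
Qed.

Section Picard.
Variable R : realType.
Implicit Types (N M : nat) (n : int) (b : int -> int -> R).

(** The interactions with [j = n] add up to the mean square of [a] times [a n], and
    so do those with [l = n]; the equation subtracts both. *)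
Definition sgn (n : int) (x : int * int) : R[i] :=
  1 - (n - x.1 == 0)%:R - (n - x.2 == 0)%:R.

Lemma sgn_adm n x : ~~ adm n x -> sgn n x = 0.
Proof.
rewrite /adm /admissible /sgn.
by case: (n - x.1 == 0); case: (n - x.2 == 0) => //= _; ring.
Qed.

Lemma cabs_sgn_le n x : cabs (sgn n x) <= 1.
Proof.
rewrite /sgn; case: (n - x.1 == 0); case: (n - x.2 == 0);
  by rewrite !(mulr1n, mulr0n, subr0, subrr, sub0r, cabsN, cabs1, cabs0).
Qed.

Definition nonlin N (a : int -> R -> R[i]) n t : R[i] :=
  \sum_(x <- pairs N) sgn n x * wave (phase n x) t *
    (a x.1 t * conjc (a (x.1 + x.2 - n) t) * a x.2 t).

(** A superposition of waves with slowly varying amplitudes: over a time [T] they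
    may change by as much as their size. *)
Definition atomic N M (T : R) b (a : int -> R -> R[i]) : Prop :=
  exists c dc : int -> int -> R -> R[i],
   [/\ forall n k t, 0 <= t <= T -> has_cderiv (c n k) t (dc n k t),
       forall n k t, 0 <= t <= T -> cabs (c n k t) <= b n k,
       forall n k t, 0 <= t <= T -> cabs (dc n k t) <= b n k / T &
       forall n t, a n t = \sum_(k <- ints M) c n k t * wave k t].

Lemma sum3_mul (I : Type) (s : seq I) (f g h : I -> R[i]) :
  (\sum_(i <- s) f i) * (\sum_(i <- s) g i) * (\sum_(i <- s) h i) =
  \sum_(i <- s) \sum_(j <- s) \sum_(k <- s) f i * g j * h k.
Proof.
rewrite -mulrA mulr_suml; apply: eq_bigr => i _.
rewrite mulr_suml mulr_sumr; apply: eq_bigr => j _.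
by rewrite mulrA mulr_sumr.
Qed.

Lemma big_quintuples_gen (V : nmodType) N M (F : int * int * (int * int * int) -> V) :
  \sum_(x <- quintuples N M) F x =
  \sum_(x <- pairs N) \sum_(t1 <- ints M) \sum_(t2 <- ints M) \sum_(t3 <- ints M)
     F (x, (t1, t2, t3)).
Proof.
rewrite big_allpairs_dep /=; apply: eq_bigr => x _.
by rewrite big_allpairs_dep /= big_allpairs_dep.
Qed.

(** Each interaction is integrated by [duhamel_exists].  Its boundary term stays at
    the frequency [k] of the interaction; its remainder, or the whole integral if
    [T * |k| < 1], joins the datum at frequency 0. *)
Lemma picard_step_exists (w : R[i]) N M (T : R) b (g : int -> R[i]) (a : int -> R -> R[i]) :
  cabs w <= 1 -> 0 < T ->
  (forall n k, 0 <= b n k) -> (forall n k, n \notin ints N -> b n k = 0) ->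
  atomic N M T b a ->
  exists a' : int -> R -> R[i],
   [/\ atomic N (freq_bound N M) T (majorant_step T (fun n => cabs (g n)) N M b) a',
       forall n, n \in ints N -> a' n 0 = g n,
       forall n t, n \in ints N -> 0 <= t <= T -> has_cderiv (a' n) t (w * nonlin N a n t),
       forall n t, n \in ints N -> 0 <= t <= T ->
          cabs (a' n t - g n) <= \sum_(k <- ints (freq_bound N M))
            (if 1 <= T * (absz k)%:R then Num.min (conv b N M n k * t) (3 * conv b N M n k / (absz k)%:R)
             else conv b N M n k * t) &
       forall n t, n \notin ints N -> a' n t = 0].
Proof.
move=> w1 T0 b0 bN [c [dc [hc bc bdc aE]]].
set M' := freq_bound N M.
pose Q n k x := adm n x.1 && (freq n x == k).
pose tr n (x : int * int * (int * int * int)) s :=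
  c x.1.1 x.2.1.1 s * conjc (c (x.1.1 + x.1.2 - n) x.2.1.2 s) * c x.1.2 x.2.2 s.
pose dtr n (x : int * int * (int * int * int)) s :=
  (dc x.1.1 x.2.1.1 s * conjc (c (x.1.1 + x.1.2 - n) x.2.1.2 s) +
   c x.1.1 x.2.1.1 s * conjc (dc (x.1.1 + x.1.2 - n) x.2.1.2 s)) * c x.1.2 x.2.2 s +
  c x.1.1 x.2.1.1 s * conjc (c (x.1.1 + x.1.2 - n) x.2.1.2 s) * dc x.1.2 x.2.2 s.
pose F n k s := \sum_(x <- quintuples N M | Q n k x) w * sgn n x.1 * tr n x s.
pose dF n k s := \sum_(x <- quintuples N M | Q n k x) w * sgn n x.1 * dtr n x s.
have wsg n x : cabs (w * sgn n x) <= 1.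
  rewrite cabsM -[leRHS]mulr1; apply: ler_pM; rewrite ?cabs_ge0 //; exact: cabs_sgn_le.
have hF n k t : 0 <= t <= T -> has_cderiv (F n k) t (dF n k t).
  move=> ht; apply: has_cderiv_sum => x _; apply: has_cderivZ.
  apply: has_cderivM (hc _ _ _ ht); apply: has_cderivM; first exact: hc.
  exact/has_cderivJ/hc.
have bF n k t : 0 <= t <= T -> cabs (F n k t) <= conv b N M n k.
  move=> ht; apply: le_trans (cabs_sum _ _ _) _; apply: ler_sum => x _.
  rewrite cabsM -[leRHS]mul1r; apply: ler_pM; rewrite ?cabs_ge0 //.
  rewrite /tr /trip !cabsM cabs_conj.
  by apply: ler_pM; rewrite ?mulr_ge0 ?cabs_ge0 ?bc //; apply: ler_pM; rewrite ?cabs_ge0 ?bc.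
have bdF n k t : 0 <= t <= T -> cabs (dF n k t) <= 3 * conv b N M n k / T.
  move=> ht; apply: le_trans (cabs_sum _ _ _) _.
  rewrite mulrAC mulr_sumr; apply: ler_sum => x _.
  rewrite cabsM -[leRHS]mul1r; apply: ler_pM; rewrite ?cabs_ge0 //.
  have l3 (z1 z2 z3 z1' z2' z3' : R[i]) (y1 y2 y3 : R) : cabs z1 <= y1 -> cabs z2 <= y2 -> cabs z3 <= y3 ->
     cabs z1' <= y1 / T -> cabs z2' <= y2 / T -> cabs z3' <= y3 / T ->
     cabs ((z1' * z2 + z1 * z2') * z3 + z1 * z2 * z3') <= 3 / T * (y1 * y2 * y3).
    move=> h1 h2 h3 k1 k2 k3.
    rewrite mulrDl; apply: le_trans (cabsD _ _) _; apply: le_trans (lerD (cabsD _ _) (lexx _)) _.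
    rewrite !cabsM.
    have l (p1 p2 p3 q1 q2 q3 : R) : 0 <= p1 -> 0 <= p2 -> 0 <= p3 -> p1 <= q1 -> p2 <= q2 -> p3 <= q3 ->
       p1 * p2 * p3 <= q1 * q2 * q3.
      by move=> *; apply: ler_pM; rewrite ?mulr_ge0 //; apply: ler_pM.
    have -> : 3 / T * (y1 * y2 * y3) = y1 / T * y2 * y3 + y1 * (y2 / T) * y3 + y1 * y2 * (y3 / T) by ring.
    by apply: lerD; [apply: lerD|]; apply: l; rewrite ?cabs_ge0.
  by apply: l3; rewrite ?cabs_conj ?bc ?bdc.
have key n k := @duhamel_exists R (F n k) (dF n k) T (conv b N M n k) k T0 (hF n k) (bF n k) (bdF n k).
have [H hH] := choice (fun nk : int * int => key nk.1 nk.2).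
have [dH {}hH] := choice hH.
have cv0 n k : 0 <= conv b N M n k by exact: conv_ge0.
pose hi k := 1 <= T * (absz k)%:R.
have hi0 k : hi k -> k != 0.
  by rewrite /hi; case: (eqVneq k 0) => [->|//]; rewrite /= mulr0 ler10.
pose h n k s := if hi k then H (n, k) s - F n k s * wave k s / rate R k else H (n, k) s.
pose dh n k s := if hi k then dH (n, k) s else F n k s * wave k s.
pose p n k s := if hi k then (rate R k)^-1 * F n k s else 0.
pose dp n k s := if hi k then (rate R k)^-1 * dF n k s else 0.
have hh n k t : 0 <= t <= T -> has_cderiv (h n k) t (dh n k t).
  by move=> ht; have [_ h1 _ h2 _] := hH (n, k); rewrite /h /dh; case: (hi k); [exact: h2 | exact: h1].
have hp n k t : 0 <= t <= T -> has_cderiv (p n k) t (dp n k t).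
  move=> ht; rewrite /p /dp; case: (hi k); last exact: has_cderiv_cst.
  exact/has_cderivZ/hF.
have bh n k t : 0 <= t <= T -> cabs (h n k t) <= 2 * damp T k * conv b N M n k /\
    cabs (dh n k t) <= 2 * damp T k * conv b N M n k / T.
  move=> ht; have /andP[t0 tT] := ht; have [_ _ h1 _ h2] := hH (n, k); rewrite /h /dh /damp -/(hi k).
  case: ifPn => hk.
    have [e1 e2] := h2 (hi0 _ hk) t ht.
    by rewrite (_ : 2 * _ * _ = 2 * conv b N M n k / (absz k)%:R); [split | ring].
  have c0 := cv0 n k.
  split.
    apply: le_trans (h1 t ht) _ => /=; nra.
  rewrite cabsM cabs_wave mulr1 ler_pdivlMr //.
  apply: le_trans (ler_wpM2r (ltW T0) (bF n k t ht)) _; nra.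
have bp n k t : 0 <= t <= T -> cabs (p n k t) <= 2 * damp T k * conv b N M n k /\
    cabs (dp n k t) <= 2 * damp T k * conv b N M n k / T.
  move=> ht; rewrite /p /dp /damp -/(hi k).
  case: ifPn => hk; last first.
    by rewrite cabs0 !mulr_ge0 ?invr_ge0 // ltW.
  have k0 : 0 < (absz k)%:R :> R by rewrite ltr0n absz_gt0 hi0.
  have i0 : 0 <= ((absz k)%:R : R)^-1 by rewrite invr_ge0 ltW.
  have c0 : 0 <= ((absz k)%:R : R)^-1 * conv b N M n k by rewrite mulr_ge0.
  rewrite !cabsM cabsV cabs_rate invfM; split.
    apply: le_trans (ler_wpM2l _ (bF n k t ht)) _; first by rewrite mulr_ge0 // invr_ge0.
    rewrite -!mulrA; lra.
  apply: le_trans (ler_wpM2l _ (bdF n k t ht)) _; first by rewrite mulr_ge0 // invr_ge0.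
  rewrite [leLHS](_ : _ = 3 / 2 * ((absz k)%:R^-1 * conv b N M n k) / T); last by ring.
  rewrite -[2 * _ * _]mulrA ler_wpM2r ?invr_ge0 ?(ltW T0) //; lra.
pose c' n k s := if n \in ints N then
    p n k s + (k == 0)%:R * (g n + \sum_(u <- ints M') h n u s) else 0.
pose dc' n k s := if n \in ints N then
    dp n k s + (k == 0)%:R * (0 + \sum_(u <- ints M') dh n u s) else 0.
pose a' n s := \sum_(k <- ints M') c' n k s * wave k s.
have a'E n s : n \in ints N -> a' n s = g n + \sum_(k <- ints M') H (n, k) s.
  move=> nN; rewrite /a' /c' nN.
  under eq_bigr do rewrite mulrDl.
  rewrite big_split /= addrC.
  have zero_in : 0 \in ints M' by rewrite mem_ints.
  have pick (Y : R[i]) : \sum_(k <- ints M') (k == 0)%:R * Y * wave k s = Y.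
    rewrite (big_rem _ zero_in) eqxx mul1r wave0 mulr1 big_seq_cond big1 ?addr0 //=; first exact: addr0.
    move=> k; rewrite mem_rem_uniq ?ints_uniq // inE andbT => /andP[/negbTE -> _].
    by rewrite !mul0r.
  rewrite pick.
  rewrite -addrA -big_split /=; congr (_ + _); apply: eq_bigr => k _.
  rewrite /h /p; case: (hi k); last by rewrite mul0r addr0.
  by rewrite [X in _ + X](_ : _ = F n k s * wave k s / rate R k) ?subrK //; ring.
exists a'; split.
- exists c', dc'; split => //.
  + move=> n k t ht; rewrite /c' /dc'; case: (n \in ints N); last exact: has_cderiv_cst.
    apply: has_cderivD; first exact: hp.
    apply: has_cderivZ; apply: has_cderivD; first exact: has_cderiv_cst.
    by apply: has_cderiv_sum => u _; exact: hh.
  + move=> n k t ht; rewrite /c' /majorant_step; case: (n \in ints N); last by rewrite cabs0.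
    apply: le_trans (cabsD _ _) _; apply: lerD; first by have [] := bp n k t ht.
    case: (k == 0); last by rewrite !mul0r cabs0.
    rewrite !mul1r; apply: le_trans (cabsD _ _) _; rewrite lerD2l.
    apply: le_trans (cabs_sum _ _ _) _; apply: ler_sum => u _.
    by have [] := bh n u t ht.
  + move=> n k t ht; rewrite /dc' /majorant_step; case: (n \in ints N); last by rewrite cabs0 mul0r.
    apply: le_trans (cabsD _ _) _; rewrite mulrDl; apply: lerD; first by have [] := bp n k t ht.
    case: (k == 0); last by rewrite !mul0r cabs0.
    rewrite !mul1r add0r; apply: le_trans (cabs_sum _ _ _) _.
    rewrite mulrDl -[leLHS]add0r; apply: lerD.
      by rewrite divr_ge0 ?cabs_ge0 // ltW.
    by rewrite mulr_suml; apply: ler_sum => u _; have [] := bh n u t ht.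
- move=> n nN; rewrite a'E // big1 ?addr0 // => k _; by have [] := hH (n, k).
- move=> n t nN ht.
  apply: has_cderiv_ext (_ : has_cderiv (fun s => g n + \sum_(k <- ints M') H (n, k) s) t
     (0 + \sum_(k <- ints M') F n k t * wave k t)) => [s||]; first by rewrite a'E.
    rewrite add0r.
    have -> : \sum_(k <- ints M') F n k t * wave k t =
      \sum_(k <- ints M') \sum_(x <- quintuples N M | Q n k x) w * sgn n x.1 * tr n x t * wave k t.
      by apply: eq_bigr => k _; rewrite mulr_suml.
    rewrite (sum_partition (fun x => adm n x.1) _ (fun x => freq n x)
      (fun x k => w * sgn n x.1 * tr n x t * wave k t) (ints_uniq M')).
    have -> : \sum_(x <- quintuples N M | adm n x.1 && (freq n x \in ints M'))
        w * sgn n x.1 * tr n x t * wave (freq n x) t =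
       \sum_(x <- quintuples N M) w * sgn n x.1 * tr n x t * wave (freq n x) t.
      rewrite big_mkcond big_seq [RHS]big_seq; apply: eq_bigr => x xin.
      rewrite (freq_in_bound nN xin) andbT; case: ifPn => // /sgn_adm ->.
      by rewrite mulr0 !mul0r.
    rewrite big_quintuples_gen /nonlin mulr_sumr; apply: eq_bigr => x _.
    rewrite !aE conj_sum sum3_mul !mulr_sumr; apply: eq_bigr => t1 _.
    rewrite !mulr_sumr; apply: eq_bigr => t2 _.
    rewrite !mulr_sumr; apply: eq_bigr => t3 _.
    rewrite rmorphM /= /tr /freq /= !waveD !waveN /=; ring.
  apply: has_cderivD; first exact: has_cderiv_cst.
  by apply: has_cderiv_sum => k _; have [_ h1 _ _ _] := hH (n, k); exact: h1.
- move=> n t nN ht; rewrite a'E // addrC addKr.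
  apply: le_trans (cabs_sum _ _ _) _; apply: ler_sum => k _.
  have [_ _ h1 _ h2] := hH (n, k).
  rewrite -/(hi k); case: ifPn => hk; last exact: h1.
  rewrite le_min h1 //=.
  have [e1 _] := h2 (hi0 _ hk) t ht.
  have k0 : 0 < (absz k)%:R :> R by rewrite ltr0n absz_gt0 hi0.
  have e3 : cabs (F n k t * wave k t / rate R k) <= conv b N M n k / (absz k)%:R.
    rewrite !cabsM cabs_wave mulr1 cabsV cabs_rate.
    apply: ler_pM; rewrite ?cabs_ge0 ?invr_ge0 ?mulr_ge0 ?bF //.
    by rewrite lef_pV2 ?posrE ?mulr_gt0 //; lra.
  rewrite -(subrK (F n k t * wave k t / rate R k) (H (n, k) t)).
  apply: le_trans (cabsD _ _) _; apply: le_trans (lerD e1 e3) _ => /=; lra.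
- by move=> n t nN; rewrite /a' /c' (negbTE nN) big1 // => k _; rewrite mul0r.
Qed.

End Picard.

(** * The truncated system *)

Section Iteration.
Variable R : realType.
Implicit Types (N M : nat) (n : int) (b : int -> int -> R).
Local Notation jap := (bracket R).

Lemma min_le_powR (u v e : R) : 0 <= u -> 0 <= v -> 0 < e < 1 ->
  Num.min u v <= u `^ e * v `^ (1 - e).
Proof.
move=> u0 v0 /andP[e0 e1].
set m := Num.min u v; have m0 : 0 <= m by rewrite /m le_min u0 v0.
have -> : m = m `^ e * m `^ (1 - e).
  have [->|mn0] := eqVneq m 0; first by rewrite powR0 ?mul0r // gt_eqF.
  rewrite -powRD ?mn0 ?implybT // (_ : e + (1 - e) = 1); last by ring.
  by rewrite powRr1.
apply: ler_pM; rewrite ?powR_ge0 //; apply: ge0_ler_powR; rewrite ?nnegrE //.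
- exact: ltW.
- by rewrite /m ge_min lexx.
- by lra.
- by rewrite /m ge_min lexx orbT.
Qed.

(** The minimum of two bounds is at most their geometric mean with exponents [e]
    and [1 - e]. *)
Lemma duhamel_gain_le (T t e A : R) (k : int) : 0 < T <= 1 -> 0 <= t <= T -> 0 < e < 1 -> 0 <= A ->
  (if 1 <= T * (absz k)%:R then Num.min (A * t) (3 * A / (absz k)%:R) else A * t)
  <= 6 * t `^ e * (A * jap k `^ (-1 + e)).
Proof.
move=> /andP[T0 T1] /andP[t0 tT] e01 A0; have /andP[e0 e1] := e01.
set y : R := (absz k)%:R; have y0 : 0 <= y by exact: ler0n.
have J0 : 0 < jap k := bracket_gt0 R k.
have JE : jap k = 1 + y by [].
have main : (if 1 <= T * y then Num.min t (3 / y) else t) <= Num.min t (6 / jap k).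
  case: ifPn => h.
    have y1 : 1 <= y by apply: le_trans h _; rewrite ler_piMl.
    rewrite le_min ge_min lexx /= ge_min; apply/orP; right.
    rewrite ler_pdivrMr; last by lra.
    rewrite mulrAC ler_pdivlMr // JE; lra.
  rewrite -ltNge in h.
  rewrite le_min lexx /= ler_pdivlMr // JE mulrDr mulr1.
  have : t * y <= T * y by rewrite ler_wpM2r.
  lra.
apply: le_trans (_ : A * Num.min t (6 / jap k) <= _).
  apply: le_trans (ler_wpM2l A0 main); case: ifP => // _.
  by rewrite minr_pMr // (_ : A * (3 / y) = 3 * A / y) //; ring.
rewrite [leRHS](_ : _ = A * (t `^ e * (6 * jap k `^ (-1 + e)))); last by ring.
rewrite ler_wpM2l //.
apply: le_trans (min_le_powR t0 _ e01) _; first by rewrite divr_ge0 // ltW.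
rewrite ler_wpM2l ?powR_ge0 // powRM ?invr_ge0 ?(ltW J0) //.
have -> : -1 + e = - (1 - e) by ring.
rewrite -(powR_inv1 (ltW J0)) -powRrM mulN1r ler_wpM2r ?powR_ge0 //.
by apply: ler1_powR; lra.
Qed.

Lemma nonlin_lipschitz N (x a : int -> R -> R[i]) (B t : R) :
  (forall n, n \notin ints N -> x n t = 0) -> (forall n, n \notin ints N -> a n t = 0) ->
  \sum_(n <- ints N) cabs (x n t) <= B -> \sum_(n <- ints N) cabs (a n t) <= B ->
  \sum_(n <- ints N) cabs (nonlin N x n t - nonlin N a n t) <=
  3 * B ^+ 2 * \sum_(n <- ints N) cabs (x n t - a n t).
Proof.
move=> xN aN xB aB.
pose X n := cabs (x n t); pose A n := cabs (a n t); pose D n := cabs (x n t - a n t).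
have X0 n : 0 <= X n := cabs_ge0 _.
have A0 n : 0 <= A n := cabs_ge0 _.
have D0 n : 0 <= D n := cabs_ge0 _.
have XN n : n \notin ints N -> X n = 0 by move=> nN; rewrite /X xN // cabs0.
have DN n : n \notin ints N -> D n = 0 by move=> nN; rewrite /D xN // aN // subr0 cabs0.
have AN n : n \notin ints N -> A n = 0 by move=> nN; rewrite /A aN // cabs0.
have pt n : cabs (nonlin N x n t - nonlin N a n t) <=
  \sum_(y <- pairs N) D y.1 * X (y.1 + y.2 - n) * X y.2 +
  (\sum_(y <- pairs N) A y.1 * D (y.1 + y.2 - n) * X y.2 +
   \sum_(y <- pairs N) A y.1 * A (y.1 + y.2 - n) * D y.2).
  rewrite /nonlin -sumrB -!big_split /=; apply: le_trans (cabs_sum _ _ _) _.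
  apply: ler_sum => y _; rewrite -mulrBr cabsM -[leRHS]mul1r.
  apply: ler_pM; rewrite ?cabs_ge0 //.
    by rewrite cabsM cabs_wave mulr1 cabs_sgn_le.
  set x1 := x y.1 t; set x2 := x (y.1 + y.2 - n) t; set x3 := x y.2 t.
  set a1 := a y.1 t; set a2 := a (y.1 + y.2 - n) t; set a3 := a y.2 t.
  have -> : x1 * conjc x2 * x3 - a1 * conjc a2 * a3 =
     (x1 - a1) * conjc x2 * x3 + (a1 * conjc (x2 - a2) * x3 + a1 * conjc a2 * (x3 - a3)).
    by rewrite rmorphB /=; ring.
  apply: le_trans (cabsD _ _) _; apply: lerD; first by rewrite !cabsM cabs_conj.
  by apply: le_trans (cabsD _ _) _; rewrite !cabsM !cabs_conj.
apply: le_trans (ler_sum _ (fun n _ => pt n)) _.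
rewrite big_split /= big_split /=.
set S := \sum_(n <- ints N) D n.
have S0 : 0 <= S by apply: sumr_ge0.
have SX0 : 0 <= \sum_(n <- ints N) X n by apply: sumr_ge0.
have SA0 : 0 <= \sum_(n <- ints N) A n by apply: sumr_ge0.
have B0 : 0 <= B by apply: le_trans SX0 xB.
have BB (u v : R) : 0 <= u -> 0 <= v -> u <= B -> v <= B -> u * v <= B ^+ 2.
  by move=> *; rewrite expr2; apply: ler_pM.
rewrite -/S (_ : 3 * B ^+ 2 * S = B ^+ 2 * S + (B ^+ 2 * S + B ^+ 2 * S)); last by ring.
apply: lerD; last apply: lerD.
- apply: le_trans (sum_trilinear_le D0 X0 X0 XN) _.
  by rewrite -mulrA mulrC ler_wpM2r // BB.
- apply: le_trans (sum_trilinear_le A0 D0 X0 DN) _.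
  by rewrite mulrAC ler_wpM2r // BB.
- apply: le_trans (sum_trilinear_le A0 A0 D0 AN) _.
  by rewrite ler_wpM2r // BB.
Qed.

End Iteration.

Section APriori.
Variable R : realType.
Local Notation jap := (bracket R).

(** Holder's inequality with the summable weight [jap ^ (- s)]. *)
Lemma atomic_le (r s : R) : 1 < r -> 1 < s -> exists C : R, 0 < C /\
  forall N M T b (a : int -> R -> R[i]) n t, (forall n k, 0 <= b n k) ->
    atomic N M T b a -> 0 <= t <= T ->
    cabs (a n t) <= C * energy r s b M n `^ (r^-1).
Proof.
move=> r1 s1; have [C [C0 HC]] := sum_bracket_le s1.
have r0 : 0 < r by lra.
exists (C `^ ((r - 1) * r^-1)); split; first exact: powR_gt0.
move=> N M T b a n t b0 [c [dc [_ bc _ aE]]] ht.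
apply: le_trans (_ : \sum_(k <- ints M) b n k <= _).
  rewrite aE; apply: le_trans (cabs_sum _ _ _) _; apply: ler_sum => k _.
  by rewrite cabsM cabs_wave mulr1 bc.
set S := \sum_(k <- ints M) b n k.
have S0 : 0 <= S by apply: sumr_ge0.
have H := powR_sum_weighted_le (ints M) xpredT (ltW r1)
     (fun k => bracket_powR_gt0 k (- s)) (fun k => b0 n k).
have e1 : \sum_(k <- ints M) (jap k `^ (- s)) `^ (1 - r) * b n k `^ r = energy r s b M n.
  by apply: eq_bigr => k _; rewrite -powRrM; congr (_ `^ _ * _); ring.
rewrite e1 -/S in H.
have -> : S = (S `^ r) `^ (r^-1) by rewrite -powRrM divff ?gt_eqF // powRr1.
have E0 := energy_ge0 r s b M n.
apply: le_trans (_ : (C `^ (r - 1) * energy r s b M n) `^ (r^-1) <= _); last first.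
  by rewrite powRM ?powR_ge0 // -powRrM.
apply: ge0_ler_powR; rewrite ?nnegrE ?powR_ge0 ?invr_ge0 ?(ltW r0) ?mulr_ge0 ?powR_ge0 //.
apply: le_trans H _; rewrite ler_wpM2r //; apply: ge0_ler_powR; rewrite ?nnegrE ?(ltW C0) ?HC ?ints_uniq //.
  by lra.
by apply: sumr_ge0 => k _; exact: powR_ge0.
Qed.

Lemma sum_ints_at0 (V : nmodType) M (F : int -> V) : (forall k, k != 0 -> F k = 0) ->
  \sum_(k <- ints M) F k = F 0.
Proof.
move=> F0; have zero_in : 0 \in ints M by rewrite mem_ints.
rewrite (big_rem _ zero_in) /= big_seq big1 ?addr0 // => k.
by rewrite mem_rem_uniq ?ints_uniq // inE => /andP[/F0].
Qed.

(** For [T] small depending on [G], the bound [total <= K] is invariant under a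
    Picard step, so all iterates [a] satisfy it, and the [l ^ q] estimate for the
    next iterate follows from [sum_conv_bracket_le] and [kernel_le].  The weights
    [wt] turn the invariant bound into one in [l ^ 1], where the nonlinearity is
    Lipschitz; measured with the factor [expR (2 * L * t)], the distance from [x] to
    the iterates is halved by a step, up to the contribution of [err].  The constants
    [C] and [e] must not depend on [B], [W] and [D], which are not controlled by the
    norm of the datum. *)
Lemma apriori (q lam G : R) : 1 <= q -> 0 < lam -> 0 < G ->
  let p := 3 * q / (1 + 2 * lam) in 1 <= p ->
  exists T0 e C : R, [/\ 0 < T0 <= 1, 0 < e, 0 < C &
  forall T (w : R[i]) N (wt : int -> R) (W B D : R) (x err : int -> R -> R[i]) (g : int -> R[i]),
    0 < T <= T0 -> cabs w <= 1 ->
    (forall n, 1 <= wt n) -> (forall j k l, wt (j - k + l) <= wt j * wt k * wt l) ->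
    \sum_(n <- ints N) wt n `^ p * cabs (g n) `^ p <= G ->
    \sum_(n <- ints N) (wt n)^-1 <= W ->
    (forall n, n \in ints N -> x n 0 = g n) -> (forall n t, n \notin ints N -> x n t = 0) ->
    (forall n t, n \in ints N -> 0 <= t <= T ->
        has_cderiv (x n) t (w * nonlin N x n t + err n t)) ->
    (forall t, 0 <= t <= T -> \sum_(n <- ints N) cabs (err n t) <= D) ->
    (forall t, 0 <= t <= T -> \sum_(n <- ints N) cabs (x n t) <= B) ->
    forall m : nat, exists a : int -> R -> R[i],
      (forall t, 0 <= t <= T -> \sum_(n <- ints N) cabs (a n t - g n) `^ q <= (C * t `^ e) `^ q) /\
      (forall t, 0 <= t <= T -> \sum_(n <- ints N) cabs (x n t - a n t) <=
         ((2 * (B + C * W + 1)) * 2^-1 ^+ m + D) * expR (6 * (B + C * W + 1) ^+ 2 * t))].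
Proof.
move=> q1 l0 G0 p p1.
have p0 : 0 < p by lra.
have q0 : 0 < q by lra.
(* The exponent r is so large that the loss r^-1 in the kernel is affordable for
   kernel_le (see hk); s, e and X then balance the gain of a step (see hX). *)
pose y := 4 * q * (1 + lam) / lam.
have y0 : 0 < y by rewrite divr_gt0 // !mulr_gt0 //; lra.
pose r := y + p + 2.
have r2 : 2 < r by rewrite /r; lra.
have r1 : 1 < r by lra.
have r0 : 0 < r by lra.
pose s := 1 + (4 * r)^-1; pose e := (8 * r)^-1; pose X := (2 * r)^-1.
have ri0 : 0 < r^-1 by rewrite invr_gt0.
have sE : s = 1 + 4^-1 * r^-1 by rewrite /s invfM.
have eE : e = 8^-1 * r^-1 by rewrite /e invfM.
have XE : X = 2^-1 * r^-1 by rewrite /X invfM.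
have yr : y <= r by rewrite /r; lra.
have ylam : y * lam = 4 * q * (1 + lam) by rewrite /y divfK // gt_eqF.
have pr : p <= r by rewrite /r; lra.
clearbody s e X r y.
have ri1 : r^-1 < 1 by rewrite invf_lt1.
have s1 : 1 < s by rewrite sE; lra.
have e0 : 0 < e by rewrite eE; lra.
have es : e < s - 1 by rewrite eE sE; lra.
have X01 : 0 < X < 1 by rewrite XE; apply/andP; split; lra.
have rr : r * r^-1 = 1 by rewrite divff // gt_eqF.
have hX : s * (r - 1) + (-1 + X) * r <= - (e * (r - 1)).
  rewrite sE eE XE.
  have -> : (1 + 4^-1 * r^-1) * (r - 1) + (-1 + 2^-1 * r^-1) * r =
    - 1 + 4^-1 * (r * r^-1) - 4^-1 * r^-1 + 2^-1 * (r * r^-1) by field; rewrite gt_eqF.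
  have -> : 8^-1 * r^-1 * (r - 1) = 8^-1 * (r * r^-1) - 8^-1 * r^-1 by ring.
  rewrite rr; lra.
have hk : 1 < (1 - 2 * q * r^-1) * (1 + lam).
  have h1 : 4 * q * (1 + lam) <= r * lam by rewrite -ylam ler_wpM2r // ltW.
  have h2 : 4 * q * (1 + lam) * r^-1 <= lam.
    by rewrite ler_pdivrMr // mulrC in h1 *; lra.
  have -> : (1 - 2 * q * r^-1) * (1 + lam) = 1 + lam - 2^-1 * (4 * q * (1 + lam) * r^-1) by field; rewrite gt_eqF.
  lra.
have [C1 [C2 [C10 C20 Hstep]]] := total_step_le r1 s1 p0 pr e0 es X01 hX.
(* In a step the datum contributes C1 * G, and the cubic term at most G. *)
pose K := 2 * (C1 + 1) * G.
have K0 : 0 < K by rewrite !mulr_gt0 //; lra.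
have GK : G <= K by rewrite /K; nra.
have KE : K = C1 * G + G + (C1 * G + G) by rewrite /K; ring.
clearbody K.
have [Ca [Ca0 HCa]] := atomic_le r1 s1.
have [Cb [Cb0 HCb]] := sum_conv_bracket_le r1 s1 ri0 (lexx r^-1).
have [Ck [Ck0 HCk]] := kernel_le q1 ri0 l0 hk (ltW K0).
pose T1 := (G / (C2 * K ^+ 3)) `^ ((X * p)^-1).
have X0 : 0 < X by case/andP: X01.
have Xp : 0 < X * p by rewrite mulr_gt0.
have T10 : 0 < T1 by rewrite powR_gt0 // divr_gt0 // mulr_gt0 // exprn_gt0.
pose T0 := Num.min 1 T1.
pose Cq := 6 * Cb * Ck `^ (q^-1).
have Cq0 : 0 < Cq by rewrite !mulr_gt0 // powR_gt0.
pose CW := Ca * K `^ (p^-1).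
have CW0 : 0 < CW by rewrite mulr_gt0 // powR_gt0.
have CqE : Cq = 6 * Cb * Ck `^ (q^-1) by [].
have CWE : CW = Ca * K `^ (p^-1) by [].
clearbody Cq CW.
exists T0, r^-1, (Cq + CW); split => //.
- by rewrite /T0 lt_min ltr01 T10 ge_min lexx.
- exact: addr_gt0.
move=> T w N wt W B D x err g /andP[T_gt0 TT0] w1 wt1 wtM gG wW x0 xN dx errD xB.
have T1le : T <= 1 by apply: le_trans TT0 _; rewrite /T0 ge_min lexx.
have T01 : 0 < T <= 1 by rewrite T_gt0 T1le.
have Tsmall : C2 * T `^ (X * p) * K ^+ 3 <= G.
  have TT1 : T <= T1 by apply: le_trans TT0 _; rewrite /T0 ge_min lexx orbT.
  have K3 : 0 < C2 * K ^+ 3 by rewrite mulr_gt0 // exprn_gt0.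
  rewrite mulrAC -ler_pdivlMl // [leRHS]mulrC.
  have -> : G / (C2 * K ^+ 3) = T1 `^ (X * p).
    by rewrite /T1 -powRrM mulVf ?gt_eqF // powRr1 // divr_ge0 // ltW.
  by apply: ge0_ler_powR; rewrite ?nnegrE ?(ltW Xp) ?(ltW T_gt0) ?(ltW T10).
have wt0 n : 0 <= wt n by apply: le_trans (wt1 n).
pose L1 := B + (Cq + CW) * W + 1.
have W0 : 0 <= W.
  by apply: le_trans wW; apply: sumr_ge0 => n _; rewrite invr_ge0.
have t0in : 0 <= (0 : R) <= T by rewrite lexx ltW.
have B0 : 0 <= B by apply: le_trans (xB 0 t0in); apply: sumr_ge0 => n _; exact: cabs_ge0.
have D0 : 0 <= D by apply: le_trans (errD 0 t0in); apply: sumr_ge0 => n _; exact: cabs_ge0.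
have L11 : 1 <= L1 by rewrite /L1 lerDr addr_ge0 // mulr_ge0 // addr_ge0 // ltW.
pose St (a : int -> R -> R[i]) := exists M b, [/\ atomic N M T b a, forall n k, 0 <= b n k,
   forall n k, n \notin ints N -> b n k = 0 & total r s p wt N M b <= K].
have St_l1 a : St a -> forall t, 0 <= t <= T -> \sum_(n <- ints N) cabs (a n t) <= L1.
  move=> [M [b [at_a b0 bN bK]]] t ht.
  apply: le_trans (_ : \sum_(n <- ints N) CW * (wt n)^-1 <= _); last first.
    rewrite -mulr_sumr /L1.
    suff : CW * \sum_(n <- ints N) (wt n)^-1 <= (Cq + CW) * W.
      by move: B0; clear; lra.
    apply: ler_pM => //; first exact: ltW.
      by apply: sumr_ge0 => n _; rewrite invr_ge0.
    by rewrite lerDr ltW.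
  rewrite big_seq [leRHS]big_seq; apply: ler_sum => n nN.
  apply: le_trans (HCa _ _ _ _ _ n t b0 at_a ht) _.
  rewrite CWE -mulrA ler_pM2l // ler_pdivlMr; last exact: lt_le_trans (wt1 n).
  have E0 := energy_ge0 r s b M n.
  have -> : energy r s b M n `^ r^-1 * wt n = (wt n `^ p * energy r s b M n `^ (p / r)) `^ (p^-1).
    rewrite powRM ?powR_ge0 // -!powRrM divff ?gt_eqF // powRr1 // mulrC; congr (_ * _ `^ _).
    by field; rewrite !gt_eqF.
  apply: ge0_ler_powR; rewrite ?nnegrE ?invr_ge0 ?(ltW p0) ?(ltW K0) //.
    by rewrite mulr_ge0 ?powR_ge0.
  apply: le_trans bK; rewrite /total (big_rem _ nN) /= lerDl sumr_ge0 // => k _.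
  by rewrite mulr_ge0 ?powR_ge0.
have St_vanish a : St a -> forall n t, n \notin ints N -> 0 <= t <= T -> a n t = 0.
  move=> [M [b [[c [dc [_ bc _ aE]]] b0 bN bK]]] n t nN ht.
  rewrite aE big1 // => k _; have := bc n k t ht; rewrite bN // => h.
  by rewrite (@cabs_eq0 R (c n k t)) ?mul0r //; apply/eqP; rewrite eq_le h cabs_ge0.
pose L := 3 * L1 ^+ 2.
have L10 : 0 < L1 by exact: lt_le_trans ltr01 L11.
have L_gt0 : 0 < L by rewrite mulr_gt0 // exprn_gt0.
have L3 : 1 <= L by rewrite /L; move: L11; clear; nra.
have LE : 6 * L1 ^+ 2 = 2 * L by rewrite /L; ring.
have BL1 : B <= L1 by rewrite /L1 -addrA lerDl addr_ge0 // mulr_ge0 // addr_ge0 // ltW.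
pose claim (Am : R) (a : int -> R -> R[i]) :=
  [/\ St a, forall t, 0 <= t <= T -> \sum_(n <- ints N) cabs (a n t - g n) `^ q <= ((Cq + CW) * t `^ r^-1) `^ q &
   forall t, 0 <= t <= T -> \sum_(n <- ints N) cabs (x n t - a n t) <= Am * expR (2 * L * t)].
suff main m : exists a, claim (2 * L1 * 2^-1 ^+ m + D) a.
  move=> m; have [a [_ h1 h2]] := main m; exists a; split => // t ht.
  apply: le_trans (h2 t ht) _; rewrite le_eqVlt; apply/orP; left; apply/eqP.
  by rewrite -/L1 LE.
have CqW0 : 0 < Cq + CW by exact: addr_gt0.
have ex1 t : 0 <= t -> 1 <= expR (2 * L * t).
  move=> t0; apply: le_trans (expR_ge1Dx _); by rewrite lerDl mulr_ge0 // mulr_ge0 // ltW.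
elim: m => [|m [a [Sta ha1 ha2]]].
  pose a n (t : R) : R[i] := if n \in ints N then g n else 0.
  have Sta : St a.
    exists 0%N, (fun n k => if (n \in ints N) && (k == 0) then cabs (g n) else 0); split.
    - exists (fun n k t => if (n \in ints N) && (k == 0) then g n else 0), (fun _ _ _ => 0); split.
      + by move=> n k t _; exact: has_cderiv_cst.
      + by move=> n k t _; case: ifP => _; rewrite ?cabs0.
      + by move=> n k t _; rewrite cabs0 divr_ge0 ?(ltW T_gt0) //; case: ifP => _; rewrite ?cabs_ge0.
      + move=> n t; rewrite sum_ints_at0 => [|k /negbTE ->]; last by rewrite andbF mul0r.
        by rewrite eqxx andbT wave0 mulr1.
    - by move=> n k; case: ifP => _; rewrite ?cabs_ge0.
    - by move=> n k /negbTE ->.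
    apply: le_trans GK; apply: le_trans gG.
    rewrite /total big_seq [leRHS]big_seq; apply: ler_sum => n nN.
    rewrite ler_wpM2l ?powR_ge0 // /energy sum_ints_at0 => [|k /negbTE ->].
      rewrite nN eqxx /= /bracket /= addr0 powR1 mul1r -powRrM mulrC divfK //.
      by rewrite gt_eqF.
    by rewrite andbF powR0 ?mulr0 // gt_eqF.
  exists a; split => //.
    move=> t ht; rewrite big_seq big1 ?powR_ge0 // => n nN.
    by rewrite /a nN subrr cabs0 powR0 // gt_eqF.
  move=> t ht; have /andP[t0 tT] := ht.
  apply: le_trans (_ : 2 * L1 <= _).
    apply: le_trans (_ : \sum_(n <- ints N) (cabs (x n t) + cabs (a n t)) <= _).
      by apply: ler_sum => n _; exact: cabsB.
    rewrite big_split /=; move: BL1 (St_l1 a Sta t ht) (xB t ht); clear; lra.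
  rewrite expr0 mulr1 -[leLHS]mulr1; apply: ler_pM => //; first by rewrite mulr_ge0 // ltW.
    by rewrite lerDl.
  exact: ex1.
have [M [b [at_a b0 bN bK]]] := Sta.
have [a' [at_a' a'0 da' ba' a'N]] := picard_step_exists g w1 T_gt0 b0 bN at_a.
have total0 : 0 <= total r s p wt N M b.
  by apply: sumr_ge0 => n _; rewrite mulr_ge0 ?powR_ge0.
have bs0 n k : 0 <= majorant_step T (fun n => cabs (g n)) N M b n k.
  rewrite /majorant_step; case: ifP => // _.
  have tm u : 0 <= 2 * damp T u * conv b N M n u.
    by rewrite !mulr_ge0 ?damp_ge0 // conv_ge0.
  by rewrite addr_ge0 // mulr_ge0 // addr_ge0 ?cabs_ge0 // sumr_ge0.
have Sta' : St a'.
  exists (freq_bound N M), (majorant_step T (fun n => cabs (g n)) N M b); split; [exact: at_a' | exact: bs0 | | ].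
    by move=> n k nN; rewrite /majorant_step (negbTE nN).
  apply: le_trans (Hstep N M T wt (fun n => cabs (g n)) b T01 (fun n => cabs_ge0 _) wt0 wtM b0 bN) _.
  apply: le_trans (_ : C1 * G + C2 * T `^ (X * p) * K ^+ 3 <= _).
    apply: lerD; first by rewrite ler_pM2l.
    rewrite ler_wpM2l ?mulr_ge0 ?powR_ge0 ?(ltW C20) //.
    by apply: lerXn2r; rewrite ?nnegrE // ltW.
  apply: le_trans (lerD (lexx _) Tsmall) _.
  by rewrite KE lerDl addr_ge0 ?mulr_ge0 // ltW.
exists a'; split => //.
  move=> t ht; have /andP[t0 tT] := ht.
  pose P i := energy r s b M i `^ r^-1.
  have P0 i : 0 <= P i := powR_ge0 _ _.
  have PN i : i \notin ints N -> P i = 0.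
    move=> iN; rewrite /P /energy big1 ?powR0 ?gt_eqF // => k _.
    by rewrite bN // powR0 ?mulr0 // gt_eqF.
  pose S n := \sum_(y <- pairs N | adm n y) jap (phase n y) `^ (- (1 - r^-1)) *
      (P y.1 * P (y.1 + y.2 - n) * P y.2).
  have S0 n : 0 <= S n by apply: sumr_ge0 => i _; rewrite !mulr_ge0 ?powR_ge0.
  have c60 : 0 <= 6 * t `^ r^-1 * Cb by rewrite !mulr_ge0 ?powR_ge0 // ltW.
  have r01 : 0 < r^-1 < 1 by rewrite ri0 ri1.
  have pt n : n \in ints N -> cabs (a' n t - g n) <= 6 * t `^ r^-1 * Cb * S n.
    move=> nN; apply: le_trans (ba' n t nN ht) _.
    apply: le_trans (ler_sum _ (fun k _ => duhamel_gain_le k T01 ht r01 (conv_ge0 N M n k b0))) _.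
    rewrite -mulr_sumr -[leRHS]mulrA; apply: ler_wpM2l; first by rewrite mulr_ge0 ?powR_ge0.
    exact: HCb.
  apply: le_trans (_ : (6 * t `^ r^-1 * Cb) `^ q * \sum_(n <- ints N) S n `^ q <= _).
    rewrite mulr_sumr big_seq [leRHS]big_seq; apply: ler_sum => n nN.
    rewrite -(powRM _ c60 (S0 n)); apply: ge0_ler_powR; [exact: ltW | | | exact: pt].
      by rewrite nnegrE cabs_ge0.
    by rewrite nnegrE mulr_ge0.
  have SCk : \sum_(n <- ints N) S n `^ q <= Ck.
    apply: HCk => //; apply: le_trans bK; apply: ler_sum => n _.
    rewrite /P -powRrM -/p [r^-1 * p]mulrC -[leLHS]mul1r ler_wpM2r ?powR_ge0 //.
    by rewrite -[leLHS](powRr0 (wt n)); apply: ler_powR => //; exact: ltW.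
  apply: le_trans (ler_wpM2l (powR_ge0 _ _) SCk) _.
  have -> : Ck = (Ck `^ q^-1) `^ q by rewrite -powRrM mulVf ?gt_eqF // powRr1 // ltW.
  rewrite -(powRM _ c60 (powR_ge0 _ _)).
  have -> : 6 * t `^ r^-1 * Cb * Ck `^ q^-1 = Cq * t `^ r^-1.
    by rewrite CqE; move: (t `^ r^-1) (Ck `^ q^-1) => u v; clear; ring.
  apply: ge0_ler_powR; [exact: ltW | | | ].
  - by rewrite nnegrE mulr_ge0 ?powR_ge0 // ltW.
  - by rewrite nnegrE mulr_ge0 ?powR_ge0 // ltW.
  by apply: ler_wpM2r; [exact: powR_ge0 | rewrite lerDl ltW].
move=> t ht; have /andP[t0 tT] := ht.
pose Am := 2 * L1 * 2^-1 ^+ m + D.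
(* Q solves 2 * L * Q = L * Am + D: the integral of expR (2 * L * u) gains 1 / (2 * L). *)
pose Q := (Am + D / L) / 2.
have hm : 0 <= (2^-1 : R) ^+ m by rewrite exprn_ge0.
have Am0 : 0 <= Am by rewrite addr_ge0 // mulr_ge0 // mulr_ge0 // ltW.
have DL : D / L <= D by rewrite ler_pdivrMr // ler_peMr.
have DL0 : 0 <= D / L by rewrite divr_ge0 // ltW.
have AmQ : Q <= 2 * L1 * 2^-1 ^+ m.+1 + D.
  by rewrite /Q /Am exprS; move: DL; clear; lra.
pose F n u := if n \in ints N then x n u - a' n u else 0.
pose dF n u := if n \in ints N then w * (nonlin N x n u - nonlin N a n u) + err n u else 0.
have := @sum_cabs_le R int (ints N) F dF (fun u => Q * expR (2 * L * u))
   (fun u => 2 * L * Q * expR (2 * L * u)) t t0 _ _ _.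
have -> : \sum_(n <- ints N) cabs (F n t - F n 0) = \sum_(n <- ints N) cabs (x n t - a' n t).
  rewrite big_seq [RHS]big_seq; apply: eq_bigr => n nN; rewrite /F nN x0 // a'0 // subrr subr0 //.
move=> H; apply: le_trans (H _ _ _) _.
- move=> n u /andP[u0 ut]; rewrite /F /dF; case: ifPn => nN; last exact: has_cderiv_cst.
  have hu : 0 <= u <= T by rewrite u0 (le_trans ut).
  by apply: has_cderiv_ext (has_cderivB (dx n u nN hu) (da' n u nN hu)) => [//|]; ring.
- move=> u _.
  have dl : is_derive u 1 (fun v : R => 2 * L * v) (2 * L).
    by apply: is_derive_ext (is_deriveZ (2 * L) (is_derive_id u 1)) => [//|]; rewrite /GRing.scale /= mulr1.
  apply: is_derive_ext (is_deriveZ Q (is_derive1_comp (is_derive_expR (2 * L * u)) dl)) => [//|].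
  by rewrite /GRing.scale /=; ring.
- move=> u /andP[u0 ut]; have hu : 0 <= u <= T by rewrite u0 (le_trans ut).
  apply: le_trans (_ : \sum_(n <- ints N) (cabs (nonlin N x n u - nonlin N a n u) + cabs (err n u)) <= _).
    rewrite big_seq [leRHS]big_seq; apply: ler_sum => n nN; rewrite /dF nN.
    by apply: le_trans (cabsD _ _) _; rewrite lerD2r cabsM ler_piMl ?cabs_ge0.
  rewrite big_split /=.
  have lip : \sum_(n <- ints N) cabs (nonlin N x n u - nonlin N a n u) <= L * (Am * expR (2 * L * u)).
    apply: le_trans (@nonlin_lipschitz R N x a L1 u _ _ _ _) _.
    - by move=> n nN; exact: xN.
    - by move=> n nN; apply: St_vanish.
    - by apply: le_trans (xB u hu) _.
    - exact: St_l1.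
    by rewrite -/L ler_pM2l // ha2.
  apply: le_trans (lerD lip (errD u hu)) _.
  have e1 := ex1 u u0.
  have -> : 2 * L * Q * expR (2 * L * u) = L * (Am * expR (2 * L * u)) + D * expR (2 * L * u).
    rewrite /Q; field; by rewrite gt_eqF.
  by rewrite lerD2l ler_peMr.
apply: le_trans (_ : Q * expR (2 * L * t) <= _).
  rewrite lerBlDr lerDl mulr_ge0 ?expR_ge0 // /Q divr_ge0 // addr_ge0 //.
by rewrite ler_wpM2r ?expR_ge0.
Qed.

End APriori.

(** * Integration over the torus *)

Local Open Scope classical_set_scope.
Local Open Scope ring_scope.
Local Open Scope complex_scope.

Section TorusIntegral.
Variable R : realType.
Implicit Types (f g : R -> R).
Local Notation mu := (@lebesgue_measure R).
Local Notation I := (`[(0 : R), 2 * pi]%classic : set R).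

Lemma twopi_gt0 : 0 < 2 * pi :> R.
Proof. by rewrite mulr_gt0 ?pi_gt0. Qed.

(** A class of functions stable under the products and sums that occur, on which
    the integral is linear. *)
Definition tame f : Prop :=
  measurable_fun I f /\ exists M : R, forall x, 0 <= x <= 2 * pi -> `|f x| <= M.

Lemma tame_integrable f : tame f -> mu.-integrable I (EFin \o f).
Proof.
move=> [mf [M bM]]; apply: measurable_bounded_integrable => //.
- by apply: compact_finite_measure; exact: segment_compact.
- exists M; split; first exact: num_real.
  move=> y My x /=; rewrite in_itv /= => hx.
  by apply: le_trans (bM x hx) _; exact: ltW.
Qed.

Lemma tame_continuous f : continuous f -> tame f.
Proof.
move=> cf; split.
  by apply: measurable_funTS; exact: continuous_measurable_fun.
have c1 : {within `[0, 2 * pi], continuous (fun x => `|f x|)}.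
  apply: continuous_subspaceT => x; apply: continuous_comp; first exact: cf.
  exact: norm_continuous.
have [c _ hc] := EVT_max (ltW twopi_gt0) c1.
by exists `|f c| => x hx; apply: hc; rewrite in_itv.
Qed.

Lemma tame_cst (c : R) : tame (fun=> c).
Proof. by apply: tame_continuous => x; exact: cvg_cst. Qed.

Lemma tameD f g : tame f -> tame g -> tame (fun x => f x + g x).
Proof.
move=> [mf [M hM]] [mg [K hK]]; split; first exact: measurable_funD.
by exists (M + K) => x hx; apply: le_trans (ler_normD _ _) _; rewrite lerD ?hM ?hK.
Qed.

Lemma tameM f g : tame f -> tame g -> tame (fun x => f x * g x).
Proof.
move=> [mf [M hM]] [mg [K hK]]; split; first exact: measurable_funM.
by exists (M * K) => x hx; rewrite normrM; apply: ler_pM; rewrite ?hM ?hK.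
Qed.

Lemma tameN f : tame f -> tame (fun x => - f x).
Proof.
move=> tf; have := tameM (tame_cst (-1)) tf.
by under eq_fun do rewrite mulN1r.
Qed.

Lemma torus_intD f g : tame f -> tame g ->
  torus_int (fun x => f x + g x) = torus_int f + torus_int g.
Proof. by move=> tf tg; apply: RintegralD => //; exact: tame_integrable. Qed.

Lemma torus_intZ (c : R) f : tame f -> torus_int (fun x => c * f x) = c * torus_int f.
Proof. by move=> tf; apply: RintegralZl => //; exact: tame_integrable. Qed.

Lemma torus_intB f g : tame f -> tame g ->
  torus_int (fun x => f x - g x) = torus_int f - torus_int g.
Proof. by move=> tf tg; apply: RintegralB => //; exact: tame_integrable. Qed.

Lemma torus_int_cst (c : R) : torus_int (fun=> c) = c * (2 * pi).
Proof.
rewrite /torus_int Rintegral_cst //; congr (_ * _).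
have := @lebesgue_measure_itv R `[0, 2 * pi]; rewrite /= lte_fin twopi_gt0 -EFinB subr0 => h.
by rewrite h.
Qed.

Lemma eq_torus_int f g : (forall x, 0 <= x <= 2 * pi -> f x = g x) -> torus_int f = torus_int g.
Proof. by move=> fg; apply: eq_Rintegral => x; rewrite inE /= in_itv /= => /fg. Qed.

Lemma torus_int_ge0 f : (forall x, 0 <= x <= 2 * pi -> 0 <= f x) -> 0 <= torus_int f.
Proof. by move=> f0; apply: Rintegral_ge0 => x /=; rewrite in_itv /= => /f0. Qed.

Lemma ler_torus_int f g : tame f -> tame g -> (forall x, 0 <= x <= 2 * pi -> f x <= g x) ->
  torus_int f <= torus_int g.
Proof.
move=> tf tg fg; rewrite -subr_ge0.
have -> : torus_int g - torus_int f = torus_int (fun x => g x + (- 1) * f x).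
  by rewrite torus_intD ?torus_intZ ?mulN1r //; apply: tameM => //; exact: tame_cst.
by apply: torus_int_ge0 => x hx; rewrite mulN1r subr_ge0 fg.
Qed.

Lemma norm_torus_int_le f (M : R) : tame f -> (forall x, 0 <= x <= 2 * pi -> `|f x| <= M) ->
  `|torus_int f| <= M * (2 * pi).
Proof.
move=> tf bM; rewrite -torus_int_cst ler_norml; apply/andP; split.
  rewrite -mulN1r -torus_intZ; last exact: tame_cst.
  apply: ler_torus_int => //; first by apply: tameM; exact: tame_cst.
  by move=> x /bM; rewrite mulN1r ler_norml => /andP[].
apply: ler_torus_int => //; first exact: tame_cst.
by move=> x /bM; rewrite ler_norml => /andP[].
Qed.

Lemma torus_int_derive (F f : R -> R) : (forall x : R, is_derive x 1 F (f x)) -> continuous f ->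
  torus_int f = F (2 * pi) - F 0.
Proof.
move=> dF cf; rewrite /torus_int /Rintegral.
have cF x : {for x, continuous F} := is_derive_continuous (dF x).
rewrite (@continuous_FTC2 R f F 0 (2 * pi) twopi_gt0) ?EFinN //.
- by apply: continuous_subspaceT.
- split; first by move=> x _; case: (dF x).
    by apply: cvg_at_right_filter; exact: cF.
  by apply: cvg_at_left_filter; exact: cF.
- by move=> x _; rewrite derive1E; case: (dF x).
Qed.

End TorusIntegral.

Section ComplexTorusIntegral.
Variable R : realType.
Implicit Types (f g : R -> R[i]).

Definition ctame f : Prop := tame (re_of f) /\ tame (im_of f).

Lemma ctame_cst (c : R[i]) : ctame (fun=> c).
Proof. by split; exact: tame_cst. Qed.

Lemma ctame_ext f g : (forall x, f x = g x) -> ctame f -> ctame g.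
Proof. by move=> /funext ->. Qed.

Lemma tame_ext (f g : R -> R) : (forall x, f x = g x) -> tame f -> tame g.
Proof. by move=> /funext ->. Qed.

Lemma ctameD f g : ctame f -> ctame g -> ctame (fun x => f x + g x).
Proof.
move=> [f1 f2] [g1 g2]; split.
  by apply: tame_ext (tameD f1 g1) => x; rewrite /re_of ReD.
by apply: tame_ext (tameD f2 g2) => x; rewrite /im_of ImD.
Qed.

Lemma ctameM f g : ctame f -> ctame g -> ctame (fun x => f x * g x).
Proof.
move=> [f1 f2] [g1 g2]; split.
  by apply: tame_ext (tameD (tameM f1 g1) (tameN (tameM f2 g2))) => x; rewrite /re_of ReM.
by apply: tame_ext (tameD (tameM f1 g2) (tameM f2 g1)) => x; rewrite /im_of ImM.
Qed.

Lemma ctameJ f : ctame f -> ctame (fun x => conjc (f x)).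
Proof.
move=> [f1 f2]; split; first by apply: tame_ext f1 => x; rewrite /re_of ReJ.
by apply: tame_ext (tameN f2) => x; rewrite /im_of ImJ.
Qed.

Lemma ctame_sum (T : Type) (s : seq T) (P : pred T) (F : T -> R -> R[i]) :
  (forall i, ctame (F i)) -> ctame (fun x => \sum_(i <- s | P i) F i x).
Proof.
move=> tF; elim: s => [|i s IH].
  by apply: ctame_ext (ctame_cst 0) => x; rewrite big_nil.
case Pi : (P i); last by apply: ctame_ext IH => x; rewrite big_cons Pi.
by apply: ctame_ext (ctameD (tF i) IH) => x; rewrite big_cons Pi.
Qed.

Lemma ctame_derivable f (df : R -> R[i]) : (forall x, has_cderiv f x (df x)) -> ctame f.
Proof.
move=> hf; split; apply: tame_continuous => x.
  exact: is_derive_continuous (hf x).1.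
exact: is_derive_continuous (hf x).2.
Qed.

Lemma ctame_cexpi (a : R) : ctame (fun x => cexpi (a * x)).
Proof. exact: ctame_derivable (has_cderiv_cexpi a). Qed.

Lemma torus_cintD f g : ctame f -> ctame g ->
  torus_cint (fun x => f x + g x) = torus_cint f + torus_cint g.
Proof.
move=> [f1 f2] [g1 g2]; apply: complex_ext; rewrite ?ReD ?ImD /torus_cint /=.
  by rewrite -torus_intD //; congr torus_int; apply/funext => x; rewrite /re_of ReD.
by rewrite -torus_intD //; congr torus_int; apply/funext => x; rewrite /im_of ImD.
Qed.

Lemma torus_cintZ (c : R[i]) f : ctame f -> torus_cint (fun x => c * f x) = c * torus_cint f.
Proof.
move=> [f1 f2]; apply: complex_ext; rewrite ?ReM ?ImM /torus_cint /=.
  rewrite -(torus_intZ _ f1) -(torus_intZ _ f2) -mulN1r -torus_intZ; last first.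
    by apply: tameM => //; exact: tame_cst.
  rewrite -torus_intD; last 2 first.
  - by apply: tameM => //; exact: tame_cst.
  - by apply: tameM (tame_cst _) _; apply: tameM => //; exact: tame_cst.
  by congr torus_int; apply/funext => x; rewrite /re_of ReM mulN1r.
rewrite -(torus_intZ _ f1) -(torus_intZ _ f2) -torus_intD; last 2 first.
- by apply: tameM => //; exact: tame_cst.
- by apply: tameM => //; exact: tame_cst.
by congr torus_int; apply/funext => x; rewrite /im_of ImM.
Qed.

Lemma torus_cint_sum (T : Type) (s : seq T) (P : pred T) (F : T -> R -> R[i]) :
  (forall i, ctame (F i)) ->
  torus_cint (fun x => \sum_(i <- s | P i) F i x) = \sum_(i <- s | P i) torus_cint (F i).
Proof.
move=> tF; elim: s => [|i s IH].
  rewrite big_nil (_ : (fun x => _) = (fun=> 0 * 0)); last by apply/funext => x; rewrite big_nil mul0r.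
  by rewrite torus_cintZ ?mul0r //; exact: ctame_cst.
rewrite big_cons; case Pi : (P i).
  rewrite -IH -torus_cintD //; last exact: ctame_sum.
  by congr torus_cint; apply/funext => x; rewrite big_cons Pi.
by rewrite -IH; congr torus_cint; apply/funext => x; rewrite big_cons Pi.
Qed.

Lemma eq_torus_cint f g : (forall x, 0 <= x <= 2 * pi -> f x = g x) -> torus_cint f = torus_cint g.
Proof.
by move=> fg; apply: complex_ext; rewrite /torus_cint /=; apply: eq_torus_int => x hx; rewrite /re_of /im_of fg.
Qed.

Lemma torus_cint_cst (c : R[i]) : torus_cint (fun=> c) = c * (2 * pi)%:C.
Proof.
apply: complex_ext; rewrite ?ReM ?ImM /torus_cint /re_of /im_of /= torus_int_cst ?mulr0 ?subr0 //.
by rewrite add0r.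
Qed.

Lemma torus_cintJ f : ctame f -> torus_cint (fun x => conjc (f x)) = conjc (torus_cint f).
Proof.
move=> [f1 f2]; apply: complex_ext; rewrite ?ReJ ?ImJ /torus_cint /=.
  by congr torus_int; apply/funext => x; rewrite /re_of ReJ.
rewrite -mulN1r -torus_intZ //.
by congr torus_int; apply/funext => x; rewrite /im_of ImJ mulN1r.
Qed.

Lemma cabs_torus_cint_le f (M : R) : ctame f ->
  (forall x, 0 <= x <= 2 * pi -> cabs (f x) <= M) -> cabs (torus_cint f) <= 2 * M * (2 * pi).
Proof.
move=> [f1 f2] bM; apply: le_trans (cabs_le_Re_Im _) _; rewrite /torus_cint /=.
rewrite [2 * M]mulrDl mul1r mulrDl; apply: lerD; apply: norm_torus_int_le => // x /bM.
  by apply: le_trans; exact: normRe_le_cabs.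
by apply: le_trans; exact: normIm_le_cabs.
Qed.

Lemma torus_cint_deriv f (df : R -> R[i]) (ddf : R -> R[i]) : (forall x, has_cderiv f x (df x)) ->
  (forall x, has_cderiv df x (ddf x)) -> torus_cint df = f (2 * pi) - f 0.
Proof.
move=> hf hdf; apply: complex_ext; rewrite ?ReD ?ImD ?ReN ?ImN /torus_cint /=.
  apply: (@torus_int_derive R (re_of f)); first by move=> x; case: (hf x).
  by move=> x; exact: is_derive_continuous (hdf x).1.
apply: (@torus_int_derive R (im_of f)); first by move=> x; case: (hf x).
by move=> x; exact: is_derive_continuous (hdf x).2.
Qed.

End ComplexTorusIntegral.

(** * Fourier coefficients *)

Section Fourier.
Variable R : realType.
Implicit Types (f g : R -> R[i]) (n k : int).
Local Notation tpi := (2 * pi : R).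

Lemma conjM (z w : R[i]) : conjc (z * w) = conjc z * conjc w.
Proof. exact: rmorphM. Qed.

Lemma conjB (z w : R[i]) : conjc (z - w) = conjc z - conjc w.
Proof. exact: rmorphB. Qed.

Definition chr n (x : R) : R[i] := cexpi (n%:~R * x).

Lemma chrD n k x : chr (n + k) x = chr n x * chr k x.
Proof. by rewrite /chr -cexpiD intrD mulrDl. Qed.

Lemma chrJ n x : conjc (chr n x) = chr (- n) x.
Proof. by rewrite /chr conj_cexpi rmorphN /= mulNr. Qed.

Lemma chr0 x : chr 0 x = 1.
Proof. by rewrite /chr mul0r cexpi0. Qed.

Lemma cabs_chr n x : cabs (chr n x) = 1.
Proof. exact: cabs_cexpi. Qed.

Lemma cexpi_2pi : cexpi tpi = 1.
Proof. by rewrite mulr_natl /cexpi cos2pi sin2pi. Qed.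

Lemma chr_2pi n : chr n tpi = 1.
Proof.
have nat_case (m : nat) : cexpi (m%:R * tpi) = 1.
  elim: m => [|m IH]; first by rewrite mul0r cexpi0.
  by rewrite -natr1 mulrDl mul1r cexpiD IH cexpi_2pi mulr1.
rewrite /chr; case: n => m; first exact: nat_case.
rewrite NegzE rmorphN /= mulNr -conj_cexpi.
by rewrite (nat_case m.+1) conjc1.
Qed.

Lemma has_cderiv_chr n x : has_cderiv (chr n) x ('i * (n%:~R)%:C * chr n x).
Proof. exact: has_cderiv_cexpi. Qed.

Lemma ctame_chr n : ctame (chr n).
Proof. exact: ctame_cexpi. Qed.

Definition coef f n : R[i] := fourier (distr_of_fun f) n.

Lemma coefE f n : coef f n = (tpi^-1)%:C * torus_cint (fun x => chr (- n) x * f x).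
Proof.
rewrite /coef /fourier /distr_of_fun; congr (_ * torus_cint _); apply/funext => x.
by rewrite /chr rmorphN /= mulNr.
Qed.

Lemma tpiC_neq0 : (tpi^-1)%:C != 0.
Proof. by rewrite -(rmorph0 (real_complex R)) (inj_eq (@complexI _)) invr_eq0 gt_eqF // twopi_gt0. Qed.

Lemma coefD f g n : ctame f -> ctame g -> coef (fun x => f x + g x) n = coef f n + coef g n.
Proof.
move=> tf tg; rewrite !coefE -mulrDr -torus_cintD; try by apply: ctameM => //; exact: ctame_chr.
by congr (_ * torus_cint _); apply/funext => x; rewrite mulrDr.
Qed.

Lemma coefZ (c : R[i]) f n : ctame f -> coef (fun x => c * f x) n = c * coef f n.
Proof.
move=> tf; rewrite !coefE mulrCA -(torus_cintZ c); last by apply: ctameM => //; exact: ctame_chr.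
by congr (_ * torus_cint _); apply/funext => x; rewrite mulrCA.
Qed.

Lemma coef_sum (T : Type) (s : seq T) (P : pred T) (F : T -> R -> R[i]) n :
  (forall i, ctame (F i)) ->
  coef (fun x => \sum_(i <- s | P i) F i x) n = \sum_(i <- s | P i) coef (F i) n.
Proof.
move=> tF; rewrite coefE.
rewrite (_ : (fun x => _) = fun x => \sum_(i <- s | P i) (chr (- n) x * F i x)); last first.
  by apply/funext => x; rewrite mulr_sumr.
rewrite torus_cint_sum; last by move=> i; apply: ctameM => //; exact: ctame_chr.
by rewrite mulr_sumr; apply: eq_bigr => i _; rewrite coefE.
Qed.

Lemma eq_coef f g n : (forall x, 0 <= x <= tpi -> f x = g x) -> coef f n = coef g n.
Proof. by move=> fg; rewrite !coefE; congr (_ * _); apply: eq_torus_cint => x /fg ->. Qed.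

Lemma torus_cint_chr k : torus_cint (chr k) = if k == 0 then tpi%:C else 0.
Proof.
case: (eqVneq k 0) => [->|k0].
  rewrite (_ : chr 0 = fun=> 1); last by apply/funext => x; rewrite chr0.
  by rewrite torus_cint_cst mul1r.
pose c : R[i] := 'i * (k%:~R)%:C.
have c0 : c != 0.
  apply/eqP => h; have := congr1 (@cabs R) h; rewrite cabsM cabs_i mul1r cabs_real cabs0 => /eqP.
  by rewrite normr_eq0 intr_eq0 (negbTE k0).
have d2 x : has_cderiv (fun y => c * chr k y) x (c * (c * chr k x)).
  by apply: has_cderivZ; exact: has_cderiv_chr.
have := torus_cint_deriv (has_cderiv_chr k) d2.
rewrite chr_2pi /chr mulr0 cexpi0 subrr -/(chr k) -/c torus_cintZ; last exact: ctame_chr.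
by move/eqP; rewrite mulf_eq0 (negbTE c0) /= => /eqP.
Qed.

Lemma tpiVC : (tpi^-1)%:C * tpi%:C = 1 :> R[i].
Proof. by rewrite -rmorphM /= mulVf // gt_eqF // twopi_gt0. Qed.

Lemma coef_chr k n : coef (chr k) n = (k == n)%:R.
Proof.
rewrite coefE (_ : (fun x => _) = chr (k - n)); last first.
  by apply/funext => x; rewrite -chrD addrC.
rewrite torus_cint_chr subr_eq0; case: (k == n); last by rewrite mulr0.
exact: tpiVC.
Qed.

Lemma coef_cst (c : R[i]) n : coef (fun=> c) n = c * (0 == n)%:R.
Proof.
rewrite -coef_chr -coefZ; last exact: ctame_chr.
by rewrite (_ : (fun x => c * chr 0 x) = fun=> c) //; apply/funext => x; rewrite chr0 mulr1.
Qed.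

Lemma cabs_coef_le f (M : R) n : ctame f -> (forall x, 0 <= x <= tpi -> cabs (f x) <= M) ->
  cabs (coef f n) <= 2 * M.
Proof.
move=> tf bM; rewrite coefE cabsM cabs_real ger0_norm; last by rewrite invr_ge0 ltW // twopi_gt0.
rewrite mulrC ler_pdivrMr ?twopi_gt0 //.
apply: cabs_torus_cint_le; first by apply: ctameM => //; exact: ctame_chr.
by move=> x /bM; rewrite cabsM cabs_chr mul1r.
Qed.

Lemma coef_deriv f (df ddf : R -> R[i]) n : (forall x, f (x + tpi) = f x) ->
  (forall x, has_cderiv f x (df x)) -> (forall x, has_cderiv df x (ddf x)) ->
  coef df n = 'i * (n%:~R)%:C * coef f n.
Proof.
move=> per hf hdf.
pose F x := chr (- n) x * f x.
pose c : R[i] := 'i * ((- n)%:~R)%:C.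
pose dF x := c * chr (- n) x * f x + chr (- n) x * df x.
have hF x : has_cderiv F x (dF x) by apply: has_cderivM (hf x); exact: has_cderiv_chr.
have hdF x : has_cderiv dF x
   (c * (c * chr (- n) x) * f x + c * chr (- n) x * df x + (c * chr (- n) x * df x + chr (- n) x * ddf x)).
  apply: has_cderivD; apply: has_cderivM => //; last exact: has_cderiv_chr.
  by apply: has_cderivZ; exact: has_cderiv_chr.
have tf : ctame f := ctame_derivable hf.
have tdf : ctame df := ctame_derivable hdf.
have t1 : ctame (fun x => chr (- n) x * f x) by apply: ctameM => //; exact: ctame_chr.
have t2 : ctame (fun x => chr (- n) x * df x) by apply: ctameM => //; exact: ctame_chr.
have := torus_cint_deriv hF hdF.
have -> : F tpi - F 0 = 0.
  have := per 0; rewrite add0r /F => ->.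
  by rewrite chr_2pi /chr mulr0 cexpi0 subrr.
have -> : torus_cint dF = c * torus_cint (fun x => chr (- n) x * f x) + torus_cint (fun x => chr (- n) x * df x).
  rewrite -torus_cintZ // -torus_cintD //.
    by congr torus_cint; apply/funext => x; rewrite /dF mulrA.
  by apply: ctameM => //; exact: ctame_cst.
move=> /eqP; rewrite addrC addr_eq0 => /eqP e.
rewrite !coefE e /c rmorphN /= rmorphN /= ; ring.
Qed.

Lemma sum_ints_single k (F : int -> R[i]) N : k \in ints N ->
  \sum_(n <- ints N) (n == k)%:R * F n = F k.
Proof.
move=> kN; rewrite (big_rem _ kN) eqxx mul1r big_seq_cond big1 /=; first exact: addr0.
move=> n; rewrite mem_rem_uniq ?ints_uniq // inE andbT => /andP[/negbTE -> _].
by rewrite mul0r.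
Qed.

(** The remainder [h] is orthogonal to the characters of [ints N], and the integral
    of its squared modulus is nonnegative. *)
Lemma bessel g (M : R) N : ctame g -> (forall x, 0 <= x <= tpi -> cabs (g x) <= M) ->
  \sum_(n <- ints N) cabs (coef g n) ^+ 2 <= M ^+ 2.
Proof.
move=> tg bM.
pose h x := g x + (-1) * \sum_(n <- ints N) coef g n * chr n x.
have tc n : ctame (fun x => coef g n * chr n x) by apply: ctameM; [exact: ctame_cst | exact: ctame_chr].
have ts : ctame (fun x => \sum_(n <- ints N) coef g n * chr n x) by exact: ctame_sum.
have th : ctame h by apply: ctameD => //; apply: ctameM => //; exact: ctame_cst.
have ch k : k \in ints N -> coef h k = 0.
  move=> kN; rewrite coefD //; last by apply: ctameM => //; exact: ctame_cst.
  rewrite coefZ // coef_sum //.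
  rewrite (eq_bigr (fun n => (n == k)%:R * coef g n)); last first.
    by move=> n _; rewrite (coefZ _ _ (ctame_chr n)) coef_chr mulrC.
  by rewrite sum_ints_single // mulN1r subrr.
have hch k : k \in ints N -> torus_cint (fun x => h x * conjc (chr k x)) = 0.
  move=> /ch; rewrite coefE => /eqP; rewrite mulf_eq0 (negbTE tpiC_neq0) /= => /eqP e.
  rewrite -[RHS]e (_ : (fun x => h x * conjc (chr k x)) = fun x => chr (- k) x * h x) //.
  by apply/funext => x; rewrite chrJ mulrC.
have tJ := ctameJ.
have hh : torus_cint (fun x => h x * conjc (h x)) = torus_cint (fun x => h x * conjc (g x)).
  rewrite (_ : (fun x => h x * conjc (h x)) = fun x => h x * conjc (g x) +
     (-1) * \sum_(n <- ints N) conjc (coef g n) * (h x * conjc (chr n x))); last first.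
    apply/funext => x; rewrite {2}/h !mulN1r conjB conj_sum mulrBr; congr (_ - _).
    rewrite mulr_sumr; apply: eq_bigr => n _.
    by rewrite conjM mulrCA.
  have tt n : ctame (fun x => conjc (coef g n) * (h x * conjc (chr n x))).
    apply: ctameM; first exact: ctame_cst.
    by apply: ctameM => //; apply: ctameJ; exact: ctame_chr.
  rewrite torus_cintD; last 2 first.
  - by apply: ctameM => //; exact: ctameJ.
  - by apply: ctameM; [exact: ctame_cst | exact: ctame_sum].
  rewrite torus_cintZ; last exact: ctame_sum.
  rewrite torus_cint_sum // big_seq big1 ?mulr0 ?addr0 // => n nN.
  rewrite torus_cintZ ?hch ?mulr0 //.
  by apply: ctameM => //; apply: ctameJ; exact: ctame_chr.
have hg : torus_cint (fun x => h x * conjc (g x)) = torus_cint (fun x => g x * conjc (g x)) -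
    tpi%:C * \sum_(n <- ints N) coef g n * conjc (coef g n).
  rewrite (_ : (fun x => h x * conjc (g x)) = fun x => g x * conjc (g x) +
     (-1) * \sum_(n <- ints N) coef g n * (conjc (chr (- n) x * g x))); last first.
    apply/funext => x; rewrite {1}/h mulrDl; congr (_ + _).
    rewrite -mulrA mulr_suml; congr (_ * _); apply: eq_bigr => n _.
    by rewrite conjM chrJ opprK mulrA.
  have tt n : ctame (fun x => coef g n * conjc (chr (- n) x * g x)).
    apply: ctameM; first exact: ctame_cst.
    by apply: ctameJ; apply: ctameM => //; exact: ctame_chr.
  rewrite torus_cintD; last 2 first.
  - by apply: ctameM => //; exact: ctameJ.
  - by apply: ctameM; [exact: ctame_cst | exact: ctame_sum].
  rewrite torus_cintZ; last exact: ctame_sum.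
  rewrite torus_cint_sum // mulN1r; congr (_ - _).
  rewrite mulr_sumr; apply: eq_bigr => n _.
  have tcg : ctame (fun x => chr (- n) x * g x) by apply: ctameM => //; exact: ctame_chr.
  rewrite torus_cintZ ?torus_cintJ //; last exact: ctameJ.
  rewrite mulrCA; congr (_ * _); rewrite coefE conjM conjc_real mulrA.
  by rewrite -rmorphM /= divff ?mul1r // gt_eqF // twopi_gt0.
have re0 : 0 <= complex.Re (torus_cint (fun x => h x * conjc (h x))).
  rewrite /torus_cint /=; apply: torus_int_ge0 => x _; rewrite /re_of -cabs_sqr /=.
  exact: sqr_ge0.
have reg : complex.Re (torus_cint (fun x => g x * conjc (g x))) <= M ^+ 2 * tpi.
  rewrite /torus_cint /= -torus_int_cst; apply: ler_torus_int.
  - by have [] : ctame (fun x => g x * conjc (g x)) by apply: ctameM => //; exact: ctameJ.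
  - exact: tame_cst.
  move=> x hx; rewrite /re_of -cabs_sqr /=.
  by apply: lerXn2r; rewrite ?nnegrE ?cabs_ge0 ?bM // (le_trans (cabs_ge0 (g x))) ?bM.
rewrite hh hg ReD ReN in re0.
have sumE : complex.Re (tpi%:C * \sum_(n <- ints N) coef g n * conjc (coef g n)) =
    tpi * \sum_(n <- ints N) cabs (coef g n) ^+ 2.
  under eq_bigr do rewrite -cabs_sqr.
  by rewrite ReM Re_sum /= mul0r subr0.
rewrite sumE in re0.
have t0 : 0 < tpi := twopi_gt0 R.
rewrite -(ler_pM2l t0); move: re0 reg.
set a := complex.Re _; set S := \sum_(n <- _) _; clearbody a S; clear; lra.
Qed.

(** Otherwise infinitely many coefficients would be bounded below, against
    Bessel's inequality. *)
Lemma coef_small g (M e : R) (n0 : nat) : ctame g -> (forall x, 0 <= x <= tpi -> cabs (g x) <= M) ->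
  0 < e -> exists n : nat, (n0 <= n)%N /\
    cabs (coef g (- (Posz n.+1))) + cabs (coef g (Posz n)) <= e.
Proof.
move=> tg bM e0; apply: contrapT => no.
have big (n : nat) : (n0 <= n)%N -> e ^+ 2 / 2 <= cabs (coef g (- (Posz n.+1))) ^+ 2 + cabs (coef g (Posz n)) ^+ 2.
  move=> nn0; have : e < cabs (coef g (- (Posz n.+1))) + cabs (coef g (Posz n)).
    by rewrite ltNge; apply/negP => h; apply: no; exists n.
  set a := cabs _; set b := cabs _ => eab.
  have a0 : 0 <= a by exact: cabs_ge0.
  have b0 : 0 <= b by exact: cabs_ge0.
  have e2 : e ^+ 2 <= (a + b) ^+ 2.
    by apply: lerXn2r; rewrite ?nnegrE ?addr_ge0 ?(ltW e0) ?(ltW eab).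
  have := sqr_ge0 (a - b); move: e2; clearbody a b; clear; lra.
have many (K : nat) : (K%:R * (e ^+ 2 / 2) : R) <= M ^+ 2.
  pose l := [seq Posz i | i <- iota n0 K] ++ [seq - (Posz i.+1) | i <- iota n0 K].
  have ul : uniq l.
    rewrite cat_uniq !map_inj_uniq ?iota_uniq //=; try by move=> a b; lia.
    by rewrite andbT; apply/hasPn => x /mapP[a _ ->]; apply/negP => /mapP[b _]; lia.
  have [N lN] := ints_sub l.
  apply: le_trans (bessel N tg bM).
  apply: le_trans (sum_ge0_subset xpredT ul (ints_uniq N) lN _); last by move=> i; exact: sqr_ge0.
  rewrite /l big_cat /= !big_map -big_split /=.
  apply: le_trans (_ : \sum_(n <- iota n0 K) e ^+ 2 / 2 <= _).
    by rewrite big_const_seq count_predT size_iota iter_addr_0 mulr_natl.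
  rewrite big_seq [leRHS]big_seq; apply: ler_sum => n; rewrite mem_iota => /andP[nn _].
  by rewrite addrC big.
have e2 : 0 < e ^+ 2 / 2 by rewrite divr_gt0 // exprn_gt0.
have := many (Num.truncn (M ^+ 2 / (e ^+ 2 / 2))).+1.
rewrite leNgt => /negP; apply.
by rewrite -ltr_pdivrMr // truncnS_gt.
Qed.

End Fourier.

(** * Fourier inversion with a rate *)

Section Inversion.
Variable R : realType.
Implicit Types (f g : R -> R[i]).
Local Notation tpi := (2 * pi : R).
Local Notation jap := (bracket R).

Lemma sin_ge_quarter (z : R) : 0 <= z <= pi / 2 -> z / 4 <= sin z.
Proof.
move=> /andP[z0 zp]; have z2 : z <= 2 by have /andP[_] := pihalf_02 R; lra.
have pi0 := pi_gt0 R.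
have key : z * cos z <= sin z.
  have dG (s : R) : is_derive s 1 (fun y => sin y - y * cos y) (s * sin s).
    apply: is_derive_ext (is_deriveB (is_derive_sin s) (is_deriveM (is_derive_id s 1) (is_derive_cos s))) => [//|].
    by rewrite /GRing.scale /=; ring.
  have := @ge0_derive_le R (fun y => sin y - y * cos y) (fun s => s * sin s) z z0 (fun s _ => dG s) _.
  rewrite sin0 mul0r subr0; move=> H; rewrite -subr_ge0; apply: H => s /andP[s0 sz].
  by rewrite mulr_ge0 // sin_ge0_pi // s0 /=; lra.
have c0 : 0 <= cos z by apply: cos_ge0_pihalf; apply/andP; split; lra.
have s0 : 0 <= sin z by apply: sin_ge0_pi; rewrite z0 /=; lra.
case: (lerP (1 / 2) (cos z)) => h.
  apply: le_trans key; rewrite ler_wpM2l //; lra.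
have sq : 1 / 4 <= sin z ^+ 2 by rewrite sin2cos2; nra.
have : 1 / 2 <= sin z.
  rewrite leNgt; apply/negP => h2; nra.
lra.
Qed.

Lemma cabs_cexpiB (x y : R) : cabs (cexpi x - cexpi y) = 2 * `|sin ((x - y) / 2)|.
Proof.
have -> : cexpi x - cexpi y = cexpi ((x + y) / 2) * (0 +i* (2 * sin ((x - y) / 2))).
  have ex : x = (x + y) / 2 + (x - y) / 2 by field.
  have ey : y = (x + y) / 2 + (- ((x - y) / 2)) by field.
  rewrite [in LHS]ex [in X in _ - X]ey !cexpiD -mulrBr; congr (_ * _).
  by apply: complex_ext; rewrite /cexpi /= ?cosN ?sinN; ring.
rewrite cabsM cabs_cexpi mul1r /cabs /= expr0n add0r sqrtr_sqr normrM.
by rewrite ger0_norm.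
Qed.

(** The denominator vanishes at [x0] modulo a period only.  If [x] is closer to
    [x0 + 2 pi] than to [x0], the Lipschitz bound is applied there. *)
Lemma lipschitz_quotient f (L x x0 : R) : 0 <= L -> (forall x, f (x + tpi) = f x) ->
  (forall x y, 0 <= x <= 2 * tpi -> 0 <= y <= 2 * tpi -> cabs (f x - f y) <= L * `|x - y|) -> 0 <= x <= tpi -> 0 <= x0 <= tpi ->
  cabs (f x - f x0) <= 4 * L * cabs (cexpi x - cexpi x0).
Proof.
move=> L0 per lip.
wlog xx : x x0 / x0 <= x.
  move=> H hx hx0; case: (lerP x0 x) => [le|/ltW le]; first exact: H.
  by rewrite cabsC [cabs (cexpi _ - _)]cabsC; exact: H.
move=> /andP[x_0 x1] /andP[y0 y1].
rewrite cabs_cexpiB; set z := (x - x0) / 2.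
have pi0 := pi_gt0 R.
have z0 : 0 <= z by rewrite /z; lra.
have zp : z <= pi by rewrite /z; lra.
have xz : x - x0 = 2 * z by rewrite /z; field.
have s0 : 0 <= sin z by apply: sin_ge0_pi; rewrite z0.
rewrite (ger0_norm s0).
case: (lerP z (pi / 2)) => hz.
  have sz : z / 4 <= sin z by apply: sin_ge_quarter; rewrite z0.
  apply: le_trans (lip _ _ _ _) _; [by apply/andP; split; lra.. |].
  rewrite xz ger0_norm; last by lra.
  nra.
(* x is closer to x0 + 2 pi. *)
have sz : (pi - z) / 4 <= sin z.
  have -> : sin z = sin (pi - z) by rewrite sinB sinpi cospi; ring.
  by apply: sin_ge_quarter; apply/andP; split; lra.
rewrite -(per x0); apply: le_trans (lip _ _ _ _) _; [by apply/andP; split; lra.. |].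
have -> : x - (x0 + tpi) = - (2 * (pi - z)) by rewrite /z; field.
rewrite normrN ger0_norm; last by lra.
nra.
Qed.

(** Chernoff's device for pointwise convergence of Fourier series: the quotient by
    [cexpi x - cexpi x0] is bounded, so that [coef_small] applies to it. *)
Lemma chernoff_quotient f (L x0 : R) : 0 <= L -> ctame f -> (forall x, f (x + tpi) = f x) ->
  (forall x y, 0 <= x <= 2 * tpi -> 0 <= y <= 2 * tpi -> cabs (f x - f y) <= L * `|x - y|) -> 0 <= x0 <= tpi ->
  exists g (M : R), [/\ ctame g, forall x, 0 <= x <= tpi -> cabs (g x) <= M &
    forall x, 0 <= x <= tpi -> f x - f x0 = (cexpi x - cexpi x0) * g x].
Proof.
move=> L0 tf per lip hx0.
pose d x : R[i] := cexpi x - cexpi x0.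
(* The quotient by d is written with conjc d and the inverse of the squared modulus,
   a real power, which is measurable and vanishes together with d. *)
pose u x : R := complex.Re (d x) * complex.Re (d x) + complex.Im (d x) * complex.Im (d x).
have td : ctame d.
  have tce : ctame (@cexpi R).
    by apply: ctame_ext (ctame_cexpi 1) => x; rewrite mul1r.
  apply: ctame_ext (ctameD tce (ctame_cst (- cexpi x0))) => x; by [].
have tu : tame u by case: td => t1 t2; apply: tameD; apply: tameM.
pose g x := (f x - f x0) * conjc (d x) * ((u x) `^ (-1))%:C.
have uE x : (u x)%:C = d x * conjc (d x).
  by apply: complex_ext; rewrite ?ReM ?ImM ReJ ImJ /u /=; ring.
have u0 x : 0 <= u x by rewrite /u -!expr2 addr_ge0 ?sqr_ge0.
have eq x : 0 <= x <= tpi -> f x - f x0 = d x * g x.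
  move=> hx; rewrite /g.
  have -> : d x * ((f x - f x0) * conjc (d x) * (u x `^ (-1))%:C) =
     (f x - f x0) * (d x * conjc (d x)) * (u x `^ (-1))%:C by ring.
  rewrite -uE -mulrA -rmorphM /= powR_inv1 //.
  have [ux0|ux0] := eqVneq (u x) 0; last by rewrite divff // mulr1.
  have dx0 : d x = 0.
    apply: cabs_eq0; apply/eqP; rewrite -(@sqrf_eq0 R).
    have := cabs_sqr (d x); rewrite -uE => /(@complexI _) ->; exact/eqP.
  have := lipschitz_quotient L0 per lip hx hx0; rewrite -/(d x) dx0 cabs0 mulr0 => h.
  rewrite (@cabs_eq0 R (f x - f x0)) ?mul0r //; apply/eqP; rewrite eq_le h; exact: cabs_ge0.
have bg x : 0 <= x <= tpi -> cabs (g x) <= 4 * L.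
  move=> hx; have [dx0|dx0] := eqVneq (d x) 0.
    by rewrite /g dx0 conjc0 mulr0 mul0r cabs0 mulr_ge0.
  have dpos : 0 < cabs (d x).
    rewrite lt_neqAle cabs_ge0 andbT eq_sym; apply/eqP => /cabs_eq0 h; by rewrite h eqxx in dx0.
  rewrite -(ler_pM2r dpos) -cabsM mulrC -(eq x hx).
  exact: lipschitz_quotient.
exists g, (4 * L); split => //.
pose A x := (f x - f x0) * conjc (d x).
have tA : ctame A.
  apply: ctameM; last exact: ctameJ.
  by apply: ctame_ext (ctameD tf (ctame_cst (- f x0))).
have mu : measurable_fun (`[0, tpi] : set R) (fun x => u x `^ (-1)).
  apply: (@measurableT_comp _ _ _ _ _ _ (@powR R ^~ (-1))); first exact: measurable_powR.
  by case: tu.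
split; split.
- rewrite (_ : re_of g = fun x => re_of A x * u x `^ (-1)); last first.
    by apply/funext => x; rewrite /re_of /g ReM /= mulr0 subr0.
  by apply: measurable_funM => //; case: tA => -[].
- by exists (4 * L) => x hx; apply: le_trans (normRe_le_cabs _) (bg x hx).
- rewrite (_ : im_of g = fun x => im_of A x * u x `^ (-1)); last first.
    by apply/funext => x; rewrite /im_of /g ImM /= mulr0 add0r.
  by apply: measurable_funM => //; case: tA => _ [].
- by exists (4 * L) => x hx; apply: le_trans (normIm_le_cabs _) (bg x hx).
Qed.

Lemma sum_intsS (V : zmodType) (F : int -> V) N :
  \sum_(n <- ints N.+1) F n = F (Posz N.+1) + F (- (Posz N.+1)) + \sum_(n <- ints N) F n.
Proof.
rewrite -addrA.
have -> : F (Posz N.+1) + (F (- Posz N.+1) + \sum_(n <- ints N) F n) =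
   \sum_(n <- Posz N.+1 :: - (Posz N.+1) :: ints N) F n by rewrite !big_cons.
apply: perm_big; apply: uniq_perm; first exact: ints_uniq.
  have a1 : Posz N.+1 \notin - Posz N.+1 :: ints N by rewrite in_cons mem_ints; lia.
  have a2 : - Posz N.+1 \notin ints N by rewrite mem_ints; lia.
  by apply/and3P; split; [exact: a1 | exact: a2 | exact: ints_uniq].
by move=> k; rewrite mem_ints (in_cons (Posz N.+1)) (in_cons (- Posz N.+1)) mem_ints; lia.
Qed.

Lemma sum_ints0 (V : zmodType) (F : int -> V) : \sum_(n <- ints 0) F n = F 0.
Proof.
have -> : F 0 = \sum_(n <- [:: 0]) F n by rewrite big_seq1.
by apply: perm_big; apply: uniq_perm; rewrite ?ints_uniq // => k; rewrite mem_ints inE; lia.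
Qed.

(** Multiplication by [cexpi] shifts the coefficients, so those of [f - f x0] are
    differences of consecutive coefficients of [g]. *)
Lemma partial_sum_telescope f g (x0 : R) N : ctame f -> ctame g ->
  (forall x, 0 <= x <= tpi -> f x - f x0 = (cexpi x - cexpi x0) * g x) ->
  \sum_(n <- ints N) coef f n * chr n x0 - f x0 =
  chr (- (Posz N)) x0 * coef g (- (Posz N.+1)) - chr (Posz N.+1) x0 * coef g (Posz N).
Proof.
move=> tf tg hg.
have rel n : coef f n = f x0 * (0 == n)%:R + (coef g (n - 1) - cexpi x0 * coef g n).
  have e1 : coef (fun x => f x + (- f x0)) n = coef f n + - f x0 * (0 == n)%:R.
    by rewrite coefD ?coef_cst //; exact: ctame_cst.
  have t1 : ctame (fun x => chr 1 x * g x) by apply: ctameM => //; exact: ctame_chr.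
  have t2 : ctame (fun x => (- cexpi x0) * g x) by apply: ctameM => //; exact: ctame_cst.
  have e2 : coef (fun x => f x + (- f x0)) n = coef (fun x => chr 1 x * g x + (- cexpi x0) * g x) n.
    apply: eq_coef => x hx; rewrite hg // mulrBl mulNr; congr (_ * _ - _).
    by rewrite /chr mul1r.
  rewrite (coefD n t1 t2) (coefZ (- cexpi x0) n tg) in e2.
  have e3 : coef (fun x => chr 1 x * g x) n = coef g (n - 1).
    rewrite !coefE; congr (_ * torus_cint _); apply/funext => x.
    by rewrite mulrA -chrD; congr (chr _ x * _); ring.
  rewrite e1 e3 in e2; rewrite mulNr in e2.
  have -> : coef f n = (coef f n - f x0 * (0 == n)%:R) + f x0 * (0 == n)%:R by ring.
  by rewrite e2; ring.
elim: N => [|N IH].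
  have c1 : chr (Posz 1) x0 = cexpi x0 by rewrite /chr mul1r.
  rewrite sum_ints0 rel eqxx mulr1 sub0r c1 oppr0 !chr0 [- 1](_ : _ = - Posz 1) //.
  by move: (coef g (- Posz 1)) (coef g 0) => a b; ring.
rewrite sum_intsS -addrA IH !rel.
have -> : (0 == Posz N.+1) = false by [].
have -> : (0 == - Posz N.+1) = false by lia.
rewrite !mulr0 !add0r.
have h1 : Posz N.+1 - 1 = Posz N by lia.
have h2 : - Posz N.+1 - 1 = - Posz N.+2 by lia.
have c0 : chr 1 x0 = cexpi x0 by rewrite /chr mulr1z mul1r.
have c1 : chr (Posz N.+2) x0 = cexpi x0 * chr (Posz N.+1) x0.
  have -> : Posz N.+2 = 1 + Posz N.+1 by lia. rewrite chrD c0. reflexivity.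
have c2 : chr (- Posz N) x0 = cexpi x0 * chr (- Posz N.+1) x0.
  have -> : - Posz N = 1 + - Posz N.+1 by lia. rewrite chrD c0. reflexivity.
rewrite h1 h2 c1 c2; ring.
Qed.

(** The boundary terms of [partial_sum_telescope] are small for arbitrarily large
    truncations [K], so only the terms between [N] and [K] matter; they are bounded
    by their decay. *)
Lemma fourier_tail_le : exists Z : R, 0 < Z /\
  forall f (L A x0 : R) N, 0 <= L -> 0 <= A -> ctame f -> (forall x, f (x + tpi) = f x) ->
    (forall x y, 0 <= x <= 2 * tpi -> 0 <= y <= 2 * tpi -> cabs (f x - f y) <= L * `|x - y|) -> 0 <= x0 <= tpi ->
    (forall n, cabs (coef f n) <= A * jap n `^ (-4)) ->
    cabs (f x0 - \sum_(n <- ints N) coef f n * chr n x0) <= A * Z * (1 + N%:R) `^ (-2).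
Proof.
have s2 : 1 < 2 :> R by lra.
have [Z [Z0 HZ]] := sum_bracket_le s2.
exists Z; split => // f L A x0 N L0 A0 tf per lip hx0 dec.
have [g [M [tg bg hg]]] := chernoff_quotient L0 tf per lip hx0.
apply/ler_addgt0Pr => e e0.
have [K [KN he]] := coef_small N tg bg e0.
set SN := \sum_(n <- ints N) _.
have -> : f x0 - SN = (f x0 - \sum_(n <- ints K) coef f n * chr n x0) +
   (\sum_(n <- ints K) coef f n * chr n x0 - SN) by ring.
apply: le_trans (cabsD _ _) _; rewrite addrC; apply: lerD; last first.
  rewrite cabsC (partial_sum_telescope K tf tg hg).
  apply: le_trans (cabsB _ _) _; rewrite !(cabsM (chr _ _)) !cabs_chr !mul1r; exact: he.
have -> : SN = \sum_(n <- ints K | n \in ints N) coef f n * chr n x0.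
  rewrite -big_filter; apply: perm_big; apply: uniq_perm; rewrite ?filter_uniq ?ints_uniq //.
  by move=> k; rewrite mem_filter !mem_ints; lia.
rewrite (bigID (fun n => n \in ints N)) /= addrAC subrr add0r.
apply: le_trans (cabs_sum _ _ _) _.
apply: le_trans (_ : \sum_(n <- ints K | n \notin ints N) A * (1 + N%:R) `^ (-2) * jap n `^ (-2) <= _).
  apply: ler_sum => n; rewrite mem_ints -ltnNge => nN.
  rewrite cabsM cabs_chr mulr1; apply: le_trans (dec n) _.
  rewrite -mulrA ler_wpM2l //.
  have N0 : 0 < 1 + N%:R :> R by rewrite ltr_pwDl.
  have -> : (-4 : R) = -2 + -2 by ring.
  rewrite powRD ?(gt_eqF (bracket_gt0 _ _)) ?implybT //.
  rewrite ler_wpM2r ?powR_ge0 // !powRN lef_pV2 ?posrE ?powR_gt0 ?bracket_gt0 //.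
  apply: ge0_ler_powR; rewrite ?nnegrE ?bracket_ge0 ?addr_ge0 //.
  by rewrite /bracket lerD2l ler_nat ltnW.
rewrite -mulr_sumr (_ : A * Z * (1 + N%:R) `^ (-2) = A * (1 + N%:R) `^ (-2) * Z); last by ring.
apply: ler_wpM2l; first by rewrite mulr_ge0 ?powR_ge0.
by rewrite -big_filter; apply: HZ; rewrite filter_uniq ?ints_uniq.
Qed.

End Inversion.

(** * Functions smooth in time and space *)

Section SmoothFamilies.
Variable R : realType.
Local Notation tpi := (2 * pi : R).
Local Notation jap := (bracket R).

Lemma continuous2_bounded (w : R -> R -> R) (a b c d : R) :
  continuous (fun z : R * R => w z.1 z.2) ->
  exists M : R, forall t x, a <= t <= b -> c <= x <= d -> `|w t x| <= M.
Proof.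
move=> cw.
have K : compact (`[a, b] `*` `[c, d] : set (R * R)%type).
  by apply: compact_setX; exact: segment_compact.
have cW : {within (`[a, b] `*` `[c, d] : set (R * R)%type), continuous (fun z : R * R => w z.1 z.2)}.
  exact: continuous_subspaceT.
have /compact_bounded [M [_ hM]] := continuous_compact cW K.
exists (M + 1) => t x ht hx; apply: (hM (M + 1)); first by rewrite ltrDl.
by exists (t, x) => //; split => /=; rewrite in_itv.
Qed.

Lemma continuous2_slice (w : R -> R -> R) (t : R) :
  continuous (fun z : R * R => w z.1 z.2) -> continuous (w t).
Proof.
move=> cw x; apply: (@continuous_comp R (R * R)%type R (fun x => (t, x)) (fun z : R * R => w z.1 z.2)).
  by apply: (@cvg_pair _ _ _ _ (nbhs t) (nbhs x)); [exact: cvg_cst | exact: cvg_id].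
exact: cw.
Qed.

Lemma torus_int_dt (w : R -> R -> R) (c : R -> R) (t : R) :
  continuous (fun z : R * R => w z.1 z.2) ->
  continuous (fun z : R * R => dt w z.1 z.2) ->
  (forall t x, derivable (fun s => w s x) t 1) ->
  continuous c ->
  is_derive t 1 (fun s => torus_int (fun x => c x * w s x)) (torus_int (fun x => c x * dt w t x)).
Proof.
move=> cw cdw dw cc.
have [M hM] := continuous2_bounded (t - 1) (t + 1) 0 tpi cdw.
have tc := tame_continuous cc.
have [_ [K hK]] := tc.
pose f (s x : R) := c x * w s x.
have df (s x : R) : is_derive s 1 (f ^~ x) (c x * dt w s x).
  apply: is_derive_ext (is_deriveZ (c x) (derivableP (dw s x))) => [//|].
  by rewrite /GRing.scale /= /dt derive1E.
have p1 s x : partial1of2 f s x = c x * dt w s x.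
  by rewrite /partial1of2 derive1E; case: (df s x).
have tin : `](t - 1), (t + 1)[%classic t by rewrite /= in_itv /=; apply/andP; split; lra.
have intf s : lebesgue_measure.-integrable `[0, tpi] (EFin \o f s).
  by apply: tame_integrable; apply: tameM => //; apply: tame_continuous; exact: continuous2_slice.
pose G (x : R) : R := `|K| * `|M|.
have G0 x : 0 <= G x by rewrite mulr_ge0.
have intG : lebesgue_measure.-integrable `[0, tpi] (EFin \o G).
  by apply: tame_integrable; exact: tame_cst.
have bG s x : `](t - 1), (t + 1)[%classic s -> `[0, tpi]%classic x -> `|partial1of2 f s x| <= G x.
  rewrite /= !in_itv /= => /andP[s1 s2] hx; rewrite p1 normrM.
  apply: ler_pM => //; first by apply: le_trans (hK x hx) (ler_norm _).
  by apply: le_trans (hM s x _ hx) (ler_norm _); rewrite !ltW.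
have mI : measurable (`[0, tpi] : set R) by exact: measurable_itv.
have df1 s x : `](t - 1), (t + 1)[%classic s -> `[0, tpi]%classic x -> derivable (f ^~ x) s 1.
  by move=> _ _; case: (df s x).
have d1 := @derivable_under_integral R _ _ lebesgue_measure f `[0, tpi] mI t (t - 1) (t + 1) tin
   (fun s _ => intf s) df1 G G0 intG bG.
have d2 := @differentiation_under_integral R _ _ lebesgue_measure f `[0, tpi] mI t (t - 1) (t + 1) tin
   (fun s _ => intf s) df1 G G0 intG bG.
split; first exact: d1.
rewrite -derive1E; rewrite /torus_int /Rintegral in d2 *; rewrite d2.
by congr fine; apply: eq_integral => x _; rewrite p1.
Qed.

Variable U : R -> R -> R[i].
Hypotheses (sre : smooth2 (re2 U)) (sim : smooth2 (im2 U)).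
Hypothesis per : forall t x, U t (x + tpi) = U t x.

Definition xder (k : nat) (t x : R) : R[i] :=
  partials (nseq k false) (re2 U) t x +i* partials (nseq k false) (im2 U) t x.

Lemma xder0 t x : xder 0 t x = U t x.
Proof. by rewrite /xder /= /re2 /im2; case: (U t x). Qed.

Lemma has_cderiv_xder k t x : has_cderiv (xder k t) x (xder k.+1 t x).
Proof.
have [_ /(_ t x) [_ d1]] := sre (nseq k false).
have [_ /(_ t x) [_ d2]] := sim (nseq k false).
split.
  by split; [exact: d1 | rewrite -derive1E].
by split; [exact: d2 | rewrite -derive1E].
Qed.

Lemma derive_periodic (h dh : R -> R) : (forall x : R, is_derive x 1 h (dh x)) ->
  (forall x, h (x + tpi) = h x) -> forall x, dh (x + tpi) = dh x.
Proof.
move=> d p x.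
have sh : is_derive x 1 (fun y : R => y + tpi) (1 + 0).
  exact: (is_deriveD (is_derive_id x 1) (is_derive_cst tpi x 1)).
have d1 := @is_derive1_comp R h (fun y : R => y + tpi) x _ _ (d (x + tpi)) sh.
have e : h \o (fun y => y + tpi) = h by apply/funext => y /=.
rewrite e in d1.
case: (d x) => _ <-; case: d1 => _ ->.
by rewrite addr0 mulr1.
Qed.

Lemma xder_periodic k t x : xder k t (x + tpi) = xder k t x.
Proof.
elim: k x => [|k IH] x; first by rewrite !xder0 per.
apply: complex_ext.
  apply: (@derive_periodic (fun y => complex.Re (xder k t y)) (fun y => complex.Re (xder k.+1 t y))).
    by move=> y; case: (has_cderiv_xder k t y).
  by move=> y; rewrite IH.
apply: (@derive_periodic (fun y => complex.Im (xder k t y)) (fun y => complex.Im (xder k.+1 t y))).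
  by move=> y; case: (has_cderiv_xder k t y).
by move=> y; rewrite IH.
Qed.

Lemma xder_bounded k (a b c d : R) :
  exists M : R, 0 <= M /\ forall t x, a <= t <= b -> c <= x <= d -> cabs (xder k t x) <= M.
Proof.
have [c1 _] := sre (nseq k false); have [c2 _] := sim (nseq k false).
have [M1 h1] := continuous2_bounded a b c d c1.
have [M2 h2] := continuous2_bounded a b c d c2.
exists (`|M1| + `|M2|); split; first by rewrite addr_ge0.
move=> t x ht hx; apply: le_trans (cabs_le_Re_Im _) _; apply: lerD.
  by apply: le_trans (h1 t x ht hx) (ler_norm _).
by apply: le_trans (h2 t x ht hx) (ler_norm _).
Qed.

Lemma ctame_xder k t : ctame (xder k t).
Proof. exact: ctame_derivable (has_cderiv_xder k t). Qed.

Lemma ctame_U t : ctame (U t).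
Proof. by apply: ctame_ext (ctame_xder 0 t) => x; rewrite xder0. Qed.

Lemma coef_xder k t n : coef (xder k t) n = ('i * (n%:~R)%:C) ^+ k * coef (U t) n.
Proof.
elim: k => [|k IH].
  rewrite expr0 mul1r (_ : xder 0 t = U t) //.
  by apply/funext => x; rewrite xder0.
rewrite (coef_deriv n (xder_periodic k t) (has_cderiv_xder k t) (has_cderiv_xder k.+1 t)).
by rewrite IH exprS mulrA.
Qed.

(** Four derivatives are enough for the truncation error in [truncated_evolution]
    and for the weights in [weight_exists]. *)
Lemma coef_decay (T : R) : exists A : R, 0 <= A /\
  forall t n, 0 <= t <= T -> cabs (coef (U t) n) <= A * jap n `^ (-4).
Proof.
have [M0 [M00 h0]] := xder_bounded 0 0 T 0 tpi.
have [M4 [M40 h4]] := xder_bounded 4 0 T 0 tpi.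
exists (32 * (M0 + M4)); split; first by rewrite mulr_ge0 // addr_ge0.
move=> t n ht.
have b0 : cabs (coef (U t) n) <= 2 * M0.
  apply: cabs_coef_le (ctame_U t) _ => x hx; rewrite -xder0; exact: h0.
have b4 : (absz n)%:R ^+ 4 * cabs (coef (U t) n) <= 2 * M4.
  have := cabs_coef_le n (ctame_xder 4 t) (fun x hx => h4 t x ht hx).
  rewrite coef_xder cabsM.
  suff -> : cabs (('i * (n%:~R)%:C) ^+ 4) = (absz n)%:R ^+ 4 :> R by [].
  rewrite !exprS expr0 !cabsM cabs_i cabs1 cabs_real -intr_norm natr_absz; ring.
have J0 := bracket_gt0 R n.
rewrite -[-4]/(- 4%:R) powRN powR_mulrn ?bracket_ge0 // ler_pdivlMr ?exprn_gt0 //.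
set c := cabs _ in b0 b4 *; have c0 : 0 <= c by exact: cabs_ge0.
have J4 : jap n ^+ 4 <= 16 * (1 + (absz n)%:R ^+ 4).
  have [->|n0] := eqVneq n 0; first by rewrite /bracket /= addr0 expr1n expr0n /=; lra.
  have n1 : 1 <= (absz n)%:R :> R by rewrite ler1n absz_gt0.
  have : jap n ^+ 4 <= (2 * (absz n)%:R) ^+ 4.
    by apply: lerXn2r; rewrite ?nnegrE ?bracket_ge0 ?mulr_ge0 //; rewrite /bracket; lra.
  rewrite exprMn (_ : 2 ^+ 4 = 16 :> R); last by ring.
  lra.
have h := ler_wpM2l c0 J4.
apply: le_trans h _; move: b0 b4; set m := _ ^+ 4; clearbody m c; clear; lra.
Qed.

Definition tder (t x : R) : R[i] := dt (re2 U) t x +i* dt (im2 U) t x.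

Lemma has_cderiv_coef t n : has_cderiv (fun s => coef (U s) n) t (coef (tder t) n).
Proof.
have [c1 d1] := sre [::]; have [c2 d2] := sim [::].
have [e1 _] := sre [:: true]; have [e2 _] := sim [:: true].
pose C (x : R) : R := complex.Re (chr (- n) x : R[i]).
pose S (x : R) : R := complex.Im (chr (- n) x : R[i]).
have cC : continuous C by move=> x; exact: is_derive_continuous (has_cderiv_chr (- n) x).1.
have cS : continuous S by move=> x; exact: is_derive_continuous (has_cderiv_chr (- n) x).2.
have D (w : R -> R -> R) (c : R -> R) : smooth2 w -> continuous c ->
    is_derive t 1 (fun s => torus_int (fun x => c x * w s x)) (torus_int (fun x => c x * dt w t x)).
  move=> sw cc; have [a1 a2] := sw [::]; have [a3 _] := sw [:: true].
  by exact: (@torus_int_dt w c t a1 a3 (fun s x => (a2 s x).1) cc).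
have tm (w : R -> R -> R) (c : R -> R) s : smooth2 w -> continuous c -> tame (fun x => c x * w s x).
  move=> sw cc; have [a1 _] := sw [::]; apply: tameM; apply: tame_continuous => //.
  exact: continuous2_slice a1.
have tm' (w : R -> R -> R) (c : R -> R) s : smooth2 w -> continuous c -> tame (fun x => c x * dt w s x).
  move=> sw cc; have [a1 _] := sw [:: true]; apply: tameM; apply: tame_continuous => //.
  exact: continuous2_slice a1.
have key : has_cderiv (fun s => torus_cint (fun x => chr (- n) x * U s x)) t
    (torus_cint (fun x => chr (- n) x * tder t x)).
  split.
    apply: is_derive_ext (is_deriveB (D _ _ sre cC) (D _ _ sim cS)) => [s|].
      apply: etrans (esym (torus_intB (tm _ _ s sre cC) (tm _ _ s sim cS))) _.
      by rewrite /re_of /torus_cint /=; apply: eq_torus_int => x _; rewrite /re_of ReM.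
    apply: etrans (esym (torus_intB (tm' _ _ t sre cC) (tm' _ _ t sim cS))) _.
    by rewrite /torus_cint /=; apply: eq_torus_int => x _; rewrite /re_of ReM.
  apply: is_derive_ext (is_deriveD (D _ _ sim cC) (D _ _ sre cS)) => [s|].
    apply: etrans (esym (torus_intD (tm _ _ s sim cC) (tm _ _ s sre cS))) _.
    by rewrite /im_of /torus_cint /=; apply: eq_torus_int => x _; rewrite /im_of ImM.
  apply: etrans (esym (torus_intD (tm' _ _ t sim cC) (tm' _ _ t sre cS))) _.
  by rewrite /torus_cint /=; apply: eq_torus_int => x _; rewrite /im_of ImM.
apply: has_cderiv_ext (has_cderivZ ((tpi^-1)%:C) key) => [s|]; by rewrite coefE.
Qed.

Lemma lipschitz_U t : exists L : R, 0 <= L /\ forall x y, 0 <= x <= 2 * tpi -> 0 <= y <= 2 * tpi ->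
  cabs (U t x - U t y) <= L * `|x - y|.
Proof.
have [M [M0 hM]] := xder_bounded 1 t t 0 (2 * tpi).
have tt : t <= t <= t by rewrite lexx.
have real_case (h dh : R -> R) (x y : R) : (forall x : R, is_derive x 1 h (dh x)) ->
   (forall x, 0 <= x <= 2 * tpi -> `|dh x| <= M) -> 0 <= x -> y <= 2 * tpi -> x <= y -> `|h x - h y| <= M * `|x - y|.
  move=> d b x0 y1 xy.
  have cf : {within `[x, y], continuous h}.
    by apply: continuous_subspaceT => z; exact: is_derive_continuous (d z).
  have [c cin e] := @MVT_segment R h dh x y xy (fun z _ => d z) cf.
  rewrite distrC e normrM distrC ler_wpM2r // b //.
  by move: cin; rewrite in_itv /= => /andP[c0 c1]; rewrite (le_trans x0 c0) (le_trans c1 y1).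
exists (2 * M); split; first by rewrite mulr_ge0.
move=> x y.
wlog xy : x y / x <= y.
  move=> H hx hy; have [le|/ltW le] := leP x y; first exact: H.
  by rewrite cabsC distrC; exact: H.
move=> /andP[x0 _] /andP[_ y1].
apply: le_trans (cabs_le_Re_Im _) _; rewrite ReD ReN ImD ImN.
rewrite [2 * M]mulrDl mul1r mulrDl; apply: lerD.
  apply: (real_case (fun z => complex.Re (U t z)) (fun z => complex.Re (xder 1 t z))) => //.
    by move=> z; have [d _] := has_cderiv_xder 0 t z; apply: is_derive_ext d => [w|//]; rewrite /re_of xder0.
  by move=> z hz; apply: le_trans (normRe_le_cabs _) (hM t z tt hz).
apply: (real_case (fun z => complex.Im (U t z)) (fun z => complex.Im (xder 1 t z))) => //.
  by move=> z; have [_ d] := has_cderiv_xder 0 t z; apply: is_derive_ext d => [w|//]; rewrite /im_of xder0.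
by move=> z hz; apply: le_trans (normIm_le_cabs _) (hM t z tt hz).
Qed.

End SmoothFamilies.

(** * The equation on the Fourier side *)

Section Cubic.
Variable R : realType.
Local Notation tpi := (2 * pi : R).
Implicit Types (v : int -> R[i]).

Definition trigpoly N v (x : R) : R[i] := \sum_(k <- ints N) v k * chr k x.

Definition cut N v (k : int) : R[i] := if k \in ints N then v k else 0.

Lemma ctame_trigpoly N v : ctame (trigpoly N v).
Proof.
apply: ctame_sum => k; apply: ctameM; [exact: ctame_cst | exact: ctame_chr].
Qed.

Lemma cabs_trigpoly_le N v (B x : R) : \sum_(k <- ints N) cabs (v k) <= B ->
  cabs (trigpoly N v x) <= B.
Proof.
apply: le_trans; apply: le_trans (cabs_sum _ _ _) _; apply: ler_sum => k _.
by rewrite cabsM cabs_chr mulr1.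
Qed.

Lemma conj_trigpoly N v x : conjc (trigpoly N v x) = \sum_(k <- ints N) conjc (v k) * chr (- k) x.
Proof. by rewrite conj_sum; apply: eq_bigr => k _; rewrite conjM chrJ. Qed.

Lemma sum_cut N v (k : int) (c : R[i]) :
  \sum_(i <- ints N) (i == k)%:R * (conjc (v i) * c) = conjc (cut N v k) * c.
Proof.
rewrite /cut; case: ifP => kN; first by rewrite (@sum_ints_single R k (fun i => conjc (v i) * c)).
rewrite big_seq big1 ?conjc0 ?mul0r // => i iN.
by case: eqVneq => [e|_]; [rewrite -e iN in kN | rewrite mul0r].
Qed.

Lemma coef_cubic N v n :
  coef (fun x => trigpoly N v x * conjc (trigpoly N v x) * trigpoly N v x) n =
  \sum_(x <- pairs N) v x.1 * conjc (cut N v (x.1 + x.2 - n)) * v x.2.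
Proof.
have -> : (fun x => trigpoly N v x * conjc (trigpoly N v x) * trigpoly N v x) =
   fun x => \sum_(j <- ints N) \sum_(k <- ints N) \sum_(l <- ints N)
      v j * conjc (v k) * v l * chr (j - k + l) x.
  apply/funext => x; rewrite conj_trigpoly sum3_mul.
  apply: eq_bigr => j _; apply: eq_bigr => k _; apply: eq_bigr => l _.
  rewrite !chrD; ring.
have t3 j k l : ctame (fun x => v j * conjc (v k) * v l * chr (j - k + l) x).
  by apply: ctameM; [exact: ctame_cst | exact: ctame_chr].
have t2 j k : ctame (fun x => \sum_(l <- ints N) v j * conjc (v k) * v l * chr (j - k + l) x).
  exact: ctame_sum.
rewrite coef_sum; last by move=> j; exact: ctame_sum.
rewrite big_allpairs_dep /=; apply: eq_bigr => j _.
rewrite coef_sum //.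
rewrite (eq_bigr (fun k => \sum_(l <- ints N) v j * conjc (v k) * v l * (j - k + l == n)%:R)); last first.
  move=> k _; rewrite coef_sum //; apply: eq_bigr => l _.
  by rewrite coefZ ?coef_chr //; exact: ctame_chr.
rewrite exchange_big /=; apply: eq_bigr => l _.
rewrite -mulrA mulrC -mulrA -sum_cut; apply: eq_bigr => k _.
rewrite (_ : (j - k + l == n) = (k == j + l - n)); last by apply/eqP/eqP; lia.
case: (k == _); rewrite ?mulr1 ?mul1r ?mulr0 ?mul0r ?mulr0 //; ring.
Qed.

Lemma coef_trigpoly_sqr N v :
  coef (fun x => trigpoly N v x * conjc (trigpoly N v x)) 0 = (\sum_(k <- ints N) cabs (v k) ^+ 2)%:C.
Proof.
have -> : (fun x => trigpoly N v x * conjc (trigpoly N v x)) =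
   fun x => \sum_(j <- ints N) \sum_(k <- ints N) v j * conjc (v k) * chr (j - k) x.
  apply/funext => x; rewrite conj_trigpoly mulr_suml; apply: eq_bigr => j _.
  rewrite mulr_sumr; apply: eq_bigr => k _; rewrite !chrD; ring.
have t2 j k : ctame (fun x => v j * conjc (v k) * chr (j - k) x).
  by apply: ctameM; [exact: ctame_cst | exact: ctame_chr].
rewrite coef_sum; last by move=> j; exact: ctame_sum.
rewrite rmorph_sum /= big_seq [RHS]big_seq; apply: eq_bigr => j jN.
rewrite coef_sum // cabs_sqr -(@sum_ints_single R j (fun k => v j * conjc (v k)) N jN).
apply: eq_bigr => k _; rewrite coefZ ?coef_chr; last exact: ctame_chr.
by rewrite mulrC subr_eq0 eq_sym.
Qed.

Lemma sum_sgn N v n : n \in ints N ->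
  \sum_(x <- pairs N) sgn R n x * (v x.1 * conjc (cut N v (x.1 + x.2 - n)) * v x.2) =
  \sum_(x <- pairs N) v x.1 * conjc (cut N v (x.1 + x.2 - n)) * v x.2
  - 2 * (\sum_(k <- ints N) cabs (v k) ^+ 2)%:C * v n.
Proof.
move=> nN.
pose X j l := v j * conjc (cut N v (j + l - n)) * v l.
have Ej : \sum_(j <- ints N) \sum_(l <- ints N) (n - j == 0)%:R * X j l =
    (\sum_(k <- ints N) cabs (v k) ^+ 2)%:C * v n.
  rewrite rmorph_sum /= mulr_suml.
  transitivity (\sum_(j <- ints N) (j == n)%:R * \sum_(l <- ints N) X j l).
    by apply: eq_bigr => j _; rewrite mulr_sumr; apply: eq_bigr => l _; rewrite subr_eq0 eq_sym.
  rewrite (@sum_ints_single R n (fun j => \sum_(l <- ints N) X j l)) //.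
  rewrite big_seq [RHS]big_seq; apply: eq_bigr => l lN.
  rewrite /X /cut (_ : n + l - n = l); last by ring.
  rewrite lN cabs_sqr; ring.
have El : \sum_(j <- ints N) \sum_(l <- ints N) (n - l == 0)%:R * X j l =
    (\sum_(k <- ints N) cabs (v k) ^+ 2)%:C * v n.
  rewrite rmorph_sum /= mulr_suml big_seq [RHS]big_seq; apply: eq_bigr => j jN.
  transitivity (\sum_(l <- ints N) (l == n)%:R * X j l).
    by apply: eq_bigr => l _; rewrite subr_eq0 eq_sym.
  rewrite (@sum_ints_single R n (X j)) //.
  rewrite /X /cut (_ : j + n - n = j); last by ring.
  by rewrite jN cabs_sqr.
rewrite -mulrA mulr_natl mulr2n -{1}Ej -El !big_allpairs_dep /=.
rewrite -big_split /= -sumrB; apply: eq_bigr => j _.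
rewrite -big_split /= -sumrB; apply: eq_bigr => l _.
rewrite /sgn /= -/(X j l); ring.
Qed.

Lemma coef_sqr (u : R -> R[i]) : coef (fun x => u x * conjc (u x)) 0 = (mean_sq u)%:C.
Proof.
rewrite coefE /mean_sq rmorphM /=; congr (_ * _).
rewrite (_ : (fun x => _) = fun x => (cabs (u x) ^+ 2)%:C); last first.
  by apply/funext => x; rewrite oppr0 chr0 mul1r cabs_sqr.
apply: complex_ext; rewrite /torus_cint //=.
rewrite (_ : im_of _ = fun=> 0); last by apply/funext.
by rewrite torus_int_cst mul0r.
Qed.

Lemma cabs_sqr_sub_le (y z : R[i]) (B d : R) : cabs y <= B -> cabs z <= B -> cabs (y - z) <= d ->
  cabs (y * conjc y - z * conjc z) <= 2 * B * d.
Proof.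
move=> yB zB yz; have B0 : 0 <= B := le_trans (cabs_ge0 y) yB.
have -> : y * conjc y - z * conjc z = (y - z) * conjc y + z * conjc (y - z) by rewrite conjB; ring.
apply: le_trans (cabsD _ _) _; rewrite !cabsM !cabs_conj (_ : 2 * B * d = d * B + B * d); last by ring.
by apply: lerD; apply: ler_pM => //; exact: cabs_ge0.
Qed.

Lemma cabs_cube_sub_le (y z : R[i]) (B d : R) : cabs y <= B -> cabs z <= B -> cabs (y - z) <= d ->
  cabs (y * conjc y * y - z * conjc z * z) <= 3 * B ^+ 2 * d.
Proof.
move=> yB zB yz; have B0 : 0 <= B := le_trans (cabs_ge0 y) yB.
have d0 : 0 <= d := le_trans (cabs_ge0 _) yz.
have -> : y * conjc y * y - z * conjc z * z =
   (y * conjc y - z * conjc z) * y + z * conjc z * (y - z) by ring.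
apply: le_trans (cabsD _ _) _; rewrite !(cabsM _ y) !(cabsM _ (y - z)) (cabsM z) cabs_conj.
have h := cabs_sqr_sub_le yB zB yz.
rewrite (_ : 3 * B ^+ 2 * d = 2 * B * d * B + B * B * d); last by ring.
apply: lerD; first by apply: ler_pM => //; exact: cabs_ge0.
apply: ler_pM => //; [by apply: mulr_ge0; exact: cabs_ge0 | exact: cabs_ge0 |].
by apply: ler_pM => //; exact: cabs_ge0.
Qed.

(** The cubic term and the mean square are Lipschitz on bounded sets, and [u] is
    within [d] of the trigonometric polynomial, for which [sum_sgn] is exact. *)
Lemma cubic_defect_le N (u : R -> R[i]) (B d : R) n : n \in ints N -> ctame u ->
  (forall x, 0 <= x <= tpi -> cabs (u x) <= B) ->
  \sum_(k <- ints N) cabs (coef u k) <= B ->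
  (forall x, 0 <= x <= tpi -> cabs (u x - trigpoly N (coef u) x) <= d) ->
  cabs (coef (fun x => u x * conjc (u x) * u x) n - 2 * (mean_sq u)%:C * coef u n -
    \sum_(x <- pairs N) sgn R n x *
      (coef u x.1 * conjc (cut N (coef u) (x.1 + x.2 - n)) * coef u x.2)) <= 14 * B ^+ 2 * d.
Proof.
move=> nN tu uB sB ud.
pose S := trigpoly N (coef u).
have tS : ctame S by exact: ctame_trigpoly.
have SB x : cabs (S x) <= B by exact: cabs_trigpoly_le.
have tuu : ctame (fun x => u x * conjc (u x)) by apply: ctameM => //; exact: ctameJ.
have tSS : ctame (fun x => S x * conjc (S x)) by apply: ctameM => //; exact: ctameJ.
have coefB f g k : ctame f -> ctame g -> coef f k - coef g k = coef (fun x => f x - g x) k.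
  move=> tf tg; rewrite -mulN1r -coefZ // -coefD //; last by apply: ctameM => //; exact: ctame_cst.
  by apply: eq_coef => x _; rewrite mulN1r.
have ctB f g : ctame f -> ctame g -> ctame (fun x => f x - g x).
  move=> tf tg; apply: ctame_ext (ctameD tf (ctameM (ctame_cst (-1)) tg)) => x.
  by rewrite mulN1r.
rewrite sum_sgn // -coef_cubic -coef_trigpoly_sqr -coef_sqr -/S.
rewrite (_ : _ - _ - _ =
  (coef (fun x => u x * conjc (u x) * u x) n - coef (fun x => S x * conjc (S x) * S x) n)
  + - 2 * (coef (fun x => u x * conjc (u x)) 0 - coef (fun x => S x * conjc (S x)) 0) * coef u n);
  last by ring.
have vB : cabs (coef u n) <= B.
  apply: le_trans sB; rewrite (big_rem _ nN) lerDl.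
  by apply: sumr_ge0 => k _; exact: cabs_ge0.
rewrite coefB ?coefB //; try by apply: ctameM.
apply: le_trans (cabsD _ _) _.
have c2 : cabs (-2 : R[i]) = 2.
  by rewrite cabsN (_ : 2 = (2:R)%:C) ?cabs_real ?ger0_norm // rmorphD.
rewrite (cabsM _ (coef u n)) (cabsM (-2)) c2.
rewrite (_ : 14 * B ^+ 2 * d = 2 * (3 * B ^+ 2 * d) + 2 * (2 * (2 * B * d)) * B); last by ring.
apply: lerD.
  apply: cabs_coef_le; first by apply: ctB; apply: ctameM.
  by move=> x hx; apply: cabs_cube_sub_le => //; [exact: uB | exact: ud].
apply: ler_pM => //; rewrite ?mulr_ge0 ?cabs_ge0 //; apply: ler_wpM2l => //.
apply: cabs_coef_le; first exact: ctB.
by move=> x hx; apply: cabs_sqr_sub_le => //; [exact: uB | exact: ud].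
Qed.

End Cubic.

Section Evolution.
Variable R : realType.
Local Notation tpi := (2 * pi : R).
Local Notation jap := (bracket R).
Variables (omega : R) (u0 : R -> R[i]) (U : R -> R -> R[i]).
Hypothesis sol : smooth_NLS_solution omega u0 U.

Let sre : smooth2 (re2 U). Proof. by case: sol. Qed.
Let sim : smooth2 (im2 U). Proof. by case: sol. Qed.
Let per t x : U t (x + tpi) = U t x. Proof. by case: sol. Qed.

(** The interaction representation: the free evolution is factored out. *)
Definition profile (n : int) (t : R) : R[i] := cexpi (n%:~R ^+ 2 * t) * coef (U t) n.

Lemma cabs_profile n t : cabs (profile n t) = cabs (coef (U t) n).
Proof. by rewrite cabsM cabs_cexpi mul1r. Qed.

Lemma coef_tder n t : 0 <= t -> coef (tder U t) n =
  'i * (- (n%:~R ^+ 2)%:C * coef (U t) n + omega%:C *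
    (coef (fun x => U t x * conjc (U t x) * U t x) n - 2 * (mean_sq (U t))%:C * coef (U t) n)).
Proof.
move=> t0; case: sol => _ _ _ _ pde.
have tU := ctame_U sre sim t.
have tc : ctame (fun x => U t x * conjc (U t x) * U t x).
  by apply: ctameM => //; apply: ctameM => //; exact: ctameJ.
have -> : tder U t = fun x => 'i * xder U 2 t x + 'i * omega%:C * (U t x * conjc (U t x) * U t x)
   + (- 2 * 'i * omega%:C * (mean_sq (U t))%:C) * U t x.
  apply/funext => x; have := pde t x t0.
  rewrite -/(tder U t x) -[cdxx U t x]/(xder U 2 t x) (_ : 0 +i* 1 = 'i%R) //.
  have -> : (omega * (cabs (U t x) ^+ 2 - 2 * mean_sq (U t)))%:C =
     omega%:C * (U t x * conjc (U t x) - (1 + 1) * (mean_sq (U t))%:C).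
    rewrite (rmorphM (real_complex R)) rmorphB (rmorphM (real_complex R) 2) (rmorphD (real_complex R) 1 1).
    by rewrite -cabs_sqr.
  move=> e.
  have ii : 'i * 'i = -1 :> R[i] by rewrite -expr2 sqr_i.
  have -> : tder U t x = tder U t x + 'i * ('i * tder U t x + xder U 2 t x +
    omega%:C * (U t x * conjc (U t x) - (1 + 1) * (mean_sq (U t))%:C) * U t x).
    by rewrite e mulr0 addr0.
  rewrite (mulrDr 'i) (mulrDr 'i) mulrA ii; rewrite ?complexiE; ring.
have t1 : ctame (fun x => 'i * xder U 2 t x).
  by apply: ctameM; [exact: ctame_cst | exact: ctame_xder].
have t2 : ctame (fun x => 'i * omega%:C * (U t x * conjc (U t x) * U t x)).
  by apply: ctameM => //; exact: ctame_cst.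
rewrite coefD //; last by apply: ctameM => //; exact: ctame_cst.
  rewrite coefD // !coefZ //; last exact: ctame_xder.
  rewrite coef_xder // exprMn expr2 -expr2 sqr_i -rmorphXn /=; ring.
exact: ctameD.
Qed.

Lemma cexpi_wave (n : int) x (t : R) :
  cexpi (n%:~R ^+ 2 * t) = wave (phase n x) t * cexpi (x.1%:~R ^+ 2 * t) *
     conjc (cexpi ((x.1 + x.2 - n)%:~R ^+ 2 * t)) * cexpi (x.2%:~R ^+ 2 * t).
Proof.
rewrite conj_cexpi /wave -!cexpiD; congr cexpi.
rewrite /phase intrM !(intrB, intrD); ring.
Qed.

Lemma nonlin_profile N n t :
  nonlin N (fun k s => cut N (profile^~ s) k) n t =
  cexpi (n%:~R ^+ 2 * t) * \sum_(x <- pairs N) sgn R n x *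
     (coef (U t) x.1 * conjc (cut N (coef (U t)) (x.1 + x.2 - n)) * coef (U t) x.2).
Proof.
rewrite /nonlin mulr_sumr big_seq [RHS]big_seq; apply: eq_bigr => x.
case: x => j l; rewrite mem_pairs => /andP[jN lN] /=.
rewrite /cut jN lN; case: ifP => _; last by rewrite conjc0 !(mulr0, mul0r).
rewrite (cexpi_wave n (j, l)) /profile !conjM /=.
have e : cexpi ((j + l - n)%:~R ^+ 2 * t) * conjc (cexpi ((j + l - n)%:~R ^+ 2 * t)) = 1 :> R[i].
  by rewrite conj_cexpi -cexpiD subrr cexpi0.
ring.
Qed.

Lemma has_cderiv_profile n t : 0 <= t -> has_cderiv (profile n) t
  ('i * omega%:C * (cexpi (n%:~R ^+ 2 * t) *
    (coef (fun x => U t x * conjc (U t x) * U t x) n - 2 * (mean_sq (U t))%:C * coef (U t) n))).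
Proof.
move=> t0.
have h := has_cderivM (has_cderiv_cexpi (n%:~R ^+ 2) t) (has_cderiv_coef sre sim t n).
apply: (has_cderiv_ext _ _ h) => [//|].
rewrite coef_tder //; ring.
Qed.

Lemma sum_ints_cst N (c : R) : \sum_(n <- ints N) c = c * (2 * N%:R + 1).
Proof.
elim: N => [|N IH]; first by rewrite (sum_ints0 (fun=> c)) mulr0 add0r mulr1.
by rewrite (sum_intsS (fun=> c)) IH -[N.+1]addn1 natrD; ring.
Qed.

(** The solution differs from its truncation by a quantity of order [N ^ (-2)],
    which is summed over the [2 N + 1] equations. *)
Lemma truncated_evolution (T : R) : `|omega| <= 1 ->
  exists A B K : R, [/\ 0 <= A, 0 <= B, 0 <= K &
   (forall t n, 0 <= t <= T -> cabs (profile n t) <= A * jap n `^ (-4)) /\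
   forall N, exists err : int -> R -> R[i],
    let x n t := cut N (profile^~ t) n in
    [/\ forall n t, n \in ints N -> 0 <= t <= T ->
          has_cderiv (x n) t ('i * omega%:C * nonlin N x n t + err n t),
        forall t, 0 <= t <= T -> \sum_(n <- ints N) cabs (err n t) <= K / (1 + N%:R) &
        forall t, 0 <= t <= T -> \sum_(n <- ints N) cabs (x n t) <= B]].
Proof.
move=> om1.
have [A [A0 hA]] := coef_decay sre sim per T.
have [S [S0 hS]] := @sum_bracket_le R 4 ltac:(by rewrite ltr1n).
have [M [M0 hM]] := xder_bounded sre sim 0 0 T 0 tpi.
have [Z [Z0 hZ]] := fourier_tail_le R.
pose B := A * S + M.
have B0 : 0 <= B by rewrite addr_ge0 // mulr_ge0 // ltW.
have sB N t : 0 <= t <= T -> \sum_(k <- ints N) cabs (coef (U t) k) <= B.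
  move=> ht; apply: (@le_trans _ _ (A * S)); last by rewrite lerDl.
  apply: (@le_trans _ _ (\sum_(k <- ints N) A * jap k `^ (-4))).
    by apply: ler_sum => k _; exact: hA.
  by rewrite -mulr_sumr ler_wpM2l // hS // ints_uniq.
exists A, B, (28 * B ^+ 2 * (A * Z)); split => //.
  by rewrite !mulr_ge0 // ?exprn_ge0 // ltW.
split; first by move=> t n ht; rewrite cabs_profile; exact: hA.
move=> N.
pose def n t := coef (fun x => U t x * conjc (U t x) * U t x) n - 2 * (mean_sq (U t))%:C * coef (U t) n -
    \sum_(x <- pairs N) sgn R n x *
      (coef (U t) x.1 * conjc (cut N (coef (U t)) (x.1 + x.2 - n)) * coef (U t) x.2).
exists (fun n t => 'i * omega%:C * (cexpi (n%:~R ^+ 2 * t) * def n t)).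
split.
- move=> n t nN /andP[t0 _]; apply: has_cderiv_ext (has_cderiv_profile n t0).
    by move=> s; rewrite /cut nN.
  rewrite nonlin_profile /def; ring.
- move=> t ht.
  pose d : R := A * Z * (1 + N%:R) `^ (-2).
  have [L [L0 hL]] := lipschitz_U sre sim t.
  have b n : n \in ints N ->
    cabs ('i * omega%:C * (cexpi (n%:~R ^+ 2 * t) * def n t)) <= 14 * B ^+ 2 * d.
    move=> nN; rewrite (cabsM ('i * _)) (cabsM 'i) cabs_i mul1r cabs_real (cabsM (cexpi _)) cabs_cexpi mul1r.
    rewrite -[leRHS]mul1r; apply: ler_pM; rewrite ?normr_ge0 ?cabs_ge0 //.
    apply: cubic_defect_le => //; first exact: ctame_U.
    - move=> x hx; rewrite -xder0; apply: le_trans (hM t x ht hx) _.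
      by rewrite lerDr mulr_ge0 // ltW.
    - exact: sB.
    - move=> x hx; apply: (hZ _ L) => //; first exact: ctame_U.
      by move=> n1; exact: hA.
  apply: (@le_trans _ _ (\sum_(n <- ints N) 14 * B ^+ 2 * d)).
    by rewrite big_seq [leRHS]big_seq; apply: ler_sum => n; exact: b.
  rewrite sum_ints_cst /d.
  have N1 : 0 < 1 + N%:R :> R by rewrite ltr_wpDr.
  rewrite powRN powR_mulrn; last exact: ltW.
  have c0 : 0 <= 14 * B ^+ 2 * (A * Z) by rewrite !mulr_ge0 // ?exprn_ge0 // ltW.
  have h : (2 * N%:R + 1) / (1 + N%:R) ^+ 2 <= 2 / (1 + N%:R) :> R.
    rewrite ler_pdivrMr ?exprn_gt0 // (_ : 2 / _ * _ = 2 * (1 + N%:R)); last by field; rewrite gt_eqF.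
    by lra.
    by apply: le_trans (le_trans (ler_wpM2l c0 h) _); rewrite le_eqVlt; apply/orP; left; apply/eqP; ring.
- move=> t ht; apply: le_trans (sB N t ht); rewrite big_seq [leRHS]big_seq.
  by apply: ler_sum => n nN; rewrite /cut nN cabs_profile.
Qed.

End Evolution.

(** * Norms, weights and the passage to the limit *)

Section Limits.
Variable R : realType.
Local Notation tpi := (2 * pi : R).
Local Notation jap := (bracket R).

(** The form in which bounds pass to limits: approximation at each frequency is
    enough.  If the sum exceeded [Y], so would that of [th * f] for some [th < 1],
    although [th * f <= h] once [d] is small against the nonzero values of [f]. *)
Lemma sum_powR_closed (s : seq int) (f : int -> R) (q Y : R) : 0 < q -> 0 <= Y ->
  (forall n, 0 <= f n) ->
  (forall d : R, 0 < d -> exists h : int -> R, [/\ forall n, 0 <= h n,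
     \sum_(n <- s) h n `^ q <= Y & forall n, n \in s -> f n <= h n + d]) ->
  \sum_(n <- s) f n `^ q <= Y.
Proof.
move=> q0 Y0 f0 app; rewrite leNgt; apply/negP => YS.
set S := \sum_(n <- s) _ in YS.
have S0 : 0 < S := le_lt_trans Y0 YS.
(* A dilation factor th with Y < th ^ q * S. *)
pose y := (Y / S + 1) / 2.
have YS1 : 0 <= Y / S < 1 by apply/andP; split; [apply: divr_ge0 => //; exact: ltW | rewrite ltr_pdivrMr ?mul1r].
have y01 : 0 < y < 1 by rewrite /y; move: YS1; generalize (Y / S) => z; lra.
pose th := y `^ q^-1.
have thq : th `^ q = y by rewrite /th -powRrM mulVf ?gt_eqF // powRr1 //; lra.
have th0 : 0 <= th by exact: powR_ge0.
have th1 : th < 1.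
  rewrite ltNge; apply/negP => h1.
  have := @ge0_ler_powR R q (ltW q0) 1 th; rewrite powR1 thq !nnegrE => /(_ ler01 th0 h1); lra.
have [m [m0 hm]] : exists m : R, 0 < m /\ forall n, n \in s -> 0 < f n -> m <= f n.
  elim: (s) => [|a s' [m [m0 hm]]]; first by exists 1.
  case: (ltP 0 (f a)) => [fa|fa].
    exists (Num.min m (f a)); split; first by rewrite lt_min m0 fa.
    move=> n; rewrite in_cons => /orP[/eqP -> _|ns fn]; first by rewrite ge_min lexx orbT.
    by rewrite ge_min hm.
  exists m; split=> // n; rewrite in_cons => /orP[/eqP -> h|ns fn]; first by lra.
  exact: hm.
have d0 : 0 < (1 - th) * m by rewrite mulr_gt0 // subr_gt0.
have [h [h0 hY hf]] := app _ d0.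
have : y * S <= Y.
  apply: le_trans hY; rewrite /S mulr_sumr big_seq [leRHS]big_seq; apply: ler_sum => n ns.
  rewrite -thq -powRM //; apply: ge0_ler_powR; rewrite ?nnegrE ?mulr_ge0 //; first exact: ltW.
  case: (ltP 0 (f n)) => [fn|fn]; last first.
    have -> : f n = 0 by apply/eqP; rewrite eq_le fn f0.
    by rewrite mulr0.
  have := hf n ns; have : (1 - th) * m <= (1 - th) * f n.
    by apply: ler_wpM2l; [rewrite subr_ge0 ltW | exact: hm].
  lra.
have -> : y * S = (Y + S) / 2 by rewrite /y; field; rewrite gt_eqF.
lra.
Qed.

Lemma esum_poweR_le (q c : R) (a : int -> R) : 0 < q -> 0 <= c -> (forall n, 0 <= a n) ->
  (((\esum_(n in [set: int]) (a n `^ q)%:E) `^ q^-1)%E <= c%:E)%E <->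
  (forall N, \sum_(n <- ints N) a n `^ q <= c `^ q).
Proof.
move=> q0 c0 a0.
have ge0 : (0 <= \esum_(n in [set: int]) (a n `^ q)%:E)%E.
  by apply: esum_ge0 => n _; rewrite lee_fin powR_ge0.
have qi0 : 0 <= q^-1 by rewrite invr_ge0 ltW.
have qn0 : q != 0 by rewrite gt_eqF.
split=> [h N|h].
  have hs : ((\sum_(n <- ints N) a n `^ q)%:E <= \esum_(n in [set: int]) (a n `^ q)%:E)%E.
    apply: esum_ge; exists [set` ints N]; first by split; [exact: finite_seq | move=> ?].
    by rewrite -fsbig_seq ?ints_uniq // sumEFin.
  move: h hs ge0; case: (\esum_(n in _) _)%E => [x| |//]; last first.
    by rewrite poweRyr ?invr_eq0 ?gt_eqF.
  rewrite poweR_EFin !lee_fin => h hs x0; apply: le_trans hs _.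
  rewrite -[leLHS](@powRr1 _ x) // -(mulVf qn0) powRrM.
  by apply: ge0_ler_powR; rewrite ?nnegrE ?powR_ge0 //; exact: ltW.
have hs : (\esum_(n in [set: int]) (a n `^ q)%:E <= (c `^ q)%:E)%E.
  apply: ge_ereal_sup => _ [A [fA _] <-].
  have [s ->] := (finite_seqP A).1 fA.
  have -> : [set` s] = [set` undup s].
    by apply/seteqP; split => n /=; rewrite mem_undup.
  rewrite -fsbig_seq ?undup_uniq // sumEFin lee_fin.
  have [N sN] := ints_sub (undup s).
  by apply: le_trans (h N); apply: sum_ge0_subset => //; [exact: undup_uniq | exact: ints_uniq | move=> n; exact: powR_ge0].
move: hs ge0; case: (\esum_(n in _) _)%E => [x| |//]; last by rewrite leye_eq.
rewrite poweR_EFin !lee_fin => hs x0.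
rewrite -[leRHS](@powRr1 _ c) // -(mulfV qn0) powRrM.
by apply: ge0_ler_powR; rewrite ?nnegrE ?powR_ge0.
Qed.

(** The symmetric sums exhaust the finite sets of frequencies. *)
Lemma Hnorm_leP (q c : R) (T : functional R) : 0 < q -> 0 <= c ->
  (Hnorm q T <= c%:E)%E <-> (forall N, \sum_(n <- ints N) cabs (fourier T n) `^ q <= c `^ q).
Proof. by move=> q0 c0; apply: esum_poweR_le => // n; exact: cabs_ge0. Qed.

Lemma cabs_fourier_le (q c : R) (T : functional R) n : 0 < q -> 0 <= c -> (Hnorm q T <= c%:E)%E ->
  cabs (fourier T n) <= c.
Proof.
move=> q0 c0 /(Hnorm_leP _ q0 c0)/(_ `|n|%N) h.
have : cabs (fourier T n) `^ q <= c `^ q.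
  apply: le_trans h; rewrite (big_rem n) ?mem_ints // lerDl.
  by apply: sumr_ge0 => k _; exact: powR_ge0.
have q1 : q * q^-1 = 1 by rewrite mulfV // gt_eqF.
move=> h'; have : (cabs (fourier T n) `^ q) `^ q^-1 <= (c `^ q) `^ q^-1.
  by apply: ge0_ler_powR; rewrite ?nnegrE ?powR_ge0 // invr_ge0; exact: ltW.
by rewrite -!powRrM q1 !powRr1 // cabs_ge0.
Qed.

Lemma fourier_sub (S T : functional R) n : fourier (distr_sub S T) n = fourier S n - fourier T n.
Proof. exact: mulrBr. Qed.

End Limits.

Section Weights.
Variable R : realType.
Local Notation jap := (bracket R).

(** Submultiplicative, hence compatible with the trilinear sums, and with a summable
    inverse, so that weighted bounds imply bounds in [l ^ 1]. *)
Definition weight (kap : R) (n : int) : R := (1 + kap * (absz n)%:R) ^+ 2.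

Lemma weight_ge1 kap n : 0 <= kap -> 1 <= weight kap n.
Proof. by move=> k0; rewrite expr_ge1 ?addr_ge0 ?mulr_ge0 // lerDl mulr_ge0. Qed.

Lemma weight_submul kap j k l : 0 <= kap ->
  weight kap (j - k + l) <= weight kap j * weight kap k * weight kap l.
Proof.
move=> k0; rewrite /weight -!exprMn; apply: lerXn2r; rewrite ?nnegrE ?mulr_ge0 ?addr_ge0 ?mulr_ge0 //.
have h : (absz (j - k + l))%:R <= (absz j)%:R + (absz k)%:R + (absz l)%:R :> R.
  by rewrite -!natrD ler_nat; lia.
have : kap * (absz (j - k + l))%:R <= kap * (absz j)%:R + kap * (absz k)%:R + kap * (absz l)%:R.
  by rewrite -!mulrDr; apply: ler_wpM2l.
have key (x y z : R) : 0 <= x -> 0 <= y -> 0 <= z -> 1 + (x + y + z) <= (1 + x) * (1 + y) * (1 + z).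
  move=> x0 y0 z0.
  have xy : 0 <= x * y by rewrite mulr_ge0.
  have yz : 0 <= y * z by rewrite mulr_ge0.
  have xz : 0 <= x * z by rewrite mulr_ge0.
  have xyz : 0 <= x * y * z by rewrite mulr_ge0.
  rewrite (_ : (1 + x) * (1 + y) * (1 + z) = 1 + (x + y + z) + (x * y + y * z + x * z + x * y * z)); last by ring.
  lra.
move=> H; apply: le_trans (key _ _ _ _ _ _); rewrite ?mulr_ge0 //; by rewrite lerD2l.
Qed.

Lemma sum_weight_inv_le kap : 0 < kap <= 1 -> exists W : R, 0 <= W /\
  forall N, \sum_(n <- ints N) (weight kap n)^-1 <= W.
Proof.
move=> /andP[k0 k1]; have [S [S0 hS]] := @sum_bracket_le R 2 ltac:(by rewrite ltr1n).
exists (kap ^- 2 * S); split; first by rewrite mulr_ge0 ?invr_ge0 ?exprn_ge0 ?ltW.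
move=> N; apply: (@le_trans _ _ (\sum_(n <- ints N) kap ^- 2 * jap n `^ (-2))); last first.
  by rewrite -mulr_sumr ler_wpM2l ?hS ?ints_uniq // invr_ge0 exprn_ge0 // ltW.
apply: ler_sum => n _; rewrite powRN powR_mulrn ?bracket_ge0 // -invfM -exprMn.
have p0 : 0 < kap * jap n by rewrite mulr_gt0 // bracket_gt0.
have le : kap * jap n <= 1 + kap * (absz n)%:R by rewrite /bracket mulrDr mulr1 lerD2r.
rewrite /weight lef_pV2 ?posrE ?exprn_gt0 //; last exact: lt_le_trans le.
by apply: lerXn2r => //; rewrite nnegrE ltW // (lt_le_trans p0).
Qed.

(** For small [kap] the weight is close to 1 up to a frequency [L] beyond which the
    decay of [c] outweighs it. *)
Lemma weight_exists (p A G1 : R) (c : int -> R) : 1 <= p -> 0 <= A ->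
  (forall n, 0 <= c n <= A * jap n `^ (-4)) ->
  (forall N, \sum_(n <- ints N) c n `^ p <= G1) ->
  exists kap : R, 0 < kap <= 1 /\
    forall N, \sum_(n <- ints N) weight kap n `^ p * c n `^ p <= 2 * G1 + 1.
Proof.
move=> p1 A0 hc hG.
have p0 : 0 < p by lra.
have c0 n : 0 <= c n by case/andP: (hc n).
have [S [S0 hS]] := @sum_bracket_le R (3 / 2) ltac:(lra).
have X0 : 0 <= (A `^ p * S) ^+ 2 by exact: sqr_ge0.
have L0 (L : nat) : 0 < 1 + L%:R :> R by rewrite ltr_wpDr.
have [L XL] : exists L : nat, A `^ p * S * (1 + L%:R) `^ (- 2^-1) <= 1.
  exists (Num.bound ((A `^ p * S) ^+ 2)).
  rewrite powRN ler_pdivrMr ?powR_gt0 // mul1r powR12_sqrt ?(ltW (L0 _)) //.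
  rewrite -[leLHS]ger0_norm ?mulr_ge0 ?powR_ge0 ?(ltW S0) // -sqrtr_sqr ler_wsqrtr //.
  by apply: le_trans (ltW (archi_boundP X0)) _; rewrite lerDr.
move: (L0 L) => {}L0.
have L1 : 1 <= 1 + L%:R :> R by rewrite lerDl.
have [b [b1 b2 bp]] : exists b : R, [/\ 1 < b, b <= 2 & (b ^+ 2) `^ p = 2].
  have pp0 : 0 < (2 * p)^-1 by rewrite invr_gt0 mulr_gt0.
  have pp1 : (2 * p)^-1 <= 1 by rewrite invf_le1 ?mulr_gt0 //; lra.
  exists (2 `^ (2 * p)^-1); split.
  - by have := @gt0_ltr_powR R _ pp0 1 2; rewrite powR1; apply; rewrite ?nnegrE // ltr1n.
  - by rewrite -[leRHS](@powRr1 _ 2) // ler_powR // ler1n.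
  - by rewrite -powR_mulrn ?powR_ge0 // -!powRrM mulVf ?gt_eqF ?mulr_gt0 // powRr1.
have b0 : 0 <= b by lra.
have [kap [k0 k1 e]] : exists kap : R, [/\ 0 < kap, kap <= 1 & kap * (1 + L%:R) = b - 1].
  exists ((b - 1) / (1 + L%:R)); split.
  - by rewrite divr_gt0 // subr_gt0.
  - by rewrite ler_pdivrMr // mul1r; move: b2 L1; clear; lra.
  - by rewrite divfK // gt_eqF.
exists kap; split; first by rewrite k0.
move=> N.
have term n : weight kap n `^ p * c n `^ p <=
    2 * c n `^ p + A `^ p * (1 + L%:R) `^ (- 2^-1) * jap n `^ (- (3 / 2)).
  have r0 : 0 <= A `^ p * (1 + L%:R) `^ (- 2^-1) * jap n `^ (- (3 / 2)) by rewrite !mulr_ge0 ?powR_ge0.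
  have w0 : 0 <= 1 + kap * (absz n)%:R by rewrite addr_ge0 // mulr_ge0 // ltW.
  case: (leqP (absz n) L) => nL.
    apply: (@le_trans _ _ (2 * c n `^ p)); last by rewrite lerDl.
    apply: ler_wpM2r; first exact: powR_ge0.
    have wb : weight kap n `^ p <= (b ^+ 2) `^ p.
      apply: ge0_ler_powR; rewrite ?nnegrE ?exprn_ge0 //; [exact: ltW |].
      apply: lerXn2r; rewrite ?nnegrE //.
      have kL : kap * (absz n)%:R <= kap * (1 + L%:R).
        by apply: ler_wpM2l; [exact: ltW | rewrite addrC natr1 ler_nat leqW].
      by rewrite -lerBrDl -e.
    by rewrite -bp.
  apply: (@le_trans _ _ (A `^ p * (1 + L%:R) `^ (- 2^-1) * jap n `^ (- (3 / 2)))); last first.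
    by rewrite lerDr mulr_ge0 ?powR_ge0.
  have jn : jap n != 0 by rewrite gt_eqF // bracket_gt0.
  rewrite -(@powRM _ (weight kap n) (c n)) ?exprn_ge0 //.
  have le1 : weight kap n * c n <= A * jap n `^ (-2).
    have wj : weight kap n <= jap n `^ 2.
      rewrite powR_mulrn ?bracket_ge0 //; apply: lerXn2r; rewrite ?nnegrE ?bracket_ge0 //.
      by rewrite /bracket lerD2l ler_piMl.
    apply: le_trans (ler_pM _ _ wj (andP (hc n)).2) _; rewrite ?exprn_ge0 //.
    rewrite mulrCA -powRD ?jn ?implybT //.
    by rewrite (_ : 2 + -4 = -2 :> R) //; ring.
  apply: (@le_trans _ _ (A `^ p * jap n `^ (-2))).
    apply: le_trans (ge0_ler_powR (ltW p0) _ _ le1) _; rewrite ?nnegrE ?mulr_ge0 ?exprn_ge0 ?powR_ge0 //.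
    rewrite powRM ?powR_ge0 // -powRrM ler_wpM2l ?powR_ge0 //.
    by apply: ler_powR; [exact: bracket_ge1 | lra].
  rewrite -mulrA ler_wpM2l ?powR_ge0 //.
  rewrite (_ : -2 = - 2^-1 + - (3 / 2)); last by field.
  rewrite powRD ?jn ?implybT // ler_wpM2r ?powR_ge0 //.
  rewrite !powRN lef_pV2 ?posrE ?powR_gt0 ?bracket_gt0 //.
  apply: ge0_ler_powR; rewrite ?nnegrE ?bracket_ge0 ?(ltW L0) //.
  by rewrite /bracket lerD2l ler_nat ltnW.
apply: le_trans (ler_sum _ (fun n _ => term n)) _; rewrite big_split /= -!mulr_sumr.
apply: lerD; first by apply: ler_wpM2l.
apply: le_trans XL; rewrite [leRHS]mulrAC; apply: ler_wpM2l; first by rewrite mulr_ge0 ?powR_ge0.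
by rewrite hS ?ints_uniq.
Qed.

End Weights.

Section Conclusion.
Variable R : realType.
Local Notation jap := (bracket R).

Lemma small_remainder (X Y d : R) (N0 : nat) : 0 <= X -> 0 <= Y -> 0 < d ->
  exists N : nat, (N0 <= N)%N /\ X * 2^-1 ^+ N + Y / (1 + N%:R) <= d.
Proof.
move=> X0 Y0 d0; pose b := Num.bound ((X + Y) / d).
have hb : (X + Y) / d < b%:R by apply: archi_boundP; rewrite divr_ge0 ?addr_ge0 // ltW.
clearbody b; exists (N0 + b)%N; split; first exact: leq_addr.
have N1 : 0 < 1 + (N0 + b)%:R :> R by rewrite ltr_wpDr.
have p2 : 2^-1 ^+ (N0 + b) <= (1 + (N0 + b)%:R)^-1 :> R.
  rewrite exprVn lef_pV2 ?posrE ?exprn_gt0 // addrC natr1 -natrX ler_nat.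
  exact: ltn_expl.
apply: (@le_trans _ _ ((X + Y) / (1 + (N0 + b)%:R))).
  by rewrite mulrDl lerD2r ler_wpM2l.
rewrite ler_pdivrMr // mulrC -ler_pdivrMr //; apply: le_trans (ltW hb) _.
by rewrite natrD addrA lerDr addr_ge0.
Qed.

(** The truncation and the number of iterations tend to infinity together; the rate
    depends on the solution, the bound does not. *)
Lemma smooth_solution_bound (omega p q G : R) : `|omega| <= 1 -> 1 <= p -> 1 <= q -> p / 3 < q ->
  0 < G ->
  exists T e C : R, [/\ 0 < T, 0 < e, 0 < C &
    forall (u0 : R -> R[i]) (U : R -> R -> R[i]), smooth_NLS_solution omega u0 U ->
      (forall N, \sum_(n <- ints N) cabs (coef u0 n) `^ p <= G) ->
      forall t N, 0 <= t <= T ->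
        \sum_(n <- ints N) cabs (profile U n t - coef u0 n) `^ q <= (C * t `^ e) `^ q].
Proof.
move=> om1 p1 q1 pq G0.
(* Chosen so that 3 * q / (1 + 2 * lam) = p; it is positive because p / 3 < q. *)
pose lam := (3 * q / p - 1) / 2.
have p0 : 0 < p by move: p1; clear; lra.
have q0 : 0 < q by move: q1; clear; lra.
have l0 : 0 < lam.
  rewrite divr_gt0 // subr_gt0 ltr_pdivlMr // mul1r.
  by move: pq; rewrite ltr_pdivrMr // mulrC.
have pE : 3 * q / (1 + 2 * lam) = p.
  rewrite /lam mulrCA divff // mulr1 [1 + _]addrC subrK; field.
  by rewrite !gt_eqF.
have GG : 0 < 2 * G + 1 by rewrite addr_gt0 // mulr_gt0.
have := @apriori R q lam (2 * G + 1) q1 l0 GG; rewrite /= pE => /(_ p1).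
move=> [T [e [C [T01 e0 C0 ap]]]].
have /andP[T0 T1] := T01.
exists T, e, C; split => // u0 U sol hG t N0 ht.
have [A [B [K [A0 B0 K0 [dec evo]]]]] := truncated_evolution sol T om1.
have p00 n : profile U n 0 = coef u0 n.
  have -> : u0 = U 0 by case: sol => _ _ _ h _; apply/funext => x; rewrite h.
  by rewrite /profile mulr0 cexpi0 mul1r.
have dec0 n : 0 <= cabs (coef u0 n) <= A * jap n `^ (-4).
  by rewrite cabs_ge0 -p00 dec // lexx ltW.
have [kap [k01 hk]] := weight_exists p1 A0 dec0 hG.
have k0 : 0 <= kap by case/andP: k01 => /ltW.
have [W [W0 hW]] := sum_weight_inv_le k01.
pose E := expR (6 * (B + C * W + 1) ^+ 2 * t).
have E0 : 0 <= E by exact: expR_ge0.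
have BW : 0 <= B + C * W + 1 by rewrite !addr_ge0 // mulr_ge0 // ltW.
apply: sum_powR_closed => //; first exact: powR_ge0.
move=> d d0.
have [N [N0N hN]] := @small_remainder (2 * (B + C * W + 1) * E) (K * E) d N0
   (mulr_ge0 (mulr_ge0 (ler0n _ _) BW) E0) (mulr_ge0 K0 E0) d0.
have [err [ode herr hx]] := evo N.
have [] := ap T ('i * omega%:C) N (weight kap) W B (K / (1 + N%:R))
   (fun n t => cut N (profile U ^~ t) n) err (coef u0) _ _ _ _ (hk N) (hW N) _ _ ode herr hx N.
- by rewrite T0 lexx.
- by rewrite cabsM cabs_i mul1r cabs_real.
- by move=> n; exact: weight_ge1.
- by move=> j k l; exact: weight_submul.
- by move=> n nN; rewrite /cut nN.
- by move=> n s /negbTE nN; rewrite /cut nN.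
move=> a [ha hxa].
have close n : n \in ints N0 -> cabs (profile U n t - coef u0 n) <= cabs (a n t - coef u0 n) + d.
  move=> nN0; have nN : n \in ints N by move: nN0; rewrite !mem_ints => /leq_trans; apply.
  have -> : profile U n t - coef u0 n = (a n t - coef u0 n) + (profile U n t - a n t) by ring.
  apply: le_trans (cabsD _ _) _; rewrite lerD2l.
  have -> : profile U n t = cut N (profile U ^~ t) n by rewrite /cut nN.
  apply: (@le_trans _ _ (\sum_(k <- ints N) cabs (cut N (profile U ^~ t) k - a k t))).
    by rewrite (big_rem _ nN) lerDl; apply: sumr_ge0 => k _; exact: cabs_ge0.
  apply: le_trans (hxa t ht) _; apply: le_trans hN; rewrite -/E.
  by rewrite le_eqVlt; apply/orP; left; apply/eqP; ring.
exists (fun n => cabs (a n t - coef u0 n)); split.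
- by move=> n; exact: cabs_ge0.
- apply: le_trans (ha t ht); apply: sum_ge0_subset; rewrite ?ints_uniq //.
    by move=> n; rewrite !mem_ints => /leq_trans; apply.
  by move=> n; exact: powR_ge0.
- exact: close.
Qed.

End Conclusion.

(* tau0 is the length of the interval on which S u0 is defined. *)
Theorem proposition1p3 (R : realType) (omega r p q tau0 : R)
    (homega : omega = 1 \/ omega = -1) (hp : 1 <= p)
    (hq : p / 3 < q) (hq1 : 1 <= q) (htau0 : 0 < tau0) :
  exists tau eps C : R,
    [/\ 0 < tau, tau <= tau0, 0 < eps &
      forall (u0 : functional R) (u v : R -> functional R),
        in_H p u0 -> (Hnorm p u0 <= r%:E)%E ->
        NLS_solution omega p tau0 u0 u -> linear_solution u0 v ->
        forall t : R, 0 <= t <= tau ->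
          (Hnorm q (distr_sub (u t) (v t)) <= (C * t `^ eps)%:E)%E].
Proof.
have om1 : `|omega| <= 1 by case: homega => ->; rewrite ?normrN normr1.
have p0 : 0 < p by move: hp; clear; lra.
have q0 : 0 < q by move: hq1; clear; lra.
(* Bounds the datum of the approximating solutions that are within 1 of u0. *)
pose G := 2 `^ p * (1 + `|r| `^ p).
have G0 : 0 < G by rewrite mulr_gt0 ?powR_gt0 // ltr_pwDl // powR_ge0.
have [T [e [C [T0 e0 C0 H]]]] := smooth_solution_bound om1 hp hq1 hq G0.
exists (Num.min T tau0), e, C; split => //.
- by rewrite lt_min T0 htau0.
- by rewrite ge_min lexx orbT.
move=> u0 u v _ hr [_ [g [U [sg sU gu0 Uu]]]] lin t /andP[t0]; rewrite le_min => /andP[tT ttau].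
have ht : 0 <= t <= T by rewrite t0.
have ht' : 0 <= t <= tau0 by rewrite t0.
have Y0 : 0 <= C * t `^ e by rewrite mulr_ge0 ?powR_ge0 // ltW.
apply/Hnorm_leP => // N.
apply: sum_powR_closed => //; [exact: powR_ge0 | by move=> n; exact: cabs_ge0 |].
move=> d d0.
pose d' := Num.min 1 (d / 2).
have d'0 : 0 < d' by rewrite lt_min ltr01 divr_gt0.
have d'1 : d' <= 1 by rewrite ge_min lexx.
have d'd : d' <= d / 2 by rewrite ge_min lexx orbT.
(* The datum and the solution at time t are approximated simultaneously. *)
have near1 : \forall k \near \oo, (Hnorm p (distr_sub (distr_of_fun (g k)) u0) < d'%:E)%E.
  apply: (gu0 [set y | (y < d'%:E)%E]).
  by apply: open_ereal_lt'; rewrite lte_fin.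
have [k [hk1 /(_ t ht') hk2]] := filter_ex (filterI near1 (Uu d' d'0)).
have hG N' : \sum_(n <- ints N') cabs (coef (g k) n) `^ p <= G.
  have hr' : (Hnorm p u0 <= (`|r|)%:E)%E.
    by apply: le_trans hr _; rewrite lee_fin ler_norm.
  have s1 := (Hnorm_leP _ p0 (normr_ge0 r)).1 hr' N'.
  have s2 := (Hnorm_leP _ p0 (ltW d'0)).1 (ltW hk1) N'.
  apply: (@le_trans _ _ (\sum_(n <- ints N') 2 `^ p *
     (cabs (fourier (distr_sub (distr_of_fun (g k)) u0) n) `^ p + cabs (fourier u0 n) `^ p))).
    apply: ler_sum => n _; apply: le_trans (powR_add_le _ _ (ltW p0)); rewrite ?cabs_ge0 //.
    apply: ge0_ler_powR; rewrite ?nnegrE ?addr_ge0 ?cabs_ge0 //; first exact: ltW.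
    by apply: le_trans (cabsD _ _); rewrite fourier_sub subrK.
  rewrite -mulr_sumr big_split /= ler_wpM2l ?powR_ge0 // lerD //.
  apply: le_trans s2 _; have := @ge0_ler_powR R p (ltW p0) d' 1; rewrite powR1 !nnegrE.
  by apply => //; exact: ltW.
have close n : cabs (fourier (distr_sub (u t) (v t)) n) <= cabs (profile (U k) n t - coef (g k) n) + d.
  have b1 := cabs_fourier_le n p0 (ltW d'0) (ltW hk1).
  have b2 := cabs_fourier_le n p0 (ltW d'0) hk2.
  rewrite fourier_sub in b1; rewrite fourier_sub in b2.
  have [_ /(_ n) lv] := lin t t0.
  pose c : R[i] := cexpi (n%:~R ^+ 2 * t).
  have cc : c * cexpi (- (n%:~R ^+ 2 * t)) = 1 by rewrite -cexpiD subrr cexpi0.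
  have -> : cabs (fourier (distr_sub (u t) (v t)) n) = cabs (c * (fourier (distr_sub (u t) (v t)) n)).
    by rewrite cabsM cabs_cexpi mul1r.
  rewrite fourier_sub lv mulrBr (mulrA c (cexpi _)) cc mul1r.
  have -> : c * fourier (u t) n - fourier u0 n = (profile (U k) n t - coef (g k) n) +
     (- (c * (fourier (distr_of_fun (U k t)) n - fourier (u t) n)) +
     (fourier (distr_of_fun (g k)) n - fourier u0 n)).
    rewrite /profile /coef -/c; ring.
  apply: le_trans (cabsD _ _) _; rewrite lerD2l.
  apply: le_trans (cabsD _ _) _; rewrite cabsN (cabsM c) cabs_cexpi mul1r.
  by move: (le_trans b1 d'd) (le_trans b2 d'd); clear; lra.
exists (fun n => cabs (profile (U k) n t - coef (g k) n)); split.
- by move=> n; exact: cabs_ge0.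
- exact: H (sU k) hG t N ht.
- by move=> n _; exact: close.
Qed.
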